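(* Let $\xi$ be a.s. non-negative with finite variance, and let $K$ be a compact set in $\mathbb R^d$. If $$\mathbf E\left[\xi^2\,\frac{\log^{d-1}|\xi|}{\log\log|\xi|}\right]<\infty,$$ then $$\liminf_{t\to\infty}\sqrt t\,\rho_{\mathrm H}(t^{-1/d}\mathcal M_t,\mathcal H)=0\quad\text{a.s.},\qquad \liminf_{t\to\infty}\sqrt t\,\rho_\triangle^K(t^{-1/d}\mathcal M_t,\mathcal H)=0\quad\text{a.s.}$$ If, additionally, $K\subset(0,\infty)^d$, then the second equality (for $\rho_\triangle^K$) holds provided only that $\mathbf E\xi^2<\infty$ (in place of the displayed moment condition).
   Context: Throughout, $d\ge2$ is an integer, $\mathbb N=\{1,2,\dots\}$, $\mathbb R_+^d=[0,\infty)^d$. Components of a vector $x$ are $x^1,\dots,x^d$; for a vector $x\in\mathbb R_+^d$ write $|x|=x^1\cdots x^d$ (product of components), while for a real number $|\cdot|$ is the absolute value. $m\le n$ for vectors is the componentwise order. Convention: $\log c$ and $\log\log c$ have the usual meaning for $c\ge e$, resp. $c\ge e^e$, and are set equal to $1$ for $c\in[0,e)$, resp. $c\in[0,e^e)$; $\log^{d-1}c=(\log c)^{d-1}$. $\{\xi_m,\ m\in\mathbb N^d\}$ are independent copies of an integrable random variable $\xi$ with finite mean $\mu=\mathbf E\xi>0$. $S_n=\sum_{m\le n}\xi_m$ for $n\in\mathbb N^d$, and $S_n=0$ if $n$ has non-negative integer components at least one of which is zero. $S$ is extended to $\mathbb R_+^d$ by piecewise multilinear interpolation: $S_x=\sum_{k\in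 C_x}v_k(x)S_{k^*}$, where $C_x$ is the set of vertices of a unit cube (with integer vertices, in $\mathbb R_+^d$) containing $x$, $v_k(x)=\prod_{i=1}^d|x^i-k^i|$ is the volume of the axis-parallel box with diagonally opposite vertices $k$ and $x$, and $k^*$ is the vertex of the cube opposite to $k$ (the value does not depend on the choice of the cube). Renewal sets: $\mathcal M_t=\{x\in\mathbb R_+^d: S_x\ge t\}$, $t>0$. $\mathcal H=\{x\in\mathbb R_+^d:|x|\ge\mu^{-1}\}$. Hausdorff distance: $\rho_{\mathrm H}(X,Y)=\max\{\sup_{x\in X}\inf_{y\in Y}\rho(x,y),\ \sup_{y\in Y}\inf_{x\in X}\rho(x,y)\}$ for $X,Y\subset\mathbb R^d$, with $\rho$ the Euclidean distance. Localised symmetric difference distance: $\rho_\triangle^K(X,Y)=\lambda_d(K\cap(X\triangle Y))$ for Borel $X,Y,K\subset\mathbb R^d$, with $\lambda_d$ the Lebesgue measure. *)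

(* Defs.v *)
From mathcomp Require Export all_boot all_order all_algebra.
From mathcomp Require Export all_classical all_reals all_analysis.

Set Implicit Arguments.
Unset Strict Implicit.
Unset Printing Implicit Defensive.
Export Order.TTheory GRing.Theory Num.Theory.
Export numFieldNormedType.Exports.

Local Open Scope classical_set_scope.
Local Open Scope ring_scope.

Section logarithms.
Context {R : realType}.
Implicit Types c : R.

(* The conventions log c = 1 for 0 <= c < e and log log c = 1 for
   0 <= c < e^e. *)
Definition log1 c : R := if c < expR 1 then 1 else ln c.

Definition loglog1 c : R :=
  if c < expR (expR 1) then 1 else ln (ln c).

End logarithms.

Section random_variables.
Context {d : measure_display} {T : measurableType d} {R : realType}.
Variable P : probability T R.

Definition mutually_independent {I : choiceType} (D : set I)
    (X : I -> {RV P >-> R}) : Prop :=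
  forall (s : seq I) (A : I -> set R),
    uniq s -> [set` s] `<=` D -> (forall i, measurable (A i)) ->
    P (\bigcap_(i in [set` s]) (X i @^-1` A i)) =
      (\prod_(i <- s) P (X i @^-1` A i))%E.

Definition same_law (X Y : {RV P >-> R}) : Prop :=
  forall A : set R, measurable A -> distribution P X A = distribution P Y A.

Definition independent_copies {I : choiceType} (D : set I)
    (X : I -> {RV P >-> R}) (Y : {RV P >-> R}) : Prop :=
  mutually_independent D X /\ (forall i, D i -> same_law (X i) Y).

End random_variables.

Section euclidean_sets.
Context {R : realType} {d : nat}.
Implicit Types (x y a b : 'rV[R]_d) (X Y K : set 'rV[R]_d).

Definition orthant : set 'rV[R]_d := [set x | forall i, 0 <= x 0 i].

Definition open_orthant : set 'rV[R]_d := [set x | forall i, 0 < x 0 i].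

Definition euclidean_dist x y : R :=
  Num.sqrt (\sum_(i < d) (x 0 i - y 0 i) ^+ 2).

(* Extended-real valued: the sets of interest are unbounded. *)
Definition hausdorff_dist X Y : \bar R :=
  Order.max
    (ereal_sup [set ereal_inf [set (euclidean_dist x y)%:E | y in Y] | x in X])
    (ereal_sup [set ereal_inf [set (euclidean_dist x y)%:E | x in X] | y in Y]).

Definition box a b : set 'rV[R]_d :=
  [set x | forall i, a 0 i < x 0 i <= b 0 i].

Definition box_volume a b : R := \prod_(i < d) (b 0 i - a 0 i).

(* The Lebesgue outer measure on R^d; its restriction to the Borel (more
   generally, Lebesgue measurable) sets is the Lebesgue measure.  Half-open
   boxes play the role that half-open intervals play in the construction of
   lebesgue_measure on R. *)
Definition lebesgue_rV (A : set 'rV[R]_d) : \bar R :=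
  ereal_inf [set (\sum_(k <oo) (box_volume (ab k).1 (ab k).2)%:E)%E |
    ab in [set ab : nat -> 'rV[R]_d * 'rV[R]_d |
      (forall k i, (ab k).1 0 i <= (ab k).2 0 i) /\
      A `<=` \bigcup_k box (ab k).1 (ab k).2]].

Definition symdiff_dist K X Y : \bar R := lebesgue_rV (K `&` (X `+` Y)).

Definition dilate (c : R) X : set 'rV[R]_d := [set c *: x | x in X].

Definition hyperbolic_set (mu : R) : set 'rV[R]_d :=
  [set x | orthant x /\ mu^-1 <= \prod_(i < d) x 0 i].

End euclidean_sets.

Section renewal_sets.
Context {R : realType} {d : nat}.

Definition positive_index : set {ffun 'I_d -> nat} :=
  [set m | forall i, (0 < m i)%N].

(* xi is a realisation of the field; its values outside positive_index are
   irrelevant. *)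
Variable xi : {ffun 'I_d -> nat} -> R.

Definition partial_sum (n : {ffun 'I_d -> nat}) : R :=
  \sum_(m \in [set m : {ffun 'I_d -> nat} | forall i, (0 < m i <= n i)%N]) xi m.

Definition cube_vertex (x : 'rV[R]_d) (e : {ffun 'I_d -> bool}) :
    {ffun 'I_d -> nat} :=
  [ffun i : 'I_d => (Num.truncn (x 0%R i) + e i)%N].

Definition opposite (e : {ffun 'I_d -> bool}) : {ffun 'I_d -> bool} :=
  [ffun i => ~~ e i].

(* Piecewise multilinear interpolation of the partial sums at a point x of the
   orthant; among the cubes containing x, we use the one whose lowest vertex is
   the integer part of x. *)
Definition interpolated_sum (x : 'rV[R]_d) : R :=
  \sum_(e : {ffun 'I_d -> bool})
    (\prod_(i < d) `|x 0 i - (cube_vertex x e i)%:R|) *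
    partial_sum (cube_vertex x (opposite e)).

Definition renewal_set (t : R) : set 'rV[R]_d :=
  [set x | orthant x /\ t <= interpolated_sum x].

Definition scaled_renewal_set (t : R) : set 'rV[R]_d :=
  dilate (t `^ (- d%:R^-1)) (renewal_set t).

End renewal_sets.

(* Main.v *)
Require Import Defs.
From mathcomp Require Import measurable_realfun.
From mathcomp Require Import ring lra zify.

(** Write [N = scale J = 2 ^ J], [t = N ^ d] and [rt J = N ^ (d / 2)], so that [sqrt t = rt J], and let
    [|y|] be the product of the coordinates of [y]. It suffices to find, almost surely and for every
    [eps > 0], infinitely many [J] for which both distances at [t] are at most [C * eps / rt J],
    with [C] independent of [eps].

    Geometry. Let [good eps J] be the event that the centred sums satisfy
    [|S_n - mu * |n|| <= eps * rt J * weight J n] for all [n]. On this event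
    [G y = S_(N * y) / N ^ d] differs from [mu * |y|] by at most
    [eta * (1 + |y|) * (1 + 2 * \sum_i 1 / y_i)] where [eta = eps / rt J] ([rescaled_near]). As the
    variables are nonnegative, [G] is nondecreasing, and it vanishes on the coordinate hyperplanes. A
    move of length [C * eta] along the smallest coordinate of [y] changes [mu * |y|] by more than
    this error, so the sets [1 <= G] and [1 <= mu * |y|] are within Hausdorff distance [C * eta]
    ([hausdorff_level_sets]). In a bounded region the symmetric difference lies in a layer of
    relative thickness [O (eta)] around [mu * |y| = 1] that stays away from the coordinate
    hyperplanes ([symdiff_level_sets]), and such a layer has volume [O (eta)]
    ([hyperbolic_layer_volume]).

    Probability. It remains to see that [good eps J] occurs for infinitely many [J]
    ([good_infinitely_often]). The point is a small ball estimate ([small_ball]): with a probability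
    bounded below uniformly in [J], the field is small on a cube whose side is a large multiple of
    [N]. Two independent copies of the field on such a cube are close to each other with a
    probability bounded below: outside of unlikely events a copy is described by a code from a
    finite set of fixed size, and by the pigeonhole principle two of many copies share a likely
    code ([twin_boxes]). Their difference divided by [sqrt 2] has the covariances of the field, and
    Lindeberg's replacement of one variable after the other ([lindeberg_chain]) transfers the
    estimate to the field. The field beyond the cube and the oscillation between
    grid points are controlled by a maximal inequality for sums over boxes ([maxdev_tail]), obtained from
    Ottaviani's inequality in each coordinate and from a truncation. Finally, along a rapidly
    increasing sequence of scales the variables used by earlier scales become negligible, so that
    the attempts are nearly independent, and all of them fail with probability 0 ([trials]). *)

Set Implicit Arguments.
Unset Strict Implicit.
Unset Printing Implicit Defensive.

Local Open Scope classical_set_scope.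
Local Open Scope ring_scope.

(** * Probabilities and expectations as real numbers *)


Section expectation.
Context {disp : measure_display} {T : measurableType disp} {R : realType}.
Variable P : probability T R.
Implicit Types (f g : T -> R) (A B : set T).

(** Probabilities and expectations are used as elements of [R] rather than of the
    extended reals, so that [lra] and [ring] apply to them. *)
Definition prob A : R := fine (P A).
Definition integ f := P.-integrable [set: T] (EFin \o f).
Definition ex f : R := (\int[P]_w f w)%R.

Lemma probE A : measurable A -> P A = (prob A)%:E.
Proof. by move=> mA; rewrite /prob fineK// fin_num_measure. Qed.

Lemma prob_ge0 A : 0 <= prob A.
Proof. by rewrite fine_ge0. Qed.

Lemma prob_le1 A : measurable A -> prob A <= 1.
Proof. by move=> mA; rewrite -lee_fin -probE// probability_le1. Qed.

Lemma probT : prob setT = 1.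
Proof. by rewrite /prob probability_setT. Qed.

Lemma le_prob A B : measurable A -> measurable B -> A `<=` B -> prob A <= prob B.
Proof.
by move=> mA mB AB; rewrite -lee_fin -!probE//; apply: le_measure; rewrite ?inE.
Qed.

Lemma probC A : measurable A -> prob (~` A) = 1 - prob A.
Proof. by move=> mA; rewrite /prob probability_setC// fineB ?fin_num_measure. Qed.

Lemma probU_le A B : measurable A -> measurable B ->
  prob (A `|` B) <= prob A + prob B.
Proof.
move=> mA mB; rewrite -lee_fin EFinD -!probE//; last exact: measurableU.
exact: measureU2.
Qed.

Lemma probI_ge A B : measurable A -> measurable B ->
  prob A + prob B - 1 <= prob (A `&` B).
Proof.
move=> mA mB; have := @probU_le (~` A) (~` B) (measurableC mA) (measurableC mB).
rewrite -setCI !probC//; last exact: measurableI.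
lra.
Qed.

Lemma prob_bigU_le (I : Type) (s : seq I) (Q : pred I) (F : I -> set T) :
  (forall i, measurable (F i)) ->
  prob (\big[setU/set0]_(i <- s | Q i) F i) <= \sum_(i <- s | Q i) prob (F i).
Proof.
move=> mF; elim: s => [|i s IH]; first by rewrite !big_nil /prob measure0.
rewrite !big_cons; case: ifP => // Qi.
apply: le_trans (probU_le _ _) _ => //; first exact: bigsetU_measurable.
by rewrite lerD2l.
Qed.

Lemma prob_trivI (n : nat) (F : nat -> set T) :
  (forall i, measurable (F i)) -> trivIset setT F ->
  prob (\big[setU/set0]_(i < n) F i) = \sum_(i < n) prob (F i).
Proof.
move=> mF tF; rewrite /prob measure_semi_additive//; last exact: bigsetU_measurable.
by rewrite sum_fine// => i _; exact: fin_num_measure.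
Qed.

Lemma integD f g : integ f -> integ g -> integ (fun w => f w + g w).
Proof. by move=> If Ig; exact: (integrableD measurableT If Ig). Qed.

Lemma integB f g : integ f -> integ g -> integ (fun w => f w - g w).
Proof. by move=> If Ig; exact: (integrableB measurableT If Ig). Qed.

Lemma integZ c f : integ f -> integ (fun w => c * f w).
Proof. by move=> If; exact: (integrableZl measurableT c If). Qed.

Lemma integ_cst c : integ (fun=> c).
Proof. exact: finite_measure_integrable_cst. Qed.

Lemma integ_le f g : measurable_fun setT f -> integ g ->
  (forall w, `|f w| <= g w) -> integ f.
Proof.
move=> mf Ig fg; apply: le_integrable Ig => //; first exact/measurable_EFinP.
move=> w _ /=; rewrite lee_fin; apply: le_trans (fg w) (ler_norm _).
Qed.

Lemma integ_bounded f K : measurable_fun setT f -> (forall w, `|f w| <= K) ->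
  integ f.
Proof. by move=> mf fK; apply: (integ_le mf (integ_cst K)). Qed.

Lemma exD f g : integ f -> integ g -> ex (fun w => f w + g w) = ex f + ex g.
Proof. by move=> If Ig; rewrite /ex RintegralD. Qed.

Lemma exB f g : integ f -> integ g -> ex (fun w => f w - g w) = ex f - ex g.
Proof. by move=> If Ig; rewrite /ex RintegralB. Qed.

Lemma exZ c f : integ f -> ex (fun w => c * f w) = c * ex f.
Proof. by move=> If; rewrite /ex RintegralZl. Qed.

Lemma ex_cst c : ex (fun=> c) = c.
Proof. by rewrite /ex Rintegral_cst// -/(prob _) probT mulr1. Qed.

Lemma ex_le f g : integ f -> integ g -> (forall w, f w <= g w) -> ex f <= ex g.
Proof. by move=> If Ig fg; apply: le_Rintegral. Qed.

Lemma ex_ge0 f : (forall w, 0 <= f w) -> 0 <= ex f.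
Proof. by move=> f0; apply: Rintegral_ge0. Qed.

Lemma eq_ex f g : f =1 g -> ex f = ex g.
Proof. by move=> /funext ->. Qed.

Lemma normr_ex_le f g : measurable_fun setT f -> integ g ->
  (forall w, `|f w| <= g w) -> `|ex f| <= ex g.
Proof.
move=> mf Ig fg; have If := integ_le mf Ig fg.
rewrite ler_norml; apply/andP; split.
  rewrite -mulN1r -exZ//; apply: ex_le => //; first exact: integZ.
  by move=> w; have := fg w; rewrite ler_norml mulN1r => /andP[].
by apply: ex_le => // w; have := fg w; rewrite ler_norml => /andP[].
Qed.

Lemma integ_indic A : measurable A -> integ \1_A.
Proof.
move=> mA; apply: (@integ_bounded _ 1) => // w.
by rewrite indicE; case: (_ \in _); rewrite ?normr1 ?normr0.
Qed.

Lemma ex_indic A : measurable A -> ex \1_A = prob A.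
Proof. by move=> mA; rewrite /ex /Rintegral integral_indic// setIT. Qed.

Lemma markov_prob A f c : measurable A -> integ f -> (forall w, 0 <= f w) ->
  0 < c -> (forall w, A w -> c <= f w) -> prob A <= ex f / c.
Proof.
move=> mA If f0 c0 Af; rewrite ler_pdivlMr// mulrC -ex_indic// -exZ; last first.
  exact: integ_indic.
apply: ex_le => //; first by apply: integZ; exact: integ_indic.
move=> w; rewrite indicE; case: (boolP (w \in A)) => wA /=.
  by rewrite mulr1; apply: Af; rewrite inE in wA.
by rewrite mulr0.
Qed.

End expectation.

(** * Events and functions depending on part of the field *)


Section independence.
Context {disp : measure_display} {T : measurableType disp} {R : realType}.
Variable P : probability T R.
Context {I : choiceType}.
Variables (Dom : set I) (X : I -> {RV P >-> R}).
Hypothesis indX : mutually_independent Dom X.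
Implicit Types (D : set I) (f g : T -> R) (E F : set T).

Definition info D : set (set T) :=
  [set E | exists i A, [/\ D i, measurable A & E = X i @^-1` A]].

Definition sig D : set (set T) := <<s info D >>.

Definition cylinders D : set (set T) :=
  [set E | exists s A, [/\ uniq s, [set` s] `<=` D,
    (forall i : I, measurable (A i : set R)) &
    E = \bigcap_(i in [set` s]) (X i @^-1` A i)]].

(** Cylinders form a pi-system: the constraints of two cylinders are merged
    coordinate by coordinate. *)
Lemma cylindersI D : setI_closed (cylinders D).
Proof.
move=> _ _ [s1 [A1 [u1 sD1 mA1 ->]]] [s2 [A2 [u2 sD2 mA2 ->]]].
exists (undup (s1 ++ s2)), (fun i => (if i \in s1 then A1 i else setT) `&`
  (if i \in s2 then A2 i else setT)); split.
- exact: undup_uniq.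
- move=> i /=; rewrite mem_undup mem_cat => /orP[]; [exact: sD1|exact: sD2].
- by move=> i; apply: measurableI; case: ifP.
apply/seteqP; split => w /=.
  move=> [w1 w2] i /= _; split; case: ifP => // si; [exact: w1|exact: w2].
move=> w12; split => i /= si.
  by have := w12 i; rewrite /= mem_undup mem_cat si => /(_ isT)[].
by have := w12 i; rewrite /= mem_undup mem_cat si orbT => /(_ isT)[].
Qed.

Lemma info_cylinders D : info D `<=` cylinders D.
Proof.
move=> _ [i [A [Di mA ->]]]; exists [:: i], (fun=> A); split => //.
  by move=> j /=; rewrite inE => /eqP ->.
apply/seteqP; split => w /=; last by apply; rewrite /= inE eqxx.
by move=> Aw j /=; rewrite inE => /eqP ->.
Qed.

Lemma cylinders_measurable D : cylinders D `<=` measurable.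
Proof.
move=> _ [s [A [us sD mA ->]]].
apply: fin_bigcap_measurable => [|i _]; first exact: finite_seq.
by rewrite -[X in measurable X]setTI; exact: measurable_funP.
Qed.

Lemma sig_cylinders D : sig D `<=` <<d cylinders D >>.
Proof.
rewrite (setI_closed_g_dynkin_g_sigma_algebra (@cylindersI D)).
by apply: sub_sigma_algebra2; exact: info_cylinders.
Qed.

Lemma sig_sub D1 D2 : D1 `<=` D2 -> sig D1 `<=` sig D2.
Proof.
move=> D12; apply: sub_sigma_algebra2 => E [i [A [Di mA ->]]].
by exists i, A; split => //; exact: D12.
Qed.

Lemma sig_measurable D : sig D `<=` measurable.
Proof.
apply: smallest_sub; first exact: sigma_algebra_measurable.
by move=> E /info_cylinders /cylinders_measurable.
Qed.

Lemma dynkin_indep F : measurable F ->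
  dynkin [set E | measurable E /\ P (E `&` F) = (P E * P F)%E].
Proof.
move=> mF; split.
- by split => //; rewrite setTI probability_setT mul1e.
- move=> E [mE EF]; split; first exact: measurableC.
  have pf := probE P mF; have pe := probE P mE.
  transitivity (P F - P E * P F)%E.
    rewrite setIC -setDE measureD//; last by rewrite ltey_eq fin_num_measure.
    by rewrite (setIC F E); congr (_ - _)%E; exact: EF.
  rewrite probability_setC// pf pe.
  by congr _%:E; ring.
- move=> E tE mE; split; first by apply: bigcup_measurable => n _; case: (mE n).
  rewrite setI_bigcupl measure_semi_bigcup//; first last.
  + by apply: bigcup_measurable => n _; apply: measurableI => //; case: (mE n).
  + by apply: trivIset_setIr.
  + by move=> n; apply: measurableI => //; case: (mE n).
  rewrite measure_semi_bigcup//; first last.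
  + by apply: bigcup_measurable => n _; case: (mE n).
  + by move=> n; case: (mE n).
  rewrite muleC (probE P mF) -nneseriesZl//.
  by apply: eq_eseriesr => n _; rewrite muleC -probE//; case: (mE n).
Qed.

(** Independence passes from cylinders to the generated sigma-algebras by two
    applications of the pi-lambda theorem, one in each variable. *)
Lemma sig_indep D1 D2 E F : D1 `<=` Dom -> D2 `<=` Dom -> D1 `&` D2 = set0 ->
  sig D1 E -> sig D2 F -> P (E `&` F) = (P E * P F)%E.
Proof.
move=> D1D D2D D12 sE sF.
suff: [set E | measurable E /\ P (E `&` F) = (P E * P F)%E] E by case.
move/sig_cylinders : sE; apply: smallest_sub.
  by apply: dynkin_indep; exact: sig_measurable sF.
move=> {}E cE; split; first exact: cylinders_measurable cE.
suff: [set F | measurable F /\ P (F `&` E) = (P F * P E)%E] F.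
  by case; rewrite setIC muleC.
move/sig_cylinders : sF; apply: smallest_sub.
  by apply: dynkin_indep; exact: cylinders_measurable cE.
move=> {}F cF; split; first exact: cylinders_measurable cF.
move: cE cF => [s1 [A1 [u1 sD1 mA1 ->]]] [s2 [A2 [u2 sD2 mA2 ->]]].
have disj i : i \in s1 -> i \in s2 -> False.
  move=> i1 i2; suff: set0 i by [].
  by rewrite -D12; split; [exact: sD1|exact: sD2].
pose A i := if i \in s1 then A1 i else A2 i.
have E1 : \bigcap_(i in [set` s1]) (X i @^-1` A1 i) =
          \bigcap_(i in [set` s1]) (X i @^-1` A i).
  by apply: eq_bigcapr => i /= i1; rewrite /A i1.
have E2 : \bigcap_(i in [set` s2]) (X i @^-1` A2 i) =
          \bigcap_(i in [set` s2]) (X i @^-1` A i).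
  apply: eq_bigcapr => i /= i2; rewrite /A; case: ifPn => // i1.
  by case: (disj i).
have mA i : measurable (A i) by rewrite /A; case: ifP.
rewrite E1 E2 [in RHS]indX//; last by move=> i /= /sD2; exact: D2D.
rewrite [in RHS]indX//; last by move=> i /= /sD1; exact: D1D.
rewrite -big_cat -bigcap_setU.
have -> : [set` s2] `|` [set` s1] = [set` s2 ++ s1].
  by apply/seteqP; split => i /=; rewrite mem_cat; [move=> [->|->//]; rewrite ?orbT|move/orP].
apply: indX => //.
- rewrite cat_uniq u2 u1 andbT/=; apply/hasPn => i i1.
  by apply/negP => i2; exact: (disj i).
- by move=> i /=; rewrite mem_cat => /orP[/sD2|/sD1]; [exact: D2D|exact: D1D].
Qed.

Lemma sig_prob_indep D1 D2 E F : D1 `<=` Dom -> D2 `<=` Dom -> D1 `&` D2 = set0 ->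
  sig D1 E -> sig D2 F -> prob P (E `&` F) = prob P E * prob P F.
Proof.
move=> D1D D2D D12 sE sF; rewrite /prob (sig_indep D1D D2D D12)// fineM//.
  by apply: fin_num_measure; exact: sig_measurable sE.
by apply: fin_num_measure; exact: sig_measurable sF.
Qed.

(** Measurability with respect to [sig D], through preimages, so that the closure properties of
    [sig D] apply to events directly. *)
Definition smeas D f : Prop := forall A, measurable A -> sig D (f @^-1` A).

Lemma smeasP D f : smeas D f <->
  measurable_fun [set: g_sigma_algebraType (info D)] (f : g_sigma_algebraType (info D) -> R).
Proof.
split=> [sf _ A mA|mf A mA]; first by rewrite setTI; exact: sf.
by have := mf measurableT A mA; rewrite setTI.
Qed.

Lemma smeas_sub D1 D2 f : D1 `<=` D2 -> smeas D1 f -> smeas D2 f.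
Proof. by move=> D12 sf A /sf; exact: sig_sub. Qed.

Lemma smeas_measurable D f : smeas D f -> measurable_fun setT f.
Proof. by move=> sf _ A mA; rewrite setTI; apply: (@sig_measurable D); exact: sf. Qed.

Lemma smeasX D i : D i -> smeas D (X i).
Proof. by move=> Di A mA; apply: sub_sigma_algebra; exists i, A. Qed.

Lemma smeas_cst D c : smeas D (fun=> c).
Proof. by apply/smeasP; exact: measurable_cst. Qed.

Lemma smeasD D f g : smeas D f -> smeas D g -> smeas D (fun w => f w + g w).
Proof. by move=> /smeasP ? /smeasP ?; apply/smeasP; exact: measurable_funD. Qed.

Lemma smeasB D f g : smeas D f -> smeas D g -> smeas D (fun w => f w - g w).
Proof. by move=> /smeasP ? /smeasP ?; apply/smeasP; exact: measurable_funB. Qed.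

Lemma smeasM D f g : smeas D f -> smeas D g -> smeas D (fun w => f w * g w).
Proof. by move=> /smeasP ? /smeasP ?; apply/smeasP; exact: measurable_funM. Qed.

Lemma smeas_comp D f (h : R -> R) : measurable_fun setT h -> smeas D f ->
  smeas D (h \o f).
Proof.
by move=> mh sf A mA; apply: (sf (h @^-1` A)); rewrite -[X in measurable X]setTI; exact: mh.
Qed.

Lemma smeas_norm D f : smeas D f -> smeas D (fun w => `|f w|).
Proof. by apply: (@smeas_comp _ _ Num.norm); exact: normr_measurable. Qed.

Lemma smeas_sum D (J : Type) (s : seq J) (Q : pred J) (f : J -> T -> R) :
  (forall j, Q j -> smeas D (f j)) -> smeas D (fun w => \sum_(j <- s | Q j) f j w).
Proof.
move=> sf; rewrite (_ : (fun w => _) = fun w => \sum_(j <- s)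
    (if Q j then f j w else 0)); last by apply/funext => w; rewrite big_mkcond.
elim: s => [|j s IH].
  by rewrite (_ : (fun w => _) = fun=> 0); [exact: smeas_cst|apply/funext => w; rewrite big_nil].
rewrite (_ : (fun w => _) = fun w => (if Q j then f j w else 0) +
    \sum_(j <- s) (if Q j then f j w else 0)); last first.
  by apply/funext => w; rewrite big_cons.
by apply: smeasD => //; case Qj: (Q j); [exact: sf|exact: smeas_cst].
Qed.

Lemma sig_le D f c : smeas D f -> sig D [set w | c <= f w].
Proof.
move=> sf; rewrite (_ : [set w | _] = f @^-1` `[c, +oo[); first exact: sf.
by apply/seteqP; split => w /=; rewrite in_itv/= andbT.
Qed.

Lemma sig_ge D f c : smeas D f -> sig D [set w | f w <= c].
Proof.
move=> sf; rewrite (_ : [set w | _] = f @^-1` `]-oo, c]); first exact: sf.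
by apply/seteqP; split => w /=; rewrite in_itv/=.
Qed.

Lemma sigC D E : sig D E -> sig D (~` E).
Proof. exact: sigma_algebraC. Qed.

Lemma sigI D E F : sig D E -> sig D F -> sig D (E `&` F).
Proof.
exact: (@measurableI _ (g_sigma_algebraType (info D))).
Qed.

Lemma sig_bigcup D (J : countType) (E : J -> set T) :
  (forall j, sig D (E j)) -> sig D (\bigcup_j E j).
Proof.
move=> sE; exact: (@countable_bigcupT_measurable _ (g_sigma_algebraType (info D)) J E (countableP _)).
Qed.

Lemma sig_bigcap D (J : countType) (E : J -> set T) :
  (forall j, sig D (E j)) -> sig D (\bigcap_j E j).
Proof.
move=> sE; rewrite -[X in sig D X]setCK setC_bigcap; apply: sigC.
by apply: sig_bigcup => j; exact: sigC.
Qed.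

Section product_expectation.
Variables (D1 D2 : set I) (f g : T -> R).
Hypotheses (D1D : D1 `<=` Dom) (D2D : D2 `<=` Dom) (D12 : D1 `&` D2 = set0).
Hypotheses (sf : smeas D1 f) (sg : smeas D2 g).
Hypotheses (If : integ P f) (Ig : integ P g).

(** The joint law of [(f, g)] is the product of the two laws, so Fubini's theorem
    computes the expectation of the product. *)
Lemma integM_ex : integ P (fun w => f w * g w) /\
  ex P (fun w => f w * g w) = ex P f * ex P g.
Proof.
have mf := smeas_measurable sf; have mg := smeas_measurable sg.
have mfg := measurable_fun_pair mf mg.
pose F : {mfun T >-> R} := mfun_Sub (mem_set mf).
pose G : {mfun T >-> R} := mfun_Sub (mem_set mg).
pose H : {mfun T >-> (R * R)%type} := mfun_Sub (mem_set mfg).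
pose m1 := distribution P F; pose m2 := distribution P G.
pose m := distribution P H.
have m12 A : measurable A -> (m1 \x m2)%E A = m A.
  apply: product_measure_unique => A1 A2 mA1 mA2.
  by rewrite -(sig_indep D1D D2D D12 (sf mA1) (sg mA2)).
pose h (z : R * R) : \bar R := (z.1 * z.2)%:E.
have mh : measurable_fun setT h.
  apply/measurable_EFinP; apply: measurable_funM; [exact: measurable_fst|exact: measurable_snd].
have mid : measurable_fun [set: R] (fun y : R => y%:E) by exact: EFin_measurable.
have mabs : measurable_fun [set: R] (fun y : R => `|y%:E|%E) by exact: measurableT_comp.
have I1 : m1.-integrable setT (fun x : R => x%:E).
  apply/integrableP; split => //.
  rewrite ge0_integral_distribution//.
  by case/integrableP: If.
have I2 : m2.-integrable setT (fun x : R => x%:E).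
  apply/integrableP; split => //.
  rewrite ge0_integral_distribution//.
  by case/integrableP: Ig.
have a2 : (\int[m2]_y `|y%:E| = (fine (\int[m2]_y `|y%:E|))%:E)%E.
  by rewrite fineK// ge0_fin_numE ?integral_ge0//; case/integrableP: I2.
have Ih : (m1 \x m2)%E.-integrable setT h.
  apply/integrable12ltyP => //=.
  under eq_integral => x _.
    under eq_integral => y _ do rewrite /h /= normrM EFinM.
    rewrite ge0_integralZl// -/m2 a2 muleC.
  over.
  rewrite ge0_integralZl//; last by rewrite lee_fin fine_ge0// integral_ge0.
  by rewrite lte_mul_pinfty ?lee_fin ?fine_ge0 ?integral_ge0//; case/integrableP: I1.
have IhP : P.-integrable setT (h \o H).
  apply/integrableP; split; first exact: measurableT_comp.
  case/integrableP: Ih => _; rewrite (eq_measure_integral m); last by move=> A mA _; exact: m12.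
  rewrite ge0_integral_distribution//.
  exact: measurableT_comp.
split; first exact: IhP.
apply: EFin_inj.
have fin (f' : T -> R) : integ P f' -> (ex P f')%:E = (\int[P]_w (f' w)%:E)%E.
  by move=> If'; rewrite /ex /Rintegral fineK//; exact: integrable_fin_num.
rewrite EFinM !fin//.
rewrite -[LHS](@integral_distribution _ _ _ _ _ P H h)//.
rewrite (eq_measure_integral (m1 \x m2)%E); last by move=> A mA _; exact/esym/m12.
rewrite -integral12_prod_meas1//.
rewrite -[X in (X * _)%E](@integral_distribution _ _ _ _ _ P F (fun y => y%:E))//.
rewrite -[X in (_ * X)%E](@integral_distribution _ _ _ _ _ P G (fun y => y%:E))//.
rewrite -/m1 -/m2.
have b2 : (\int[m2]_y y%:E = (fine (\int[m2]_y y%:E))%:E)%E.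
  by rewrite fineK//; exact: integrable_fin_num.
rewrite /fubini_F /h /=.
under eq_integral => x _.
  under eq_integral => y _ do rewrite EFinM.
  rewrite integralZl// b2 muleC.
over.
by rewrite integralZl// -b2 muleC.
Qed.

End product_expectation.

End independence.

(** * Moments of sums of independent centred variables *)


Section moments.
Context {disp : measure_display} {T : measurableType disp} {R : realType}.
Variable P : probability T R.
Context {I : choiceType}.
Variables (Dom : set I) (X : I -> {RV P >-> R}).
Hypothesis indX : mutually_independent Dom X.

Lemma law_ex (Y Z : {RV P >-> R}) (h : R -> R) : same_law Y Z ->
  measurable_fun setT h -> integ P (h \o Z) ->
  integ P (h \o Y) /\ ex P (h \o Y) = ex P (h \o Z).
Proof.
move=> YZ mh Ih.
have mEh : measurable_fun setT (EFin \o h) by exact/measurable_EFinP.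
have IY : integ P (h \o Y).
  apply/integrableP; split.
    by apply/measurable_EFinP; exact: measurableT_comp.
  have mah : measurable_fun setT (abse \o (EFin \o h)) by exact: measurableT_comp.
  case/integrableP : Ih => _.
  have -> : (fun x : T => `|(EFin \o (h \o Z)) x|)%E = (abse \o (EFin \o h)) \o Z by [].
  have -> : (fun x : T => `|(EFin \o (h \o Y)) x|)%E = (abse \o (EFin \o h)) \o Y by [].
  rewrite -(@ge0_integral_distribution _ _ _ _ _ P Z (abse \o (EFin \o h)))//; last first.
    by move=> y; exact: abse_ge0.
  rewrite -(@ge0_integral_distribution _ _ _ _ _ P Y (abse \o (EFin \o h)))//; last first.
    by move=> y; exact: abse_ge0.
  by rewrite (eq_measure_integral (distribution P Y))// => A mA _; first [exact: YZ|exact/esym/YZ].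
split => //; rewrite /ex /Rintegral; congr fine.
have -> : (fun w : T => ((h \o Z) w)%:E) = (EFin \o h) \o Z by [].
have -> : (fun w : T => ((h \o Y) w)%:E) = (EFin \o h) \o Y by [].
rewrite -(@integral_distribution _ _ _ _ _ P Z (EFin \o h))//.
rewrite -(@integral_distribution _ _ _ _ _ P Y (EFin \o h))//.
by apply: eq_measure_integral => A mA _; first [exact: YZ|exact/esym/YZ].
Qed.

Lemma sub_cons (a : I) (s : seq I) (D : set I) :
  [set` a :: s] `<=` D -> D a /\ [set` s] `<=` D.
Proof.
move=> sD; split; first by apply: sD; rewrite /= inE eqxx.
by move=> i /= si; apply: sD; rewrite /= inE si orbT.
Qed.

Lemma set1I_notin (a : I) (s : seq I) : a \notin s -> [set a] `&` [set` s] = set0.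
Proof.
by move=> sa; apply/seteqP; split => i //= -[-> si]; rewrite si in sa.
Qed.

Section transformed_sums.
Variable phi : R -> R.
Hypothesis mphi : measurable_fun setT phi.
Let f i := phi \o X i.
Let S (s : seq I) w := \sum_(i <- s) f i w.

Lemma smeas_phi D i : D i -> smeas X D (f i).
Proof. by move=> Di; apply: smeas_comp => //; exact: smeasX. Qed.

Lemma smeas_psum (s : seq I) : smeas X [set` s] (S s).
Proof.
rewrite /S; elim: s => [|a s IH].
  rewrite (_ : (fun w => _) = fun=> 0); first exact: smeas_cst.
  by apply/funext => w; rewrite big_nil.
rewrite (_ : (fun w => _) = fun w => f a w + S s w); last first.
  by apply/funext => w; rewrite big_cons.
apply: smeasD; first by apply: smeas_phi; rewrite /= inE eqxx.
by apply: smeas_sub IH => i /= si; rewrite inE si orbT.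
Qed.

Lemma psum_second_moment (v : R) (s : seq I) :
  (forall i, Dom i -> [/\ integ P (f i), ex P (f i) = 0,
     integ P (fun w => f i w ^+ 2) & ex P (fun w => f i w ^+ 2) = v]) ->
  uniq s -> [set` s] `<=` Dom ->
  [/\ integ P (S s), ex P (S s) = 0, integ P (fun w => S s w ^+ 2) &
      ex P (fun w => S s w ^+ 2) = (size s)%:R * v].
Proof.
move=> fP; elim: s => [_ _|a s IH /=/andP[sa us] /sub_cons[Da sD]].
  have -> : (fun w => S [::] w ^+ 2) = fun=> 0.
    by apply/funext => w; rewrite /S big_nil expr0n.
  have -> : S [::] = fun=> 0 by apply/funext => w; rewrite /S big_nil.
  by rewrite ex_cst mul0r; split => //; exact: integ_cst.
have [IS eS IS2 eS2] := IH us sD; have [If ef If2 ef2] := fP _ Da.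
have SE : S (a :: s) = fun w => f a w + S s w.
  by apply/funext => w; rewrite /S big_cons.
have aD : [set a] `<=` Dom by move=> i ->.
have [IfS efS] := integM_ex indX (D1 := [set a]) (D2 := [set` s])
  aD sD (set1I_notin sa) (@smeas_phi [set a] a (erefl a)) (@smeas_psum s) If IS.
have S2E : (fun w => S (a :: s) w ^+ 2) =
    fun w => f a w ^+ 2 + (2 * (f a w * S s w) + S s w ^+ 2).
  by rewrite SE; apply/funext => w; ring.
have I2 := integZ 2 IfS.
rewrite S2E SE; split.
- exact: integD.
- by rewrite exD// ef eS addr0.
- by apply: integD => //; exact: integD.
- rewrite !exD//; last exact: integD.
  by rewrite exZ// efS ef ef2 eS2 mul0r mulr0 add0r -nat1r; ring.
Qed.

(** Expanding the fourth power of [f a + S], the two terms with a factor of degree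
    one vanish, and the middle term is bounded through the second moments; this
    gives the induction. *)
Lemma psum_fourth_moment (B : R) (s : seq I) : (forall y, `|phi y| <= B) ->
  (forall i, Dom i -> ex P (f i) = 0) ->
  uniq s -> [set` s] `<=` Dom ->
  ex P (fun w => S s w ^+ 4) <= 3 * B ^+ 4 * (size s)%:R ^+ 2.
Proof.
move=> phiB f0.
have B0 : 0 <= B := le_trans (normr_ge0 _) (phiB 0).
have powle n (a b : R) : `|a| <= b -> `|a ^+ n| <= b ^+ n.
  by move=> ab; rewrite normrX lerXn2r// ?nnegrE// (le_trans (normr_ge0 a)).
have mS s' : measurable_fun setT (S s') := smeas_measurable (@smeas_psum s').
have mf i : measurable_fun setT (f i) by exact: measurableT_comp.
have Sb s' w : `|S s' w| <= (size s')%:R * B.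
  rewrite /S; elim: s' => [|a s' IH]; first by rewrite big_nil normr0 mul0r.
  rewrite big_cons (le_trans (ler_normD _ _))//= -nat1r mulrDl mul1r lerD//.
  exact: phiB.
have ISn n s' : integ P (fun w => S s' w ^+ n).
  apply: (@integ_bounded _ _ _ _ _ (((size s')%:R * B) ^+ n)).
    exact: measurable_funX.
  by move=> w; exact: powle.
have Ifn n i : integ P (fun w => f i w ^+ n).
  apply: (@integ_bounded _ _ _ _ _ (B ^+ n)); first exact: measurable_funX.
  by move=> w; apply: powle; exact: phiB.
have efn n i : ex P (fun w => f i w ^+ n) <= B ^+ n.
  rewrite -[leRHS](ex_cst P); apply: ex_le => //; first exact: integ_cst.
  by move=> w; rewrite (le_trans (ler_norm _))// powle//; exact: phiB.
suff H : uniq s -> [set` s] `<=` Dom ->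
  [/\ ex P (S s) = 0, ex P (fun w => S s w ^+ 2) <= B ^+ 2 * (size s)%:R &
      ex P (fun w => S s w ^+ 4) <= 3 * B ^+ 4 * (size s)%:R ^+ 2].
  by move=> us sD; case: (H us sD).
elim: s => [_ _|a s IH /=/andP[sa us] /sub_cons[Da sD]].
  have S0 n : (fun w => S [::] w ^+ n.+1) = fun=> 0.
    by apply/funext => w; rewrite /S big_nil expr0n.
  rewrite !S0.
  have -> : S [::] = fun=> 0 by apply/funext => w; rewrite /S big_nil.
  by rewrite ex_cst !mulr0 expr0n/= mulr0.
have [eS eS2 eS4] := IH us sD.
have SE : S (a :: s) = fun w => f a w + S s w.
  by apply/funext => w; rewrite /S big_cons.
have M m n : integ P (fun w => f a w ^+ m * S s w ^+ n) /\
    ex P (fun w => f a w ^+ m * S s w ^+ n) =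
    ex P (fun w => f a w ^+ m) * ex P (fun w => S s w ^+ n).
  apply: (integM_ex indX (D1 := [set a]) (D2 := [set` s])) => //.
  - by move=> i ->.
  - exact: set1I_notin.
  - apply: (@smeas_comp _ _ _ _ _ _ _ (f a) (fun y => y ^+ m)).
      exact: measurable_funX.
    exact: smeas_phi.
  - apply: (@smeas_comp _ _ _ _ _ _ _ (S s) (fun y => y ^+ n)).
      exact: measurable_funX.
    exact: smeas_psum.
have f1 : ex P (fun w => f a w ^+ 1) = 0 by exact: f0.
have S1 : ex P (fun w => S s w ^+ 1) = 0 by exact: eS.
have I1 m n := (M m n).1; have E1 m n := (M m n).2.
split.
- rewrite SE exD//; [by rewrite eS (f0 _ Da) addr0|exact: (Ifn 1%N)|exact: (ISn 1%N)].
- have -> : (fun w => S (a :: s) w ^+ 2) =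
    fun w => f a w ^+ 2 + (2 * (f a w ^+ 1 * S s w ^+ 1) + S s w ^+ 2).
    by rewrite SE; apply/funext => w; ring.
  have I2 := integZ 2 (I1 1%N 1%N).
  rewrite !exD//; last exact: integD.
  rewrite exZ// E1 f1 mul0r mulr0 add0r -nat1r mulrDr mulr1 lerD//.
- have -> : (fun w => S (a :: s) w ^+ 4) =
    fun w => f a w ^+ 4 + (4 * (f a w ^+ 3 * S s w ^+ 1) +
     (6 * (f a w ^+ 2 * S s w ^+ 2) + (4 * (f a w ^+ 1 * S s w ^+ 3) + S s w ^+ 4))).
    by rewrite SE; apply/funext => w; ring.
  have I31 := integZ 4 (I1 3%N 1%N).
  have I22 := integZ 6 (I1 2%N 2%N).
  have I13 := integZ 4 (I1 1%N 3%N).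
  have J1 := integD I13 (ISn 4%N s).
  have J2 := integD I22 J1.
  have J3 := integD I31 J2.
  rewrite exD// exD// exD// exD// !exZ// !E1 f1 S1 mul0r mulr0 mulr0 !add0r.
  have e22 : ex P (fun w => f a w ^+ 2) * ex P (fun w => S s w ^+ 2) <=
      B ^+ 2 * (B ^+ 2 * (size s)%:R).
    by apply: ler_pM => //; apply: ex_ge0 => w; exact: sqr_ge0.
  have := efn 4%N a.
  rewrite -[(size s).+1%:R]nat1r.
  set n := (size s)%:R in eS4 e22 *; set B4 := B ^+ 4 in eS4 *.
  rewrite (_ : B ^+ 2 * (B ^+ 2 * n) = B4 * n) in e22; last by rewrite /B4; ring.
  have B40 : 0 <= B4 by rewrite exprn_ge0.
  move: e22; set p := ex P _ * ex P _; move=> e22 e4.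
  have E2 : 3 * B4 * (1 + n) ^+ 2 = 3 * B4 + 6 * (B4 * n) + 3 * B4 * n ^+ 2 by ring.
  rewrite E2; lra.
Qed.

End transformed_sums.

End moments.

Section vanish.
Context {disp : measure_display} {T : measurableType disp} {R : realType}.
Variable P : probability T R.

Lemma ex_vanish (h : nat -> T -> R) (g : T -> R) :
  (forall n, measurable_fun setT (h n)) -> integ P g ->
  (forall n w, `|h n w| <= g w) ->
  (forall w e, 0 < e -> exists N, forall n, (N <= n)%N -> `|h n w| <= e) ->
  forall eta, 0 < eta -> exists N, forall n, (N <= n)%N -> ex P (h n) <= eta.
Proof.
move=> mh Ig hg h0 eta eta0.
have A1 n : measurable_fun setT (EFin \o h n) by exact/measurable_EFinP.
have A2 : \forall x \ae P, [set: T] x -> (fun n => (EFin \o h n) x) @ \oo --> 0%E.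
  apply: aeW => w _; apply: cvg_EFin; first by apply: nearW.
  apply/cvgrPdist_le => e e0; have [N HN] := h0 w e e0; exists N => // n /= Nn.
  by rewrite sub0r normrN; exact: HN.
have A3 : \forall x \ae P, forall n, [set: T] x -> (`|(EFin \o h n) x| <= (EFin \o g) x)%E.
  by apply: aeW => w n _; rewrite /= lee_fin.
have [_ _] := dominated_convergence measurableT A1 (measurable_cst _) A2 Ig A3.
rewrite integral0 => /fine_cvgP[_] /cvgrPdist_le /(_ _ eta0) [N _ HN].
exists N => n Nn; have := HN n Nn; rewrite /= sub0r normrN.
exact: le_trans (ler_norm _).
Qed.

End vanish.

Lemma sqr_norm (R : realDomainType) (y : R) : `|y| ^+ 2 = y ^+ 2.
Proof. by rewrite real_normK// num_real. Qed.

Section tail.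
Context {disp : measure_display} {T : measurableType disp} {R : realType}.
Variable P : probability T R.
Context {I : choiceType}.
Variables (Dom : set I) (X : I -> {RV P >-> R}) (xi : {RV P >-> R}) (mu : R).
Hypothesis indX : mutually_independent Dom X.
Hypothesis lawX : forall i, Dom i -> same_law (X i) xi.
Hypotheses (Ixi : integ P xi) (exi : ex P xi = mu).
Hypothesis Ixi2 : integ P (fun w => (xi w - mu) ^+ 2).

Definition csum (s : seq I) w := \sum_(i <- s) (X i w - mu).

Lemma smeas_csum (s : seq I) D : [set` s] `<=` D -> smeas X D (csum s).
Proof.
move=> sD; apply: smeas_sub sD _.
apply: (@smeas_psum _ _ _ _ _ X (fun y => y - mu)) => //.
exact: measurable_funB.
Qed.

Lemma measurable_csum s : measurable_fun setT (csum s).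
Proof. exact: smeas_measurable (@smeas_csum s _ (@subset_refl _ _)). Qed.

Let clamp (n : nat) (y : R) := Num.max (- n%:R) (Num.min n%:R (y - mu)).

Let mclamp n : measurable_fun setT (clamp n).
Proof.
apply: measurable_maxr => //; apply: measurable_minr => //.
exact: measurable_funB.
Qed.

Let clampP n y : `|clamp n y| <= n%:R /\ `|(y - mu) - clamp n y| <= `|y - mu| /\
  (`|y - mu| <= n%:R -> clamp n y = y - mu).
Proof.
rewrite /clamp; have n0 : 0 <= n%:R :> R by [].
set z := y - mu; set m := n%:R in n0 *.
case: (leP m z) => mz.
  have -> : Num.max (- m) m = m by rewrite max_r//; lra.
  have zm : 0 <= z - m by lra.
  by rewrite !ger0_norm//; [split; [|split]; lra|lra].
case: (leP (- m) z) => zm.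
  split; first by rewrite ler_norml; lra.
  by rewrite subrr normr0; split.
split; first by rewrite normrN ger0_norm; lra.
split; last by rewrite ler_norml => /andP[]; lra.
by rewrite !ler0_norm; lra.
Qed.

(** Truncate the centred variable at a level [n]. The remainder has a variance below
    [eta / 4], so Chebyshev's inequality bounds its share by the linear term with the small
    constant [eta]; the truncated part is bounded, so its fourth moment gives
    the quadratic term. The small linear constant replaces the higher moments that
    a chaining argument would use. *)
Lemma tail_csum (eta : R) : 0 < eta -> exists2 C, 0 <= C &
  forall s x, uniq s -> [set` s] `<=` Dom -> 0 < x ->
  prob P [set w | x <= `|csum s w|] <=
    eta * ((size s)%:R / x ^+ 2) + C * ((size s)%:R / x ^+ 2) ^+ 2.
Proof.
move=> eta0.
pose r n y := (y - mu) - clamp n y.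
have mr n : measurable_fun setT (r n).
  by apply: measurable_funB => //; exact: measurable_funB.
have mxi : measurable_fun setT xi by [].
have [N HN] : exists N, forall n, (N <= n)%N ->
    ex P (fun w => r n (xi w) ^+ 2) <= eta / 4.
  apply: (@ex_vanish _ _ _ _ _ (fun w => (xi w - mu) ^+ 2)) => //.
  - by move=> n; apply: measurable_funX; exact: measurableT_comp.
  - by move=> n w; rewrite normrX -[leRHS]sqr_norm lerXn2r ?nnegrE//; case: (clampP n (xi w)) => _ [].
  - move=> w e e0; exists (Num.bound `|xi w - mu|) => n Nn.
    have hb : `|xi w - mu| <= n%:R.
      by rewrite (le_trans (ltW (archi_boundP _)))// ler_nat.
    by rewrite /r (clampP n (xi w)).2.2// subrr expr0n/= normr0 ltW.
  - lra.
pose n := N.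
pose m := ex P (clamp n \o xi).
have mc : measurable_fun setT (clamp n \o xi) by exact: measurableT_comp.
have Ic : integ P (clamp n \o xi).
  by apply: (@integ_bounded _ _ _ _ _ n%:R) => // w; case: (clampP n (xi w)).
have Ixm : integ P (fun w => xi w - mu) by apply: integB => //; exact: integ_cst.
have exm : ex P (fun w => xi w - mu) = 0.
  by rewrite exB// ?ex_cst ?exi ?subrr//; exact: integ_cst.
pose phi1 y := clamp n y - m; pose phi2 y := r n y + m.
have mphi1 : measurable_fun setT phi1 by exact: measurable_funB.
have mphi2 : measurable_fun setT phi2 by exact: measurable_funD.
have Ir : integ P (fun w => r n (xi w)) by exact: integB.
have er : ex P (fun w => r n (xi w)) = - m by rewrite exB// exm sub0r.
have I1 : integ P (phi1 \o xi) by apply: integB => //; exact: integ_cst.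
have e1 : ex P (phi1 \o xi) = 0.
  by rewrite exB ?ex_cst ?subrr//; exact: integ_cst.
have I2 : integ P (phi2 \o xi) by apply: integD => //; exact: integ_cst.
have e2 : ex P (phi2 \o xi) = 0.
  by rewrite exD ?ex_cst ?er ?addNr//; exact: integ_cst.
have Ir2 : integ P (fun w => r n (xi w) ^+ 2).
  apply: (integ_le _ Ixi2).
    by apply: measurable_funX; exact: measurableT_comp.
  by move=> w; rewrite normrX -[leRHS]sqr_norm lerXn2r ?nnegrE//; case: (clampP n (xi w)) => _ [].
have phi22 : (fun w => phi2 (xi w) ^+ 2) =
    fun w => r n (xi w) ^+ 2 + ((2 * m) * r n (xi w) + m ^+ 2).
  by apply/funext => w; rewrite /phi2; ring.
have J : integ P (fun w => (2 * m) * r n (xi w) + m ^+ 2).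
  by apply: integD; [exact: integZ|exact: integ_cst].
have I22 : integ P (fun w => phi2 (xi w) ^+ 2) by rewrite phi22; exact: integD.
have e22 : ex P (fun w => phi2 (xi w) ^+ 2) <= eta / 4.
  rewrite phi22 exD// exD//; [|exact: integZ|exact: integ_cst].
  rewrite exZ// ex_cst er; have := HN n (leqnn _); have := sqr_ge0 m; lra.
have b1 y : `|phi1 y| <= n%:R + n%:R.
  rewrite (le_trans (ler_normB _ _))// lerD//; first by case: (clampP n y).
  rewrite -[leRHS](ex_cst P); apply: normr_ex_le => //; first exact: integ_cst.
  by move=> w; case: (clampP n (xi w)).
pose S1 s w := \sum_(i <- s) (phi1 \o X i) w.
pose S2 s w := \sum_(i <- s) (phi2 \o X i) w.
have S12 s w : csum s w = S1 s w + S2 s w.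
  rewrite /csum /S1 /S2 -big_split/=; apply: eq_bigr => i _.
  by rewrite /phi1 /phi2 /r; ring.
have mS1 s : measurable_fun setT (S1 s) := smeas_measurable (@smeas_psum _ _ _ _ _ X _ mphi1 s).
have mS2 s : measurable_fun setT (S2 s) := smeas_measurable (@smeas_psum _ _ _ _ _ X _ mphi2 s).
have meas (f : T -> R) c : measurable_fun setT f -> measurable [set w | c <= f w].
  move=> mf; rewrite -[X in measurable X]setTI (_ : [set w | _] = f @^-1` `[c, +oo[); first exact: mf.
  by apply/seteqP; split => w /=; rewrite in_itv/= andbT.
set B := n%:R + n%:R in b1.
(* 48 = 3 * 2 ^ 4: fourth moment constant and Markov at level x / 2. *)
exists (48 * B ^+ 4); first by rewrite mulr_ge0// exprn_ge0// (le_trans _ (b1 0)).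
move=> s x us sD x0.
have x20 : 0 < x / 2 by lra.
apply: (@le_trans _ _ (prob P ([set w | x / 2 <= `|S1 s w|] `|` [set w | x / 2 <= `|S2 s w|]))).
  apply: le_prob.
  - by apply: meas; apply: measurableT_comp => //; exact: measurable_csum.
  - by apply: measurableU; apply: meas; exact: measurableT_comp.
  - move=> w /=; rewrite S12 => xS.
    have := le_trans xS (ler_normD _ _).
    case: (leP (x / 2) `|S1 s w|) => h1; [by left|move=> h; right; lra].
apply: (le_trans (probU_le _ _ _)).
- by apply: meas; exact: measurableT_comp.
- by apply: meas; exact: measurableT_comp.
rewrite addrC; apply: lerD.
- have [] := @psum_second_moment _ _ _ P _ Dom X indX phi2 mphi2 (ex P (fun w => phi2 (xi w) ^+ 2)) s _ us sD.
    move=> i Di; have L := lawX Di.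
    have [? ?] := law_ex L mphi2 I2.
    have [||? ?] := @law_ex _ _ _ _ _ _ (fun y => phi2 y ^+ 2) L; [by apply: measurable_funX|by []|].
    by split => //; rewrite -e2.
  move=> _ _ IS2 eS2.
  apply: (le_trans (@markov_prob _ _ _ P _ (fun w => S2 s w ^+ 2) ((x / 2) ^+ 2) _ IS2 _ _ _)).
  + by apply: meas; exact: measurableT_comp.
  + by move=> w; exact: sqr_ge0.
  + by rewrite exprn_gt0.
  + by move=> w /= xw; rewrite -[leRHS]sqr_norm lerXn2r ?nnegrE// ltW.
  + rewrite eS2.
    have -> : eta * ((size s)%:R / x ^+ 2) = (size s)%:R * (eta / 4) / (x / 2) ^+ 2.
      by field; rewrite gt_eqF.
    rewrite ler_pM2r ?invr_gt0 ?exprn_gt0// ler_wpM2l//.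
- have e4 := @psum_fourth_moment _ _ _ P _ Dom X indX phi1 mphi1 B s b1 _ us sD.
  have IS4 : integ P (fun w => S1 s w ^+ 4).
    apply: (@integ_bounded _ _ _ _ _ (((size s)%:R * B) ^+ 4)).
      exact: measurable_funX.
    move=> w; rewrite normrX lerXn2r ?nnegrE//.
      by rewrite mulr_ge0// (le_trans _ (b1 0)).
    rewrite /S1; elim: (s) => [|a s' IH]; first by rewrite big_nil normr0 mul0r.
    rewrite big_cons (le_trans (ler_normD _ _))//= -[(size s').+1%:R]nat1r mulrDl mul1r lerD//.
  apply: (le_trans (@markov_prob _ _ _ P _ (fun w => S1 s w ^+ 4) ((x / 2) ^+ 4) _ IS4 _ _ _)).
  + by apply: meas; exact: measurableT_comp.
  + by move=> w; rewrite (exprM _ 2 2) sqr_ge0.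
  + by rewrite exprn_gt0.
  + move=> w /= xw; rewrite -[leRHS]ger0_norm; last by rewrite (exprM _ 2 2) sqr_ge0.
    by rewrite normrX lerXn2r ?nnegrE// ltW.
  + have -> : 48 * B ^+ 4 * ((size s)%:R / x ^+ 2) ^+ 2 =
        3 * B ^+ 4 * (size s)%:R ^+ 2 / (x / 2) ^+ 4.
      by field; rewrite gt_eqF.
    rewrite ler_pM2r ?invr_gt0 ?exprn_gt0//; apply: e4 => i Di.
    by have [_ ->] := law_ex (lawX Di) mphi1 I1.
Qed.

End tail.

(** * A maximal inequality for multi-indexed sums *)


Section maximal.
Context {disp : measure_display} {T : measurableType disp} {R : realType}.
Variable P : probability T R.
Context {d : nat}.
Notation idx := {ffun 'I_d -> nat}.
Variables (Dom : set idx) (X : idx -> {RV P >-> R}) (xi : {RV P >-> R}) (mu : R).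
Hypothesis indX : mutually_independent Dom X.
Hypothesis lawX : forall i, Dom i -> same_law (X i) xi.
Hypotheses (Ixi : integ P xi) (exi : ex P xi = mu).
Hypothesis Ixi2 : integ P (fun w => (xi w - mu) ^+ 2).

Let v := ex P (fun w => (xi w - mu) ^+ 2).

Lemma chebyshev_csum (s : seq idx) x : uniq s -> [set` s] `<=` Dom -> 0 < x ->
  prob P [set w | x <= `|csum X mu s w|] <= (size s)%:R * v / x ^+ 2.
Proof.
move=> us sD x0.
have mphi : measurable_fun setT (fun y : R => y - mu) by exact: measurable_funB.
have Ixm : integ P (fun w => xi w - mu) by apply: integB => //; exact: integ_cst.
have exm : ex P (fun w => xi w - mu) = 0.
  by rewrite exB// ?ex_cst ?exi ?subrr//; exact: integ_cst.
have [] := @psum_second_moment _ _ _ P _ Dom X indX _ mphi v s _ us sD.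
  move=> i Di; have L := lawX Di.
  have [? ?] := law_ex L mphi Ixm.
  have [||? ?] := @law_ex _ _ _ _ _ _ (fun y => (y - mu) ^+ 2) L; [by apply: measurable_funX|by []|].
  by split => //; rewrite -exm.
move=> _ _ IS2 eS2.
apply: (le_trans (@markov_prob _ _ _ P _ (fun w => csum X mu s w ^+ 2) (x ^+ 2) _ IS2 _ _ _)).
- apply: (@sig_measurable _ _ _ _ _ X [set` s]).
  by apply: sig_le; apply: smeas_norm; exact: smeas_csum.
- by move=> w; exact: sqr_ge0.
- by rewrite exprn_gt0.
- by move=> w /= xw; rewrite -[leRHS]sqr_norm lerXn2r ?nnegrE// ltW.
- by rewrite eS2.
Qed.

(** Only the first [k] coordinates are compared: the maximal inequality is obtained by
    freeing the coordinates one after the other. *)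
Definition below (k : nat) (n m : idx) := [forall i : 'I_d, (i < k)%N ==> (m i <= n i)%N].

Definition maxdev k (A : seq idx) (y : R) : set T :=
  \bigcup_(n : idx) [set w | y <= `|csum X mu [seq m <- A | below k n m] w|].

Lemma sig_maxdev k A y D : [set` A] `<=` D -> sig X D (maxdev k A y).
Proof.
move=> AD; apply: sig_bigcup => n; apply: sig_le; apply: smeas_norm.
apply: smeas_csum => m /=; rewrite mem_filter => /andP[_]; exact: AD.
Qed.

Lemma measurable_maxdev k A y : measurable (maxdev k A y).
Proof. by apply: (@sig_measurable _ _ _ _ _ X [set` A]); exact: sig_maxdev. Qed.

Lemma below_succ (k : 'I_d) (n m : idx) :
  below k.+1 n m = below k n m && (m k <= n k)%N.
Proof.
apply/forallP/andP => [H|[/forallP H mk] i].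
  split; last by have := H k; rewrite ltnS leqnn.
  by apply/forallP => i; apply/implyP => ik; have := H i; rewrite ltnS (ltnW ik).
apply/implyP; rewrite ltnS leq_eqVlt => /orP[/eqP ik|ik].
  by rewrite (_ : i = k)//; exact: val_inj.
by have := H i; rewrite ik.
Qed.

Lemma csum_filter (A : seq idx) (p : pred idx) w :
  csum X mu A w = csum X mu [seq m <- A | p m] w + csum X mu [seq m <- A | ~~ p m] w.
Proof. by rewrite /csum !big_filter (bigID p). Qed.

(** Ottaviani's inequality in direction [k]: the first layer [i] at which the
    deviation over the lower slab exceeds [2 * x] is independent of the upper slab, whose own
    deviation stays below [x] with probability at least 1/2. *)
Lemma ottaviani_step (k : 'I_d) (A : seq idx) (x : R) :
  [set` A] `<=` Dom ->
  (forall i : nat, prob P (maxdev k [seq m : idx <- A | (i < m k)%N] x) <= 2^-1) ->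
  prob P (maxdev k.+1 A (2 * x)) <= 2 * prob P (maxdev k A x).
Proof.
move=> AD H.
pose lo i := [seq m : idx <- A | (m k <= i)%N].
pose hi i := [seq m : idx <- A | (i < m k)%N].
pose E i := maxdev k (lo i) (2 * x).
pose F := seqDU E.
pose G i := ~` maxdev k (hi i) x.
pose L := (\max_(m <- A) (m : idx) k).+1.
have mE i : measurable (E i) by exact: measurable_maxdev.
have mF i : measurable (F i).
  by apply: measurableD => //; exact: bigsetU_measurable.
have mG i : measurable (G i) by apply: measurableC; exact: measurable_maxdev.
have EL i : exists2 j, (j < L)%N & lo i = lo j.
  exists (minn i L.-1); first by rewrite ltnS geq_minr.
  apply: eq_in_filter => m mA; rewrite leq_min /L/=.
  have mL : (m k <= \max_(m' <- A) (m' : idx) k)%N by exact: leq_bigmax_seq.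
  by rewrite mL andbT.
have -> : maxdev k.+1 A (2 * x) = \big[setU/set0]_(i < L) E i.
  rewrite -bigcup_mkord; apply/seteqP; split => w /=.
  - move=> [n _ /= wn]; have [j jL loj] := EL (n k).
    exists j => //; exists n => //=; rewrite -loj.
    rewrite /lo -filter_predI (eq_filter (a2 := below k.+1 n))//.
    by move=> m; rewrite below_succ.
  - move=> [i iL [n _ /= wn]].
    exists [ffun j => if j == k then i else n j] => //=.
    rewrite (_ : [seq m <- A | _] = [seq m <- lo i | below k n m])//.
    rewrite /lo -filter_predI; apply: eq_filter => m /=.
    rewrite below_succ ffunE eqxx; congr (_ && _).
    apply: eq_forallb => j; rewrite ffunE; case: eqP => // ->.
    by rewrite ltnn.
rewrite bigsetU_seqDU.
have tF : trivIset setT F by exact: trivIset_seqDU.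
rewrite prob_trivI//.
have tFG : trivIset setT (fun i => F i `&` G i).
  apply/trivIsetP => i j _ _ ij.
  have /trivIsetP/(_ i j I I ij) := tF.
  by move=> FF; rewrite setIACA FF set0I.
apply: (@le_trans _ _ (2 * prob P (\big[setU/set0]_(i < L) (F i `&` G i)))); last first.
  rewrite ler_pM2l//; apply: le_prob.
  - by apply: bigsetU_measurable => i _; exact: measurableI.
  - exact: measurable_maxdev.
  - rewrite -(bigcup_mkord L (fun i => F i `&` G i)) => w [i /= iL [[[n _ /= wE] _]] wG].
    exists n => //=.
    have /negP : ~ (x <= `|csum X mu [seq m <- hi i | below k n m] w|).
      by move=> xw; apply: wG; exists n.
    rewrite -ltNge => wlt.
    rewrite (@csum_filter [seq m <- A | below k n m] (fun m : idx => m k <= i)%N).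
    have e1 : [seq m : idx <- [seq m <- A | below k n m] | (m k <= i)%N] = [seq m <- lo i | below k n m].
      by rewrite /lo -!filter_predI; apply: eq_filter => m /=; rewrite andbC.
    have e2 : [seq m : idx <- [seq m <- A | below k n m] | ~~ (m k <= i)%N] = [seq m <- hi i | below k n m].
      by rewrite /hi -!filter_predI; apply: eq_filter => m /=; rewrite andbC -ltnNge.
    rewrite e1 e2.
    set a := csum _ _ _ _ in wE *; set b := csum _ _ _ _ in wlt *.
    have := ler_normB (a + b) b; rewrite addrK => h.
    by rewrite -(lerD2r `|b|) (le_trans _ h)// (le_trans _ wE)//; lra.
rewrite (@prob_trivI _ _ _ P L (fun i => F i `&` G i))//; last by move=> i; exact: measurableI.
rewrite mulr_sumr; apply: ler_sum => i _.
have sF : sig X [set m | m \in A /\ (m k <= i)%N] (F i).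
  rewrite /F /seqDU; apply: sigI.
    by apply: sig_maxdev => m /=; rewrite mem_filter => /andP[].
  apply: sigC; rewrite -bigcup_mkord.
  rewrite (_ : \bigcup_(_ in _) _ = \bigcup_j (if (j < i)%N then E j else set0)); last first.
    apply/seteqP; split => w [j].
      by move=> /= ji wj; exists j => //; rewrite ji.
    by move=> _; case: ifP => // ji wj; exists j.
  apply: sig_bigcup => j; case: ifP => ji; last exact: sigma_algebra0.
  apply: sig_maxdev => m /=; rewrite mem_filter => /andP[mj mA]; split => //.
  exact: leq_trans mj (ltnW ji).
have sG : sig X [set` hi i] (G i) by apply: sigC; exact: sig_maxdev.
rewrite (sig_prob_indep indX _ _ _ sF sG); first last.
- by apply/seteqP; split => m //= -[[mA mi]]; rewrite mem_filter ltnNge mi.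
- by move=> m /=; rewrite mem_filter => /andP[_]; exact: AD.
- by move=> m /= [mA _]; exact: AD.
rewrite probC; last exact: measurable_maxdev.
have := H i; have := prob_ge0 P (F i).
rewrite -/(hi i); set p := prob P (F i); set q := prob P _; nra.
Qed.

(** The hypothesis on [x] is what Chebyshev's inequality needs to make each
    upper slab harmless with probability 1/2, at every one of the [k] steps. *)
Lemma ottaviani (k : nat) (A : seq idx) (x : R) : (k <= d)%N -> uniq A ->
  [set` A] `<=` Dom -> 0 < x -> 2 ^+ k * ((size A)%:R * v) <= x ^+ 2 ->
  prob P (maxdev k A (2 ^+ k * x)) <= 2 ^+ k * prob P [set w | x <= `|csum X mu A w|].
Proof.
elim: k A => [|k IH] A kd uA AD x0 Ax.
  rewrite !expr0 !mul1r; apply: le_prob.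
  - exact: measurable_maxdev.
  - apply: (@sig_measurable _ _ _ _ _ X [set` A]).
    by apply: sig_le; apply: smeas_norm; exact: smeas_csum.
  - move=> w [n _ /=]; rewrite (_ : [seq m <- A | _] = A)//.
    by apply/all_filterP/allP => m _; apply/forallP.
have v0 : 0 <= v by apply: ex_ge0 => w; exact: sqr_ge0.
have half (A' : seq idx) : (size A' <= size A)%N -> 2 ^+ k * ((size A')%:R * v) <= x ^+ 2 / 2.
  move=> sA; rewrite ler_pdivlMr// (le_trans _ Ax)// exprS.
  rewrite [leLHS]mulrC [leLHS]mulrA ler_wpM2l ?mulr_ge0 ?exprn_ge0//.
  by rewrite ler_wpM2r// ler_nat.
rewrite exprS -!mulrA (le_trans (@ottaviani_step (Ordinal kd) A (2 ^+ k * x) AD _))//.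
  move=> i; set A' := [seq m <- A | _].
  have sA' : (size A' <= size A)%N by rewrite size_filter count_size.
  have A'D : [set` A'] `<=` Dom.
    by move=> m /=; rewrite mem_filter => /andP[_]; exact: AD.
  have uA' : uniq A' by rewrite filter_uniq.
  have h := half _ sA'.
  apply: (le_trans (IH A' (ltnW kd) uA' A'D x0 _)).
    by rewrite (le_trans h)//; have := sqr_ge0 x; lra.
  apply: (@le_trans _ _ (2 ^+ k * ((size A')%:R * v / x ^+ 2))).
    by rewrite ler_wpM2l ?exprn_ge0//; exact: chebyshev_csum.
  rewrite mulrA ler_pdivrMr ?exprn_gt0//; lra.
rewrite ler_pM2l//; apply: IH => //; first exact: ltnW.
by rewrite (le_trans (half A (leqnn _)))//; have := sqr_ge0 x; lra.
Qed.

(** When the variance condition of [ottaviani] fails, the quadratic term is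
    already at least 1, so the bound holds trivially. *)
Lemma maxdev_tail (eta : R) : 0 < eta -> exists2 C, 0 <= C &
  forall A x, uniq A -> [set` A] `<=` Dom -> 0 < x ->
  prob P (maxdev d A x) <=
    eta * ((size A)%:R / x ^+ 2) + C * ((size A)%:R / x ^+ 2) ^+ 2.
Proof.
move=> eta0.
pose a : R := 2 ^+ d.
have a0 : 0 < a by rewrite exprn_gt0.
have eta'0 : 0 < eta / a ^+ 3 by rewrite divr_gt0// exprn_gt0.
have [C C0 HC] := tail_csum indX lawX Ixi exi Ixi2 eta'0.
have v0 : 0 <= v by apply: ex_ge0 => w; exact: sqr_ge0.
exists (a ^+ 5 * C + (a ^+ 3 * v) ^+ 2).
  by rewrite addr_ge0 ?mulr_ge0 ?exprn_ge0 ?mulr_ge0 ?exprn_ge0// ltW.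
move=> A x uA AD x0; set u := (size A)%:R / x ^+ 2.
have u0 : 0 <= u by rewrite divr_ge0// exprn_ge0// ltW.
have x'0 : 0 < x / a by rewrite divr_gt0.
have uE : (size A)%:R / (x / a) ^+ 2 = a ^+ 2 * u.
  by rewrite /u; field; rewrite !gt_eqF.
case: (leP (a * ((size A)%:R * v)) ((x / a) ^+ 2)) => h.
  have := ottaviani (leqnn d) uA AD x'0 h.
  rewrite -/a mulrCA divff ?gt_eqF// mulr1 => /le_trans; apply.
  have := HC A _ uA AD x'0; rewrite uE -(ler_pM2l a0) => /le_trans; apply.
  have -> : a * (eta / a ^+ 3 * (a ^+ 2 * u) + C * (a ^+ 2 * u) ^+ 2) =
      eta * u + a ^+ 5 * C * u ^+ 2 by field; rewrite gt_eqF.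
  rewrite lerD2l mulrDl lerDl; have := sqr_ge0 (a ^+ 3 * v); have := sqr_ge0 u; nra.
apply: (le_trans (prob_le1 _ (measurable_maxdev _ _ _))).
have : 1 <= a ^+ 3 * v * u.
  have x2 : 0 < x ^+ 2 by rewrite exprn_gt0.
  rewrite /u mulrA ler_pdivlMr// mul1r.
  move: h; rewrite expr_div_n ltr_pdivrMr ?exprn_gt0//.
  move=> /ltW /le_trans; apply; rewrite le_eqVlt; apply/orP; left; apply/eqP; ring.
set t := _ * u => t1.
have -> : (a ^+ 5 * C + (a ^+ 3 * v) ^+ 2) * u ^+ 2 = a ^+ 5 * C * u ^+ 2 + t ^+ 2.
  by rewrite /t; ring.
have : 0 <= a ^+ 5 * C * u ^+ 2.
  by rewrite mulr_ge0 ?exprn_ge0// mulr_ge0 ?exprn_ge0// ltW.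
have : 0 <= eta * u by rewrite mulr_ge0// ltW.
nra.
Qed.

End maximal.

(** * Index boxes and the centred field *)


Section boxes.
Context {d : nat}.
Notation idx := {ffun 'I_d -> nat}.
Implicit Types (l u m n : idx).

Definition inbox l u m := [forall i, (l i < m i <= u i)%N].

Definition ibox l u : seq idx :=
  let K := (\max_i u i).+1 in
  [seq [ffun i => val (f i)] | f : {ffun 'I_d -> 'I_K} in
    family (fun i => [pred a : 'I_K | (l i < a <= u i)%N])].

Definition shift l n : idx := [ffun i => (l i + n i)%N].

Lemma mem_ibox l u m : (m \in ibox l u) = inbox l u m.
Proof.
rewrite /ibox /inbox; apply/fintype.imageP/forallP => [[f /familyP fF ->] i|H].
  by rewrite ffunE; exact: fF.
have mK i : (m i < (\max_i u i).+1)%N.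
  by rewrite ltnS (leq_trans _ (leq_bigmax i))//; case/andP: (H i).
exists [ffun i => Ordinal (mK i)].
  by apply/familyP => i; rewrite ffunE; exact: H.
by apply/ffunP => i; rewrite !ffunE.
Qed.

Lemma ibox_uniq l u : uniq (ibox l u).
Proof.
rewrite map_inj_uniq ?enum_uniq// => f g /ffunP fg; apply/ffunP => i.
by apply: val_inj; have := fg i; rewrite !ffunE.
Qed.

Lemma size_ibox l u : (size (ibox l u) <= \prod_i (u i - l i))%N.
Proof.
rewrite size_image card_family foldrE big_map big_enum/=.
apply: leq_prod => i _; set K := (\max_i u i).+1.
rewrite -[leqRHS](size_iota (l i).+1) -(size_map (@inord K.-1)) cardE.
apply: uniq_leq_size; first exact: enum_uniq.
move=> a; rewrite mem_enum => /andP[la au].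
apply/mapP; exists (val a); last by rewrite inord_val.
rewrite mem_iota; move: la au => /=; set b := (nat_of_ord a); move: b => b /=; lia.
Qed.

Lemma ibox_positive l u : [set` ibox l u] `<=` positive_index.
Proof.
move=> m /=; rewrite mem_ibox => /forallP H i.
by case/andP: (H i) => lm _; exact: leq_ltn_trans lm.
Qed.

Lemma subset_ibox (l n m : idx) : (forall i, n i <= m i)%N ->
  [set` ibox l (shift l n)] `<=` [set` ibox l (shift l m)].
Proof.
move=> nm k /=; rewrite !mem_ibox => /forallP H; apply/forallP => i.
by have := H i; have := nm i; rewrite !ffunE; lia.
Qed.

End boxes.

Section field.
Context {disp : measure_display} {T : measurableType disp} {R : realType}.
Variable P : probability T R.
Context {d : nat}.
Notation idx := {ffun 'I_d -> nat}.
Variables (X : idx -> {RV P >-> R}) (mu : R).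
Implicit Types (l u m n : idx).

(** The centred field seen from the corner [l]; disjoint boxes carry independent copies of the
    same process. *)
Definition field l n w : R := csum X mu (ibox l (shift l n)) w.

Lemma csum_perm (s s' : seq idx) w : uniq s -> uniq s' -> s =i s' ->
  csum X mu s w = csum X mu s' w.
Proof. by move=> us us' ss; rewrite /csum; apply: perm_big; exact: uniq_perm. Qed.

Lemma field0 l n w i : n i = 0%N -> field l n w = 0.
Proof.
move=> ni; rewrite /field (_ : ibox _ _ = [::]) ?/csum ?big_nil//.
case E : (ibox _ _) => [//|m s].
have : m \in ibox l (shift l n) by rewrite E inE eqxx.
by rewrite mem_ibox => /forallP/(_ i); rewrite ffunE ni; lia.
Qed.

Lemma field_maxdev l u n w y : (forall i, n i <= u i)%N ->
  y <= `|field l n w| -> maxdev X mu d (ibox l (shift l u)) y w.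
Proof.
move=> nu yn; exists (shift l n) => //=.
rewrite (_ : csum _ _ _ _ = field l n w)//; apply: csum_perm.
- by rewrite filter_uniq// ibox_uniq.
- exact: ibox_uniq.
move=> m; rewrite mem_filter !mem_ibox /inbox.
apply/andP/forallP => [[/forallP H1 /forallP H2] i|H].
  have := H1 i; rewrite ltn_ord/= => ->; by case/andP: (H2 i) => ->.
split; apply/forallP => i; have := H i; have := nu i; rewrite !ffunE; first by lia.
by lia.
Qed.

Lemma smeas_field l n D : [set` ibox l (shift l n)] `<=` D -> smeas X D (field l n).
Proof. exact: smeas_csum. Qed.

End field.

(** * Dyadic weights *)


Section geometric.
Context {R : realType}.
Variable th : R.
Hypotheses (th0 : 0 < th) (th1 : th < 1).

(** The distance of [j] to [J], written with truncated subtractions. *)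
Definition nat_gap (j J : nat) : nat := (j - J + (J - j))%N.

Lemma geom_two_sided (J Q : nat) : \sum_(j < Q) th ^+ nat_gap j J <= 2 / (1 - th).
Proof.
have t0 : 0 < 1 - th by rewrite subr_gt0.
suff H : \sum_(j < Q) th ^+ nat_gap j J <=
    (th ^+ (J - Q) * th + (1 - th ^+ (Q - J))) / (1 - th).
  apply: (le_trans H); rewrite ler_pM2r ?invr_gt0//.
  have : th ^+ (J - Q) * th <= 1.
    by rewrite -exprSr exprn_ile1// ltW.
  have : 0 <= th ^+ (Q - J) by rewrite exprn_ge0// ltW.
  lra.
elim: Q => [|Q IH].
  rewrite big_ord0 divr_ge0 ?(ltW t0)// sub0n expr0 subrr addr0.
  by rewrite -exprSr exprn_ge0// ltW.
rewrite big_ord_recr/= (le_trans (lerD IH (lexx _)))//.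
rewrite -lerBrDl -mulrBl.
rewrite ler_pdivlMr// /nat_gap; case: (ltnP Q J) => QJ.
  have -> : (J - Q = (J - Q.+1).+1)%N by lia.
  rewrite (_ : (Q - J = 0)%N); last by lia.
  rewrite (_ : (Q.+1 - J = 0)%N); last by lia.
  by rewrite add0n expr0 !exprSr le_eqVlt; apply/orP; left; apply/eqP; ring.
rewrite (_ : (J - Q = 0)%N); last by lia.
rewrite (_ : (J - Q.+1 = 0)%N); last by lia.
rewrite (_ : (Q.+1 - J = (Q - J).+1)%N); last by lia.
by rewrite addn0 expr0 !exprSr le_eqVlt; apply/orP; left; apply/eqP; ring.
Qed.

Lemma geom_tail (J B Q : nat) :
  \sum_(j < Q) (if (j <= J + B)%N then 0 else th ^+ nat_gap j J) <= th ^+ B / (1 - th).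
Proof.
have t0 : 0 < 1 - th by rewrite subr_gt0.
suff H : \sum_(j < Q) (if (j <= J + B)%N then 0 else th ^+ nat_gap j J) <=
    th ^+ B.+1 * (1 - th ^+ (Q - (J + B).+1)) / (1 - th).
  apply: (le_trans H); rewrite ler_pM2r ?invr_gt0//.
  have : 0 <= th ^+ (Q - (J + B).+1) by rewrite exprn_ge0// ltW.
  have : 0 <= th ^+ B by rewrite exprn_ge0// ltW.
  have : th ^+ (Q - (J + B).+1) <= 1 by rewrite exprn_ile1// ltW.
  rewrite exprS; set a := th ^+ B; set b := th ^+ _ => h1 h2 h3.
  have : a * (1 - b) <= a by nra.
  have : 0 <= a * (1 - b) by nra.
  move: th0 th1; nra.
elim: Q => [|Q IH]; first by rewrite big_ord0 sub0n expr0 subrr mulr0 mul0r.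
rewrite big_ord_recr/= (le_trans (lerD IH (lexx _)))//.
rewrite -lerBrDl -mulrBl.
case: (leqP Q (J + B)) => QJ.
  rewrite (_ : (Q - (J + B).+1 = 0)%N); last by lia.
  rewrite (_ : (Q.+1 - (J + B).+1 = 0)%N); last by lia.
  by rewrite subrr mul0r.
rewrite ler_pdivlMr// /nat_gap.
rewrite (_ : (Q - J + (J - Q) = B.+1 + (Q - (J + B).+1))%N); last by lia.
rewrite (_ : (Q.+1 - (J + B).+1 = (Q - (J + B).+1).+1)%N); last by lia.
by rewrite exprD !exprS le_eqVlt; apply/orP; left; apply/eqP; ring.
Qed.

End geometric.

Lemma bernoulli_ineq (R : realDomainType) (x : R) (n : nat) : 0 <= x <= 1 ->
  1 - n%:R * x <= (1 - x) ^+ n.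
Proof.
move=> /andP[x0 x1]; elim: n => [|n IH]; first by rewrite mul0r subr0 expr0.
rewrite exprS (le_trans _ (ler_wpM2l _ IH)) ?subr_ge0// -natr1.
have : 0 <= n%:R * x * x by rewrite !mulr_ge0.
set a := n%:R; nra.
Qed.

Section dyadic_weights.
Context {R : realType} {d : nat}.
Hypothesis d0 : (0 < d)%N.
Notation idx := {ffun 'I_d -> nat}.
Implicit Types (a n : idx).

Definition vol n : R := \prod_i (n i)%:R.
Definition scale (J : nat) : R := 2 ^+ J.
(** The size of the fluctuations of the field at [n], in units of [rt J], that is tolerated.
    It is bounded for [n] comparable to the cube of side [scale J], grows for large [n], and
    grows for [n] close to a coordinate hyperplane; in this form it matches what the
    geometry of the level sets can absorb. *)
Definition weight J n : R :=
  (1 + vol n / scale J ^+ d) * (1 + \sum_i scale J / (n i)%:R).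
Definition pow2 a : idx := [ffun i => (2 ^ a i)%N].

Lemma scale_gt0 J : 0 < scale J.
Proof. by rewrite exprn_gt0. Qed.

Lemma vol_ge0 n : 0 <= vol n.
Proof. exact: prodr_ge0. Qed.

Lemma weight_ge1 J n : 1 <= weight J n.
Proof.
rewrite -[leLHS]mulr1 ler_pM//.
  by rewrite lerDl divr_ge0// ?vol_ge0// exprn_ge0// ltW// scale_gt0.
by rewrite lerDl sumr_ge0// => i _; rewrite divr_ge0// ltW// scale_gt0.
Qed.

Lemma weight_pow2 J n a : (forall i, (0 < n i <= 2 ^ a i)%N) ->
  (forall i, (2 ^ a i <= 2 * n i)%N) -> (2 ^- d) * weight J (pow2 a) <= weight J n.
Proof.
move=> na an; rewrite /weight mulrA ler_pM//.
- rewrite mulr_ge0 ?invr_ge0 ?exprn_ge0// addr_ge0// divr_ge0 ?vol_ge0// exprn_ge0// ltW// scale_gt0.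
- by [].
- by rewrite addr_ge0// sumr_ge0// => i _; rewrite divr_ge0// ltW// scale_gt0.
- rewrite mulrDr mulr1 lerD//.
    by rewrite invf_le1 ?exprn_gt0// exprn_ege1// ler1n.
  rewrite mulrA ler_pM2r ?invr_gt0 ?exprn_gt0 ?scale_gt0//.
  rewrite ler_pdivrMl ?exprn_gt0// /vol -[X in 2 ^+ X]card_ord -prodr_const -big_split/=.
  apply: ler_prod => i _; rewrite ffunE ler0n/= -natrM ler_nat; exact: an.
- rewrite lerD2l; apply: ler_sum => i _; rewrite ler_pM2l ?scale_gt0//.
  rewrite ffunE; have /andP[n0 na'] := na i.
  by rewrite lef_pV2 ?posrE ?ltr0n ?expn_gt0// ler_nat.
Qed.

(** Chosen so that [theta ^+ d >= 1/2]: a bound from above on the [d]-th root of 1/2 in which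
    no root occurs. *)
Definition theta : R := 1 - (2 * d%:R)^-1.

Lemma theta_bounds : 0 < theta < 1.
Proof.
have d1 : 1 <= d%:R :> R by rewrite ler1n.
have h : 0 < (2 * d%:R : R)^-1 by rewrite invr_gt0; lra.
have : (2 * d%:R : R)^-1 <= 2^-1 by rewrite lef_pV2 ?posrE; lra.
by rewrite /theta; lra.
Qed.

Lemma theta_exp : 2^-1 <= theta ^+ d.
Proof.
have d1 : 1 <= d%:R :> R by rewrite ler1n.
have := theta_bounds => /andP[t0 t1].
have h0 : 0 < (2 * d%:R : R)^-1 by rewrite invr_gt0; lra.
have tb : 0 <= (2 * d%:R : R)^-1 <= 1.
  by move: t0; rewrite /theta => ?; apply/andP; split; lra.
have := @bernoulli_ineq R _ d tb; rewrite -/theta.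
apply: le_trans; rewrite invfM mulrCA divff ?mulr1; last by rewrite gt_eqF//; lra.
lra.
Qed.

(** The left-hand side is the Chebyshev bound at [pow2 a]. With [z i = 2 ^ a i / scale J] and
    [p] their product, the denominator [(1 + p) ^ 2 / p * (1 + s) ^ 2] is at least [p], and at least
    the square of any [(z i)^-1]; together these dominate all the ratios. *)
Lemma dyadic_weight J a :
  (vol (pow2 a) / scale J ^+ d) / weight J (pow2 a) ^+ 2 <=
  \prod_i theta ^+ nat_gap (a i) J.
Proof.
have /andP[t0 t1] := theta_bounds.
pose z i : R := (2 ^+ a i) / scale J.
have z0 i : 0 < z i by rewrite divr_gt0 ?exprn_gt0// scale_gt0.
pose p := \prod_i z i.
have p0 : 0 < p by exact: prodr_gt0.
have pE : vol (pow2 a) / scale J ^+ d = p.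
  rewrite /p /z big_split/= -[X in _ ^+ X]card_ord -prodr_const -prodfV.
  by congr (_ * _); apply: eq_bigr => i _; rewrite ffunE natrX.
pose s := \sum_i (z i)^-1.
have sE : \sum_i scale J / (pow2 a i)%:R = s.
  by apply: eq_bigr => i _; rewrite ffunE natrX /z invf_div.
have s0 : 0 <= s by apply: sumr_ge0 => i _; rewrite invr_ge0 ltW.
rewrite /weight sE pE.
set D := (1 + p) ^+ 2 / p * (1 + s) ^+ 2.
have D0 : 0 < D by rewrite mulr_gt0 ?divr_gt0 ?exprn_gt0//; lra.
have -> : p / ((1 + p) * (1 + s)) ^+ 2 = D^-1.
  by rewrite /D; field; rewrite !gt_eqF//; lra.
rewrite -(@ler_pXn2r _ d)//; last 2 first.
- by rewrite nnegrE invr_ge0 ltW.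
- by rewrite nnegrE prodr_ge0// => i _; rewrite exprn_ge0// ltW.
apply: (@le_trans _ _ (\prod_i (2 ^- nat_gap (a i) J))); last first.
  rewrite -prodrXl; apply: ler_prod => i _.
  rewrite invr_ge0 exprn_ge0//= -exprM mulnC exprM -exprVn lerXn2r ?nnegrE ?invr_ge0//.
    by rewrite exprn_ge0// ltW.
  exact: theta_exp.
rewrite exprVn prodfV lef_pV2 ?posrE ?exprn_gt0//; last first.
  by apply: prodr_gt0 => i _; rewrite exprn_gt0.
have -> : \prod_i (2 ^+ nat_gap (a i) J : R) = p * \prod_i (2 ^+ (J - a i)) ^+ 2.
  rewrite /p -big_split/=; apply: eq_bigr => i _; rewrite /z /scale /nat_gap.
  case: (leqP J (a i)) => Ja.
    rewrite (_ : (J - a i = 0)%N); last by lia.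
    rewrite addn0 expr0 expr1n mulr1 -[in RHS](subnK Ja) exprD mulfK//.
  rewrite (_ : (a i - J = 0)%N); last by lia.
  rewrite add0n -[in X in _ / X](subnK (ltnW Ja)) exprD.
  by field; rewrite !expf_neq0// pnatr_eq0.
have D1 : 1 <= (1 + p) ^+ 2 / p by rewrite ler_pdivlMr//; nra.
have h1 : p <= (1 + p) ^+ 2 / p by rewrite ler_pdivlMr//; nra.
apply: (@le_trans _ _ ((1 + p) ^+ 2 / p * ((1 + s) ^+ 2) ^+ d)).
  rewrite ler_pM ?(ltW p0)//; first by apply: prodr_ge0 => i _; exact: sqr_ge0.
  rewrite -[X in _ ^+ X]card_ord -prodr_const; apply: ler_prod => i _.
  rewrite sqr_ge0/= lerXn2r ?nnegrE ?exprn_ge0//; first by lra.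
  case: (leqP J (a i)) => Ja.
    by rewrite (_ : (J - a i = 0)%N) ?expr0; [lra|lia].
  have -> : 2 ^+ (J - a i) = (z i)^-1.
    rewrite /z invf_div /scale -[in RHS](subnK (ltnW Ja)) exprD mulfK//.
  have : (z i)^-1 <= s.
    rewrite /s (bigD1 i)//= lerDl; apply: sumr_ge0 => j _.
    by rewrite invr_ge0 ltW.
  lra.
rewrite /D [leRHS]exprMn; apply: ler_wpM2r; first by rewrite exprn_ge0// sqr_ge0.
by rewrite -[leLHS]expr1; apply: ler_weXn2l.
Qed.

(** The sum factorises over the coordinates; coordinate [i0] contributes a tail of a geometric
    series and the others two-sided geometric series. *)
Lemma sum_dyadic (J B Q : nat) (i0 : 'I_d) (th := theta) :
  \sum_(a : {ffun 'I_d -> 'I_Q} | (J + B < a i0)%N) \prod_i th ^+ nat_gap (a i) J <=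
  th ^+ B * (2 / (1 - th)) ^+ d.
Proof.
have /andP[t0 t1] := theta_bounds.
have tt : 0 < 1 - th by rewrite subr_gt0.
pose F (i : 'I_d) (j : 'I_Q) := if (i == i0) && (j <= J + B)%N then 0 else th ^+ nat_gap j J.
have F0 i j : 0 <= F i j.
  by rewrite /F; case: ifP => // _; rewrite exprn_ge0// ltW.
apply: (@le_trans _ _ (\sum_(a : {ffun 'I_d -> 'I_Q}) \prod_i F i (a i))).
  rewrite big_mkcond/=; apply: ler_sum => a _; case: ifPn => [ai|_]; last exact: prodr_ge0.
  rewrite le_eqVlt; apply/orP; left; apply/eqP; apply: eq_bigr => i _.
  rewrite /F; case: ifP => // /andP[/eqP ->]; lia.
rewrite -bigA_distr_bigA/=.
apply: (@le_trans _ _ (\prod_(i < d) ((if i == i0 then th ^+ B else 1) * (2 / (1 - th))))).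
  apply: ler_prod => i _; rewrite sumr_ge0//=.
  rewrite /F; case: (i == i0) => /=.
    apply: (le_trans (@geom_tail R th t0 t1 J B Q)).
    rewrite ler_wpM2l ?exprn_ge0 ?(ltW t0)// -[leLHS]mul1r.
    by rewrite ler_pM2r ?invr_gt0// ler1n.
  rewrite mul1r; exact: geom_two_sided.
rewrite big_split/= prodr_const card_ord -big_mkcond/= big_pred1_eq.
exact: lexx.
Qed.

Lemma weight_floor J (n g : idx) : (forall i, 0 < g i)%N -> (forall i, g i <= n i)%N ->
  (forall i, n i <= 2 * g i)%N -> weight J g <= 2 * weight J n.
Proof.
move=> g0 gn ng; rewrite /weight mulrCA ler_pM//.
- by rewrite addr_ge0// divr_ge0 ?vol_ge0// exprn_ge0// ltW// scale_gt0.
- by rewrite addr_ge0// sumr_ge0// => i _; rewrite divr_ge0// ltW// scale_gt0.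
- rewrite lerD2l ler_pM2r ?invr_gt0 ?exprn_gt0 ?scale_gt0//.
  by apply: ler_prod => i _; rewrite ler0n/= ler_nat.
- rewrite mulrDr mulr1 lerD//; first by lra.
  rewrite mulr_sumr; apply: ler_sum => i _.
  rewrite mulrCA ler_pM2l ?scale_gt0// -[leLHS]mul1r.
  have gi : 0 < (g i)%:R :> R by rewrite ltr0n.
  have ni : 0 < (n i)%:R :> R by rewrite ltr0n (leq_trans (g0 i)).
  rewrite ler_pdivrMr// mulrAC ler_pdivlMr// mul1r.
  by rewrite -natrM ler_nat.
Qed.

End dyadic_weights.

(** * Fluctuations over far boxes *)


Section more_prob.
Context {disp : measure_display} {T : measurableType disp} {R : realType}.
Variable P : probability T R.

Lemma prob_bigcup_le (F : nat -> set T) (c : R) : (forall n, measurable (F n)) ->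
  (forall n m, (n <= m)%N -> F n `<=` F m) -> (forall n, prob P (F n) <= c) ->
  prob P (\bigcup_n F n) <= c.
Proof.
move=> mF ndF Fc.
have mU : measurable (\bigcup_n F n) by exact: bigcup_measurable.
rewrite -lee_fin -probE//.
have cv : P \o F @ \oo --> P (\bigcup_n F n).
  by apply: nondecreasing_cvg_mu => // n m nm; apply/subsetPset; exact: ndF.
rewrite -(cvg_lim _ cv)//; apply: lime_le; first by apply/cvg_ex; eexists; exact: cv.
by apply: nearW => n /=; rewrite (probE P)// lee_fin.
Qed.

Lemma prob_sum_le (J : finType) (Q : pred J) (F : J -> set T) (E : set T) (c : J -> R) :
  (forall j, measurable (F j)) -> measurable E ->
  (forall w, E w -> exists2 j, Q j & F j w) -> (forall j, Q j -> prob P (F j) <= c j) ->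
  prob P E <= \sum_(j | Q j) c j.
Proof.
move=> mF mE EF Fc.
apply: (@le_trans _ _ (prob P (\big[setU/set0]_(j | Q j) F j))).
  apply: le_prob => //; first exact: bigsetU_measurable.
  move=> w /EF[j Qj Fj]; rewrite -bigcup_seq_cond.
  by exists j => //=; rewrite mem_index_enum.
by apply: (le_trans (prob_bigU_le P _ _ mF)); exact: ler_sum.
Qed.

End more_prob.

Section sig_more.
Context {disp : measure_display} {T : measurableType disp} {R : realType}.
Variable P : probability T R.
Context {I : choiceType}.
Variables (X : I -> {RV P >-> R}).

Lemma sig_bigcup_in (D : set I) (J : countType) (Q : set J) (E : J -> set T) :
  (forall j, Q j -> sig X D (E j)) -> sig X D (\bigcup_(j in Q) E j).
Proof.
move=> sE; rewrite bigcup_mkcond; apply: sig_bigcup => j.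
by case: ifPn => [/set_mem|_]; [exact: sE|exact: sigma_algebra0].
Qed.

End sig_more.

Section tail_event.
Context {disp : measure_display} {T : measurableType disp} {R : realType}.
Variable P : probability T R.
Context {d : nat}.
Hypothesis d0 : (0 < d)%N.
Notation idx := {ffun 'I_d -> nat}.
Variables (X : idx -> {RV P >-> R}) (xi : {RV P >-> R}) (mu : R).
Hypothesis indX : mutually_independent positive_index X.
Hypothesis lawX : forall i, positive_index i -> same_law (X i) xi.
Hypotheses (Ixi : integ P xi) (exi : ex P xi = mu).
Hypothesis Ixi2 : integ P (fun w => (xi w - mu) ^+ 2).
Implicit Types (l n : idx).

Lemma maxdev_chebyshev : exists2 C : R, 0 < C &
  forall A x, uniq A -> [set` A] `<=` positive_index -> 0 < x ->
  prob P (maxdev X mu d A x) <= C * ((size A)%:R / x ^+ 2).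
Proof.
have [C C0 HC] := maxdev_tail indX lawX Ixi exi Ixi2 ltr01.
exists (2 + C); first by lra.
move=> A x uA AD x0; have := HC A x uA AD x0.
have u0 : 0 <= (size A)%:R / x ^+ 2 by rewrite divr_ge0// exprn_ge0// ltW.
have := prob_le1 P (@measurable_maxdev _ _ _ P _ X mu d A x).
move: u0; set u := (size A)%:R / _; set p := prob _ _ => u0 p1 h.
case: (leP (C * u) 1) => Cu; last by nra.
have : C * u ^+ 2 <= u by rewrite expr2 mulrA ler_piMl.
nra.
Qed.

(** [scale J ^+ d] is the level [t]; the field over a cube of that volume fluctuates by about
    [rt J]. *)
Definition rt (J : nat) : R := Num.sqrt (scale J ^+ d).

Lemma rt_gt0 J : 0 < rt J.
Proof. by rewrite sqrtr_gt0 exprn_gt0// scale_gt0. Qed.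

Lemma rt_sqr J : rt J ^+ 2 = scale J ^+ d.
Proof. by rewrite sqr_sqrtr// exprn_ge0// ltW// scale_gt0. Qed.

Definition bad eps l J n : set T :=
  [set w | eps * rt J * weight J n < `|field X mu l n w|].

Lemma sig_bad eps l J n D : [set` ibox l (shift l n)] `<=` D ->
  sig X D (bad eps l J n).
Proof.
move=> lD; rewrite (_ : bad _ _ _ _ = ~` [set w | `|field X mu l n w| <= eps * rt J * weight J n]).
  by apply: sigC; apply: sig_ge; apply: smeas_norm; exact: smeas_field.
by apply/seteqP; split => w /=; rewrite /bad /= ltNge => /negP.
Qed.

(** The cutoff [2 ^ Q] makes the event depend on finitely many variables; the bounds
    are uniform in [Q]. *)
Definition tailbad eps l J B Q : set T :=
  \bigcup_(n in [set n : idx | (forall i, (n i <= 2 ^ Q)%N) /\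
    exists i, (2 ^ (J + B) < n i)%N]) bad eps l J n.

Lemma sig_tailbad eps l J B Q :
  sig X [set` ibox l (shift l [ffun=> (2 ^ Q)%N])] (tailbad eps l J B Q).
Proof.
apply: sig_bigcup_in => n [nQ _]; apply: sig_bad; apply: subset_ibox => i.
by rewrite ffunE.
Qed.

Lemma measurable_tailbad eps l J B Q : measurable (tailbad eps l J B Q).
Proof. exact: sig_measurable (@sig_tailbad _ _ _ _ _). Qed.

Lemma weight_ge0 J n : 0 <= weight J n :> R.
Proof. exact: le_trans (@weight_ge1 R d J n). Qed.

(** Every [n] lies in a dyadic box [pow2 a] whose sides are less than twice those of [n], so
    the maximal inequality over the dyadic boxes, weighted by [dyadic_weight], covers all [n]. *)
Lemma tailbad_bound : exists2 K : R, 0 < K & forall eps l J B Q, 0 < eps ->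
  prob P (tailbad eps l J B Q) <= K * theta (R := R) (d := d) ^+ B / eps ^+ 2.
Proof.
have [C C0 HC] := maxdev_chebyshev.
have /andP[t0 t1] := @theta_bounds R d d0.
set th := theta in t0 t1 *.
have tt : 0 < 1 - th by rewrite subr_gt0.
exists (d%:R * (C * 4 ^+ d * (2 / (1 - th)) ^+ d)).
  by rewrite mulr_gt0 ?ltr0n// mulr_gt0 ?mulr_gt0 ?exprn_gt0// divr_gt0.
move=> eps l J B Q e0.
pose pa (a : {ffun 'I_d -> 'I_Q.+1}) : idx := [ffun i => val (a i)].
pose y (a : {ffun 'I_d -> 'I_Q.+1}) := eps * rt J * (2 ^- d * weight J (pow2 (pa a))).
pose box (a : {ffun 'I_d -> 'I_Q.+1}) := ibox l (shift l (pow2 (pa a))).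
pose E (a : {ffun 'I_d -> 'I_Q.+1}) := maxdev X mu d (box a) (y a).
have mE a : measurable (E a) by exact: measurable_maxdev.
have y0 a : 0 < y a.
  have W0 := lt_le_trans ltr01 (@weight_ge1 R d J (pow2 (pa a))).
  apply: mulr_gt0; first by rewrite mulr_gt0// rt_gt0.
  by rewrite (pmulr_lgt0 _ W0) invr_gt0 exprn_gt0.
have PE a : prob P (E a) <= C * 4 ^+ d / eps ^+ 2 * \prod_i th ^+ nat_gap (a i) J.
  apply: (le_trans (HC _ _ (ibox_uniq _ _) (@ibox_positive _ _ _) (y0 a))).
  have -> : C * 4 ^+ d / eps ^+ 2 * \prod_i th ^+ nat_gap (a i) J =
      C * (4 ^+ d / eps ^+ 2 * \prod_i th ^+ nat_gap (a i) J) by ring.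
  rewrite ler_pM2l//.
  have := @dyadic_weight R d d0 J (pa a).
  rewrite (eq_bigr (fun i => th ^+ nat_gap (a i) J)); last by move=> i _; rewrite ffunE.
  set W := weight J _; set V := vol _ => h.
  have W0 : 0 < W by exact: lt_le_trans ltr01 (@weight_ge1 R d J _).
  have S0 : 0 < scale J ^+ d :> R by rewrite exprn_gt0// scale_gt0.
  apply: (@le_trans _ _ (4 ^+ d / eps ^+ 2 * (V / scale J ^+ d / W ^+ 2))); last first.
    by rewrite ler_pM2l// divr_gt0// exprn_gt0.
  have -> : y a ^+ 2 = eps ^+ 2 * scale J ^+ d * W ^+ 2 / 4 ^+ d.
    have E4 : (2 ^- d) ^+ 2 = (4 ^+ d)^-1 :> R.
      by rewrite exprVn -exprM mulnC exprM; congr (_ ^+ d)^-1; ring.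
    by rewrite /y !exprMn rt_sqr E4 -/W; ring.
  have -> : 4 ^+ d / eps ^+ 2 * (V / scale J ^+ d / W ^+ 2) =
     V / (eps ^+ 2 * scale J ^+ d * W ^+ 2 / 4 ^+ d).
    by field; rewrite ?(gt_eqF e0) ?(gt_eqF S0) ?(gt_eqF W0)// expf_neq0.
  rewrite ler_wpM2r//.
    by rewrite invr_ge0 divr_ge0 ?exprn_ge0// (mulr_ge0 (mulr_ge0 _ (ltW S0)))// sqr_ge0.
  rewrite /V /vol -natr_prod ler_nat (leq_trans (size_ibox _ _))//.
  by apply: leq_prod => i _; rewrite !ffunE addKn.
have -> : d%:R * (C * 4 ^+ d * (2 / (1 - th)) ^+ d) * th ^+ B / eps ^+ 2 =
   \sum_(i0 < d) (C * 4 ^+ d / eps ^+ 2 * (th ^+ B * (2 / (1 - th)) ^+ d)).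
  by rewrite sumr_const card_ord -[RHS]mulr_natl; ring.
pose EE (i0 : 'I_d) := \bigcup_(a in [set a : {ffun 'I_d -> 'I_Q.+1} | (J + B < a i0)%N]) E a.
have mEE i0 : measurable (EE i0).
  by apply: fin_bigcup_measurable => //; exact: finite_finset.
apply: (@prob_sum_le _ _ _ P _ predT EE) => //; first exact: measurable_tailbad.
  move=> w [n /= [nQ [i0 ni0]]] nbad.
  have n0 i : (0 < n i)%N.
    rewrite lt0n; apply/eqP => ni; move: nbad; rewrite /bad/= (@field0 _ _ _ _ _ X mu l n w i ni) normr0.
    by rewrite ltNge (mulr_ge0 (mulr_ge0 (ltW e0) (ltW (rt_gt0 J))))// weight_ge0.
  have aQ i : (up_log 2 (n i) < Q.+1)%N.
    by rewrite ltnS; apply: leq_trans (leq_up_log _ (nQ i)) _; rewrite up_expnK.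
  exists i0 => //; exists [ffun i => Ordinal (aQ i)].
    rewrite /= ffunE/= ltnNge; apply/negP => h.
    move: ni0; rewrite ltnNge; apply/negP; rewrite negbK.
    by rewrite (leq_trans (@up_logP 2 (n i0) isT))// leq_exp2l.
  apply: (@field_maxdev _ _ _ _ _ _ _ _ _ n).
    by move=> i; rewrite !ffunE /=; exact: up_logP.
  rewrite (le_trans _ (ltW nbad))// ler_pM2l ?mulr_gt0 ?rt_gt0//.
  apply: weight_pow2 => i; rewrite !ffunE /=; first by rewrite n0/= up_logP.
  case: (ltnP 1 (n i)) => n1; last first.
    by rewrite (_ : n i = 1%N) ?up_log1//; have := n0 i; lia.
  have /andP[h _] := @up_log_bounds 2 (n i) isT n1.
  have k0 : (0 < up_log 2 (n i))%N by rewrite up_log_gt0.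
  by rewrite -(prednK k0) expnS leq_mul2l/= ltnW.
move=> i0 _; apply: (@le_trans _ _ (\sum_(a : {ffun 'I_d -> 'I_Q.+1} | (J + B < a i0)%N)
    (C * 4 ^+ d / eps ^+ 2 * \prod_i th ^+ nat_gap (a i) J))).
  apply: (@prob_sum_le _ _ _ P _ _ E) => //.
rewrite -mulr_sumr ler_wpM2l//; last exact: (sum_dyadic d0).
by rewrite divr_ge0 ?exprn_ge0 ?(ltW e0)// mulr_ge0 ?exprn_ge0// ltW.
Qed.

End tail_event.

(** * Oscillation of the field between grid points *)


Section slabs.
Context {disp : measure_display} {T : measurableType disp} {R : realType}.
Variable P : probability T R.
Context {d : nat}.
Notation idx := {ffun 'I_d -> nat}.
Variables (X : idx -> {RV P >-> R}) (mu : R).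
Implicit Types (l n : idx).
Local Notation rt := (@rt R d).

Definition slab l (h K : nat) (i : 'I_d) (k : nat) : seq idx :=
  ibox (shift l [ffun j => if j == i then (k * h)%N else 0%N])
       (shift l [ffun j => if j == i then (k.+1 * h)%N else K]).

Definition floor_to (h : nat) n : idx := [ffun i => (n i %/ h * h)%N].

Lemma size_slab l h G i k : (size (slab l h (G * h) i k) * G <= (G * h) ^ d)%N.
Proof.
apply: (@leq_trans ((h * \prod_(j < d | j != i) (G * h)) * G)).
  rewrite leq_mul2r (leq_trans (size_ibox _ _)) ?orbT//.
  rewrite (bigD1 i)//= !ffunE eqxx leq_mul//; first by nia.
  by apply: leq_prod => j ji; rewrite !ffunE (negbTE ji); lia.
rewrite (eq_bigl (mem (predC1 i)))//= prod_nat_const cardC1 card_ord.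
by rewrite mulnC mulnA -expnS prednK// (leq_ltn_trans (leq0n i) (ltn_ord i)).
Qed.

(** Round the coordinates of [n] down one at a time; each rounding removes a
    partial sum over one slab. *)
Lemma slab_osc l h G (n : idx) y w : (0 < h)%N -> 0 <= y ->
  (forall i k, (k < G)%N -> ~ maxdev X mu d (slab l h (G * h) i k) y w) ->
  (forall i, (n i <= G * h)%N) ->
  `|field X mu l n w - field X mu l (floor_to h n) w| <= d%:R * y.
Proof.
move=> h0 y0 H nK.
pose nt t : idx := [ffun j : 'I_d => if (j < t)%N then floor_to h n j else n j].
have -> : floor_to h n = nt d by apply/ffunP => j; rewrite [RHS]ffunE ltn_ord.
have main t : (t <= d)%N -> `|field X mu l n w - field X mu l (nt t) w| <= t%:R * y.
  elim: t => [_|t IH td].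
    by rewrite (_ : nt 0%N = n) ?subrr ?normr0 ?mul0r//; apply/ffunP => j; rewrite ffunE.
  rewrite -[X in X - _](subrK (field X mu l (nt t) w)) -addrA -natr1 mulrDl mul1r.
  rewrite (le_trans (ler_normD _ _))// lerD//; first exact: IH (ltnW td).
  pose i := Ordinal td; pose k := (n i %/ h)%N.
  have nti : nt t i = n i by rewrite ffunE ltnn.
  have ntSi : nt t.+1 i = (k * h)%N by rewrite !ffunE ltnSn.
  have ntj j : j != i -> nt t.+1 j = nt t j.
    move=> ji; rewrite [LHS]ffunE [RHS]ffunE ltnS leq_eqVlt.
    by case: eqP => // jt; case/eqP: ji; apply: val_inj.
  have kn : (k * h <= n i)%N by exact: leq_trunc_div.
  have nk : (n i < k.+1 * h)%N by rewrite -ltn_divLR.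
  have E1 j : [ffun j => if j == i then (k * h)%N else 0%N] j =
      (if j == i then (k * h)%N else 0%N) by rewrite ffunE.
  have E2 j : [ffun j => if j == i then (k.+1 * h)%N else (G * h)%N] j =
      (if j == i then (k.+1 * h)%N else (G * h)%N) by rewrite ffunE.
  case: (ltnP k G) => kG; last first.
    rewrite (_ : nt t.+1 = nt t) ?subrr ?normr0//; apply/ffunP => j.
    case: (eqVneq j i) => [->|ji]; last exact: ntj.
    rewrite nti ntSi; have := nK i; nia.
  rewrite {1}/field (csum_filter X mu _ (fun m : idx => m i <= l i + k * h)%N).
  rewrite (_ : csum X mu [seq m : idx <- _ | (m i <= _)%N] w = field X mu l (nt t.+1) w); last first.
    apply: csum_perm; [by rewrite filter_uniq// ibox_uniq|exact: ibox_uniq|].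
    move=> m; rewrite mem_filter !mem_ibox /inbox; apply/andP/forallP.
      move=> [mi /forallP Hm] j; have := Hm j; rewrite ![shift _ _ j]ffunE.
      case: (eqVneq j i) => [->|ji]; first by rewrite ntSi nti; lia.
      by rewrite ntj.
    move=> Hm; split.
      by have := Hm i; rewrite ffunE ntSi; lia.
    apply/forallP => j; have := Hm j; rewrite ![shift _ _ j]ffunE.
    case: (eqVneq j i) => [->|ji]; last by rewrite ntj.
    by rewrite ntSi nti; lia.
  rewrite addrC addKr.
  have /negP : ~ (y <= `|csum X mu [seq m <- slab l h (G * h) i k | below d (shift l (nt t)) m] w|).
    by move=> ym; apply: (H i k kG); exists (shift l (nt t)).
  rewrite -ltNge => /ltW; apply: le_trans; rewrite le_eqVlt; apply/orP; left; apply/eqP.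
  congr `|_|; apply: csum_perm; [by rewrite filter_uniq// ibox_uniq|by rewrite filter_uniq// ibox_uniq|].
  move=> m; rewrite !mem_filter !mem_ibox /inbox /below; apply/andP/andP.
    move=> [mi /forallP Hm]; split; apply/forallP => j.
      by rewrite ltn_ord; case/andP: (Hm j).
    have := Hm j; have := nK j; rewrite ![shift _ _ j]ffunE E1 E2.
    case: (eqVneq j i) => [ji|ji]; first by rewrite ji nti; lia.
    have : (nt t j <= n j)%N by rewrite ffunE; case: ifP; rewrite ?ffunE// leq_trunc_div.
    by lia.
  move=> [/forallP H1 /forallP H2]; split.
    by have := H2 i; rewrite ![shift _ _ i]ffunE E1 E2 eqxx; lia.
  apply/forallP => j; have := H1 j; have := H2 j; rewrite ltn_ord/=.
  rewrite ![shift _ _ j]ffunE E1 E2; lia.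
exact: main.
Qed.

Definition slabbad eps l J B r : set T :=
  \bigcup_(p : 'I_d * 'I_(2 ^ (B + r)))
    maxdev X mu d (slab l (2 ^ (J - r)) (2 ^ (J + B)) p.1 p.2) (eps * rt J / d%:R).

Lemma sig_slabbad eps l J B r : (r <= J)%N ->
  sig X [set` ibox l (shift l [ffun=> (2 ^ (J + B))%N])] (slabbad eps l J B r).
Proof.
move=> rJ; apply: sig_bigcup => -[i k] /=; apply: sig_maxdev => m /=.
rewrite !mem_ibox => /forallP H; apply/forallP => j; have := H j; rewrite !ffunE.
case: eqP => _; last by lia.
have := ltn_ord k; move: (nat_of_ord k) => k' kl.
have : (k'.+1 * 2 ^ (J - r) <= 2 ^ (J + B))%N.
  rewrite (_ : (J + B = (B + r) + (J - r))%N); last by lia.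
  by rewrite expnD leq_mul2r kl orbT.
by lia.
Qed.

Lemma measurable_slabbad eps l J B r : (r <= J)%N -> measurable (slabbad eps l J B r).
Proof. move=> rJ; exact: sig_measurable (@sig_slabbad _ _ _ _ _ rJ). Qed.

End slabs.

Section slab_probability.
Context {disp : measure_display} {T : measurableType disp} {R : realType}.
Variable P : probability T R.
Context {d : nat}.
Hypothesis d0 : (0 < d)%N.
Notation idx := {ffun 'I_d -> nat}.
Variables (X : idx -> {RV P >-> R}) (xi : {RV P >-> R}) (mu : R).
Hypothesis indX : mutually_independent positive_index X.
Hypothesis lawX : forall i, positive_index i -> same_law (X i) xi.
Hypotheses (Ixi : integ P xi) (exi : ex P xi = mu).
Hypothesis Ixi2 : integ P (fun w => (xi w - mu) ^+ 2).
Implicit Types (l n : idx).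
Local Notation rt := (@rt R d).

(** There are [d * G] slabs, each with ratio [size / x ^ 2] of order [1 / G]. In [maxdev_tail] the
    linear term adds up to a multiple of its small constant, and the quadratic one
    to [O (1 / G)]. *)
Lemma slabbad_bound (eps delta : R) B : 0 < eps -> 0 < delta -> exists r,
  forall l J, (r <= J)%N -> prob P (slabbad X mu eps l J B r) <= delta.
Proof.
move=> e0 dl0.
have dR : 0 < d%:R :> R by rewrite ltr0n.
pose c : R := (2 ^+ B) ^+ d * d%:R ^+ 2 / eps ^+ 2.
have c0 : 0 < c by rewrite divr_gt0 ?mulr_gt0 ?exprn_gt0.
have eta0 : 0 < delta / (2 * d%:R * c) by rewrite divr_gt0// (mulr_gt0 (mulr_gt0 _ dR) c0).
have [C C0 HC] := maxdev_tail indX lawX Ixi exi Ixi2 eta0.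
pose r := Num.bound (2 * d%:R * C * c ^+ 2 / delta).
exists r => l J rJ.
pose G := (2 ^ (B + r))%N.
have G0 : (0 < G)%N by rewrite expn_gt0.
have GR : 0 < G%:R :> R by rewrite ltr0n.
have JB : (2 ^ (J + B) = G * 2 ^ (J - r))%N.
  by rewrite /G -expnD; congr (2 ^ _)%N; lia.
have Gr : 2 * d%:R * C * c ^+ 2 / delta <= G%:R.
  have nn : 0 <= 2 * d%:R * C * c ^+ 2 / delta.
    by rewrite divr_ge0 ?(ltW dl0)// mulr_ge0 ?sqr_ge0// mulr_ge0// mulr_ge0// ltW.
  rewrite (le_trans (ltW (archi_boundP nn)))// ler_nat -/r.
  by rewrite (leq_trans (ltnW (ltn_expl r (isT : 1 < 2)%N)))// leq_exp2l// leq_addl.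
apply: (@le_trans _ _ (\sum_(p : 'I_d * 'I_G)
    (delta / (2 * d%:R * c) * (c / G%:R) + C * (c / G%:R) ^+ 2))); last first.
  rewrite sumr_const card_prod !card_ord -[leLHS]mulr_natl natrM.
  have -> : d%:R * G%:R * (delta / (2 * d%:R * c) * (c / G%:R) + C * (c / G%:R) ^+ 2) =
     delta / 2 + d%:R * C * c ^+ 2 / G%:R.
    by field; rewrite !gt_eqF.
  have : d%:R * C * c ^+ 2 / G%:R <= delta / 2.
    rewrite ler_pdivrMr//; move: Gr; rewrite ler_pdivrMr//; lra.
  lra.
apply: (@prob_sum_le _ _ _ P _ predT (fun p : 'I_d * 'I_G => maxdev X mu d
    (slab l (2 ^ (J - r)) (2 ^ (J + B)) p.1 p.2) (eps * rt J / d%:R))).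
- by move=> p; exact: measurable_maxdev.
- exact: measurable_slabbad.
- by move=> w [p _ Hp]; exists p.
move=> p _.
have y0 : 0 < eps * rt J / d%:R :> R by rewrite divr_gt0// mulr_gt0// rt_gt0.
apply: (le_trans (HC _ _ (ibox_uniq _ _) (@ibox_positive _ _ _) y0)).
have us : (size (slab l (2 ^ (J - r)) (2 ^ (J + B)) p.1 p.2))%:R / (eps * rt J / d%:R) ^+ 2 <= c / G%:R.
  rewrite JB; have := size_slab l (2 ^ (J - r)) G p.1 p.2.
  rewrite -JB -(@ler_nat R) natrM natrX natrX exprD exprMn -/(scale J).
  set s := (size _)%:R => h.
  have S0 : 0 < scale J ^+ d :> R by rewrite exprn_gt0// scale_gt0.
  have -> : (eps * rt J / d%:R) ^+ 2 = eps ^+ 2 * scale J ^+ d / d%:R ^+ 2.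
    by rewrite !exprMn rt_sqr exprVn.
  rewrite ler_pdivrMr; last by rewrite divr_gt0 ?mulr_gt0 ?exprn_gt0.
  have -> : c / G%:R * (eps ^+ 2 * scale J ^+ d / d%:R ^+ 2) = scale J ^+ d * (2 ^+ B) ^+ d / G%:R.
    by rewrite /c; field; rewrite !gt_eqF.
  by rewrite ler_pdivlMr.
set u := _ / _ in us *.
have u0 : 0 <= u by rewrite divr_ge0// sqr_ge0.
apply: lerD; first by rewrite ler_pM2l.
by rewrite ler_wpM2l// lerXn2r ?nnegrE// (le_trans u0).
Qed.

End slab_probability.

(** * A smooth bump with a second-order Taylor formula *)


Section spline.
Context {R : realType}.
Implicit Types x h : R.

Definition pos x := Num.max x 0.

Lemma posP x : (0 <= x /\ pos x = x) \/ (x <= 0 /\ pos x = 0).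
Proof. by rewrite /pos; case: (leP x 0) => h; [right|left; split => //; exact: ltW]. Qed.

(** The integral of the quadratic B-spline: a twice differentiable step from 0 to 1
    on the interval from 0 to 3. The next two functions are its first derivative and
    half its second derivative. *)
Definition step x : R :=
  (pos x ^+ 3 - 3 * pos (x - 1) ^+ 3 + 3 * pos (x - 2) ^+ 3 - pos (x - 3) ^+ 3) / 6.
Definition step1 x : R :=
  (pos x ^+ 2 - 3 * pos (x - 1) ^+ 2 + 3 * pos (x - 2) ^+ 2 - pos (x - 3) ^+ 2) / 2.
Definition step2 x : R :=
  (pos x - 3 * pos (x - 1) + 3 * pos (x - 2) - pos (x - 3)) / 2.

(** All functions built on the knots 0, 1, 2, 3 are checked on the five intervals they cut out. *)
Lemma step_case (Q : R -> R -> R -> R -> Prop) x :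
  (x <= 0 -> Q 0 0 0 0) -> (0 <= x <= 1 -> Q x 0 0 0) ->
  (1 <= x <= 2 -> Q x (x - 1) 0 0) -> (2 <= x <= 3 -> Q x (x - 1) (x - 2) 0) ->
  (3 <= x -> Q x (x - 1) (x - 2) (x - 3)) ->
  Q (pos x) (pos (x - 1)) (pos (x - 2)) (pos (x - 3)).
Proof.
move=> h0 h1 h2 h3 h4.
have [[x0 ->]|[x0 ->]] := posP x; have [[x1 ->]|[x1 ->]] := posP (x - 1);
have [[x2 ->]|[x2 ->]] := posP (x - 2); have [[x3 ->]|[x3 ->]] := posP (x - 3);
first [by apply: h4; lra|by apply: h3; lra|by apply: h2; lra|by apply: h1; lra|
  by apply: h0; lra|by exfalso; lra].
Qed.

Lemma step_bounds x : 0 <= step x <= 1.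
Proof.
rewrite /step; apply: (@step_case (fun a b c e =>
  is_true (0 <= (a ^+ 3 - 3 * b ^+ 3 + 3 * c ^+ 3 - e ^+ 3) / 6 <= 1))).
- by move=> _; rewrite expr0n/=; lra.
- move=> /andP[? ?]; rewrite expr0n/= !mulr0 subr0 addr0 subr0.
  have : 0 <= x ^+ 3 <= 1 by rewrite exprn_ge0// exprn_ile1.
  by move=> /andP[? ?]; lra.
- move=> /andP[? ?]; rewrite expr0n/= !mulr0 addr0 subr0.
  have -> : (x ^+ 3 - 3 * (x - 1) ^+ 3) / 6 =
    (1 + 3 * (x - 1) + 3 * (x - 1) ^+ 2 - 2 * (x - 1) ^+ 3) / 6 by field.
  have y0 : 0 <= x - 1 by lra. have y1 : x - 1 <= 1 by lra.
  set y := x - 1 in y0 y1 *.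
  have h2 : 0 <= y ^+ 2 <= 1 by rewrite exprn_ge0// exprn_ile1.
  have h3 : 0 <= y ^+ 3 by rewrite exprn_ge0.
  have h23 : y ^+ 3 <= y ^+ 2 by rewrite exprS ler_piMl//; lra.
  have h4 : 0 <= (y - 1) ^+ 2 * (y + 2) by rewrite mulr_ge0 ?sqr_ge0//; lra.
  have /andP[h20 h21] := h2.
  by apply/andP; split; nra.
- move=> /andP[? ?]; rewrite expr0n/= subr0.
  have -> : (x ^+ 3 - 3 * (x - 1) ^+ 3 + 3 * (x - 2) ^+ 3) / 6 =
    1 - (3 - x) ^+ 3 / 6 by field.
  have : 0 <= (3 - x) ^+ 3 <= 1 by rewrite exprn_ge0 ?exprn_ile1//; lra.
  lra.
- move=> ?; have -> : (x ^+ 3 - 3 * (x - 1) ^+ 3 + 3 * (x - 2) ^+ 3 - (x - 3) ^+ 3) / 6 = 1 by field.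
  lra.
Qed.

Lemma step_le0 x : x <= 0 -> step x = 0.
Proof.
move=> x0; rewrite /step.
by rewrite /pos !max_r; try lra.
Qed.

Lemma step_ge3 x : 3 <= x -> step x = 1.
Proof.
move=> x3; rewrite /step /pos !max_l; try lra.
Qed.

Lemma step1_bound x : `|step1 x| <= 2.
Proof.
rewrite /step1; apply: (@step_case (fun a b c e =>
  is_true (`|(a ^+ 2 - 3 * b ^+ 2 + 3 * c ^+ 2 - e ^+ 2) / 2| <= 2))).
- by move=> _; rewrite expr0n/= !mulr0 !subr0 addr0 mul0r normr0.
- move=> /andP[? ?]; rewrite expr0n/= !mulr0 subr0 addr0 subr0 ler_norml.
  have : 0 <= x ^+ 2 <= 1 by rewrite exprn_ge0// exprn_ile1.
  lra.
- by move=> /andP[? ?]; rewrite expr0n/= !mulr0 addr0 subr0 ler_norml; apply/andP; split; nra.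
- by move=> /andP[? ?]; rewrite expr0n/= subr0 ler_norml; apply/andP; split; nra.
- move=> ?; have -> : (x ^+ 2 - 3 * (x - 1) ^+ 2 + 3 * (x - 2) ^+ 2 - (x - 3) ^+ 2) / 2 = 0 by field.
  by rewrite normr0.
Qed.

Lemma step2_bound x : `|step2 x| <= 2.
Proof.
rewrite /step2; apply: (@step_case (fun a b c e =>
  is_true (`|(a - 3 * b + 3 * c - e) / 2| <= 2))).
- by move=> _; rewrite !mulr0 !subr0 addr0 mul0r normr0.
- by move=> /andP[? ?]; rewrite ler_norml; lra.
- by move=> /andP[? ?]; rewrite ler_norml; lra.
- by move=> /andP[? ?]; rewrite ler_norml; lra.
- by move=> ?; rewrite ler_norml; lra.
Qed.

Lemma pos3_taylor x h :
  `|pos (x + h) ^+ 3 - pos x ^+ 3 - 3 * pos x ^+ 2 * h - 3 * pos x * h ^+ 2| <= `|h| ^+ 3.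
Proof.
rewrite -normrX.
have [[x0 ->]|[x0 ->]] := posP x; have [[y0 ->]|[y0 ->]] := posP (x + h).
- by rewrite le_eqVlt; apply/orP; left; apply/eqP; congr `|_|; ring.
- rewrite expr0n/=; have -> : 0 - x ^+ 3 - 3 * x ^+ 2 * h - 3 * x * h ^+ 2 =
    (- (x + h)) ^+ 3 - (- h) ^+ 3 by ring.
  have h0 : 0 <= - h by lra.
  have a0 : 0 <= - (x + h) by lra.
  have : (- (x + h)) ^+ 3 <= (- h) ^+ 3 by rewrite lerXn2r// ?nnegrE//; lra.
  have := exprn_ge0 3 a0.
  rewrite -(normrN (h ^+ 3)) (_ : - h ^+ 3 = (- h) ^+ 3); last by ring.
  rewrite (ger0_norm (exprn_ge0 3 h0)) ler_norml; lra.
- rewrite !expr0n/= !(mulr0, mul0r) !subr0.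
  have h0 : 0 <= h by lra.
  rewrite (ger0_norm (exprn_ge0 3 y0)) (ger0_norm (exprn_ge0 3 h0)).
  by rewrite lerXn2r ?nnegrE//; lra.
- by rewrite !expr0n/= !(mulr0, mul0r) !subr0 normr0.
Qed.

Lemma step_taylor x h :
  `|step (x + h) - step x - step1 x * h - step2 x * h ^+ 2| <= 2 * `|h| ^+ 3.
Proof.
have A := pos3_taylor x h; have B := pos3_taylor (x - 1) h.
have C := pos3_taylor (x - 2) h; have E := pos3_taylor (x - 3) h.
rewrite /step /step1 /step2.
have -> : x + h - 1 = x - 1 + h by ring.
have -> : x + h - 2 = x - 2 + h by ring.
have -> : x + h - 3 = x - 3 + h by ring.
move: A B C E; rewrite !ler_norml.
set a := pos (x + h); set b := pos (x - 1 + h); set c := pos (x - 2 + h).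
set e := pos (x - 3 + h); set a' := pos x; set b' := pos (x - 1).
set c' := pos (x - 2); set e' := pos (x - 3); set H := `|h| ^+ 3.
move=> /andP[A1 A2] /andP[B1 B2] /andP[C1 C2] /andP[E1 E2].
have H0 : 0 <= H by rewrite exprn_ge0.
by apply/andP; split; lra.
Qed.

Lemma measurable_pos : measurable_fun setT pos.
Proof. exact: measurable_maxr. Qed.

Lemma measurable_pos_comb (n : nat) (c : R) : measurable_fun setT (fun x =>
  (pos x ^+ n - 3 * pos (x - 1) ^+ n + 3 * pos (x - 2) ^+ n - pos (x - 3) ^+ n) / c).
Proof.
have m a : measurable_fun setT (fun x => pos (x - a) ^+ n).
  apply: measurable_funX; apply: (measurableT_comp measurable_pos).
  exact: measurable_funB.
have m0 : measurable_fun setT (fun x => pos x ^+ n).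
  by apply: measurable_funX; exact: measurable_pos.
apply: measurable_funM => //; apply: measurable_funB => //.
apply: measurable_funD; last by apply: measurable_funM.
by apply: measurable_funB => //; apply: measurable_funM.
Qed.

Lemma measurable_step : measurable_fun setT step.
Proof. exact: measurable_pos_comb. Qed.

Lemma measurable_step1 : measurable_fun setT step1.
Proof. exact: measurable_pos_comb. Qed.

Lemma measurable_step2 : measurable_fun setT step2.
Proof. exact: (measurable_pos_comb 1). Qed.

Definition bump x := (1 - step (x - 1)) * (1 - step (- x - 1)).

Lemma bump_eq1 x : `|x| <= 1 -> bump x = 1.
Proof. by rewrite ler_norml /bump => /andP[? ?]; rewrite !step_le0 ?subr0 ?mulr1//; lra. Qed.

Lemma bump_eq0 x : 4 <= `|x| -> bump x = 0.
Proof.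
rewrite /bump; case: (ler0P x) => ? ?.
  by rewrite (@step_ge3 (- x - 1)) ?subrr ?mulr0//; lra.
by rewrite (@step_ge3 (x - 1)) ?subrr ?mul0r//; lra.
Qed.

Lemma bump_bounds x : 0 <= bump x <= 1.
Proof.
have /andP[? ?] := step_bounds (x - 1); have /andP[? ?] := step_bounds (- x - 1).
rewrite /bump; apply/andP; split; first by rewrite mulr_ge0//; lra.
by rewrite mulr_ile1//; lra.
Qed.

Lemma measurable_bump : measurable_fun setT bump.
Proof.
apply: measurable_funM; apply: measurable_funB => //;
  apply: (measurableT_comp measurable_step); apply: measurable_funB => //.
Qed.

End spline.

(** * Lindeberg replacement for products of bumps *)


Section lindeberg.
Context {disp : measure_display} {T : measurableType disp} {R : realType}.
Variable P : probability T R.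
Context {I : choiceType}.
Variables (Dom : set I) (X : I -> {RV P >-> R}).
Hypothesis indX : mutually_independent Dom X.
Implicit Types (D : set I) (Phi Psi : T -> R -> R).

Lemma ler_norm6 (a b c e f g : R) :
  `|a + b + c + e + f + g| <= `|a| + `|b| + `|c| + `|e| + `|f| + `|g|.
Proof. by do 5 (rewrite (le_trans (ler_normD _ _))// lerD2r). Qed.

(** The error of the second-order expansion is controlled both by [u ^ 2] and by
    [|u| ^ 3], hence by [cubic_min u], which is what a variable with only two moments
    can use. *)
Definition taylor2 D (K : R) Phi :=
  (forall w u, 0 <= Phi w u <= 1) /\
  exists F0 F1 F2 : T -> R,
    [/\ smeas X D F0, smeas X D F1, smeas X D F2,
     (forall w, [/\ `|F0 w| <= K, `|F1 w| <= K & `|F2 w| <= K]) &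
     (forall w u, `|Phi w u - F0 w - F1 w * u - F2 w * u ^+ 2| <= K * u ^+ 2 /\
                  `|Phi w u - F0 w - F1 w * u - F2 w * u ^+ 2| <= K * `|u| ^+ 3)].

Lemma taylor2_step D (k : R) (a : T -> R) (b : R) : 1 <= k -> smeas X D a -> `|b| <= k ->
  taylor2 D (8 * k ^+ 3) (fun w u => 1 - step (a w + b * u)).
Proof.
move=> k1 sa bk; split.
  by move=> w u; have /andP[? ?] := step_bounds (a w + b * u); apply/andP; split; lra.
have k0 : 0 <= k by lra.
have k2 : 1 <= k ^+ 2 by rewrite exprn_ege1.
have k3 : k ^+ 2 <= k ^+ 3 by apply: ler_weXn2l.
have kk : k <= k ^+ 2 by rewrite -[leLHS]expr1; apply: ler_weXn2l.
exists (fun w => 1 - step (a w)), (fun w => - b * step1 (a w)), (fun w => - b ^+ 2 * step2 (a w)).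
have b2 : b ^+ 2 <= k ^+ 2 by rewrite -sqr_norm lerXn2r// nnegrE.
split.
- apply: smeasB; first exact: smeas_cst.
  by apply: (smeas_comp measurable_step).
- apply: smeasM; first exact: smeas_cst.
  by apply: (smeas_comp measurable_step1).
- apply: smeasM; first exact: smeas_cst.
  by apply: (smeas_comp measurable_step2).
- move=> w; split.
  + have /andP[? ?] := step_bounds (a w); rewrite ler_norml; apply/andP; split; lra.
  + rewrite normrM normrN (le_trans (ler_pM _ _ bk (step1_bound _)))//; lra.
  + rewrite normrM normrN normrX (le_trans (ler_pM _ _ (_ : _ <= k ^+ 2) (step2_bound _)))//.
      by rewrite sqr_norm.
    lra.
- move=> w u; set r := `|_ - _ - _ - _|.
  have rE : r <= 2 * k ^+ 3 * `|u| ^+ 3.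
    have -> : r = `|step (a w + b * u) - step (a w) - step1 (a w) * (b * u) - step2 (a w) * (b * u) ^+ 2|.
      by rewrite /r -normrN; congr `|_|; ring.
    apply: (le_trans (step_taylor _ _)); rewrite -mulrA ler_pM2l//.
    by rewrite normrM exprMn ler_wpM2r ?exprn_ge0// lerXn2r// nnegrE.
  have u3 : 0 <= `|u| ^+ 3 by rewrite exprn_ge0.
  have r3 : r <= 8 * k ^+ 3 * `|u| ^+ 3.
    by rewrite (le_trans rE)// ler_wpM2r//; lra.
  split => //.
  case: (leP `|u| 1) => u1.
    rewrite (le_trans r3)// ler_wpM2l ?mulr_ge0 ?exprn_ge0//.
    by rewrite -[leRHS]sqr_norm exprS ler_piMl// ?sqr_ge0.
  have u2 : `|u| <= u ^+ 2 by rewrite -[leRHS]sqr_norm expr2 ler_peMl// ltW.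
  have u2' : 1 <= u ^+ 2 by lra.
  have /andP[s1 s2] := step_bounds (a w + b * u); have /andP[s3 s4] := step_bounds (a w).
  apply: (@le_trans _ _ (1 + 1 + 2 * k * `|u| + 2 * k ^+ 2 * u ^+ 2)).
    rewrite /r (le_trans (ler_normB _ _))// lerD//; last first.
      rewrite normrM (ger0_norm (sqr_ge0 u)) ler_wpM2r ?sqr_ge0// normrM normrN.
      by rewrite [leRHS]mulrC ler_pM ?step2_bound// (ger0_norm (sqr_ge0 b)).
    rewrite (le_trans (ler_normB _ _))// lerD//; last first.
      rewrite normrM ler_wpM2r// normrM normrN.
      by rewrite [leRHS]mulrC; apply: ler_pM => //; exact: step1_bound.
    by rewrite (le_trans (ler_normB _ _))// lerD// ger0_norm; lra.
  have h1 : 2 * k * `|u| <= 2 * k ^+ 3 * u ^+ 2.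
    by rewrite ler_pM ?mulr_ge0//; lra.
  have h2 : 2 * k ^+ 2 * u ^+ 2 <= 2 * k ^+ 3 * u ^+ 2 by rewrite ler_wpM2r ?sqr_ge0//; lra.
  have h3 : 1 <= k ^+ 3 * u ^+ 2.
    by rewrite -[leLHS]mulr1 ler_pM//; lra.
  lra.
Qed.

Lemma taylor2_cst D : taylor2 D 1 (fun _ _ => 1).
Proof.
split; first by move=> _ _; rewrite ler01 lexx.
exists (fun=> 1), (fun=> 0), (fun=> 0); split; try exact: smeas_cst.
  by move=> _; rewrite normr1 normr0; split.
by move=> w u; rewrite !mul0r !subr0 subrr normr0 !mul1r sqr_ge0 exprn_ge0.
Qed.

(** For [|u| <= 1] the product of the two expansions is used and the extra terms are of
    order at least three; for [|u| > 1] every term is bounded by [u ^ 2]. *)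
Lemma taylor2M D K L Phi Psi : 0 <= K -> 0 <= L -> taylor2 D K Phi -> taylor2 D L Psi ->
  taylor2 D (1 + K + 6 * (K * L)) (fun w u => Phi w u * Psi w u).
Proof.
move=> K0 L0 [Phi01 [F0 [F1 [F2 [sF0 sF1 sF2 Fb FT]]]]] [Psi01 [G0 [G1 [G2 [sG0 sG1 sG2 Gb GT]]]]].
have KL0 : 0 <= K * L by rewrite mulr_ge0.
split.
  move=> w u; have /andP[? ?] := Phi01 w u; have /andP[? ?] := Psi01 w u.
  by rewrite mulr_ge0// mulr_ile1.
exists (fun w => F0 w * G0 w), (fun w => F0 w * G1 w + F1 w * G0 w),
  (fun w => F0 w * G2 w + F1 w * G1 w + F2 w * G0 w); split.
- exact: smeasM.
- by apply: smeasD; exact: smeasM.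
- by apply: smeasD; [apply: smeasD|]; exact: smeasM.
- move=> w; have [f0 f1 f2] := Fb w; have [g0 g1 g2] := Gb w.
  have pr (x y : R) : `|x| <= K -> `|y| <= L -> `|x * y| <= K * L.
    by move=> ? ?; rewrite normrM ler_pM.
  have tr3 (x y z : R) : `|x + y + z| <= `|x| + `|y| + `|z|.
    by rewrite (le_trans (ler_normD _ _))// lerD2r ler_normD.
  split.
  + have := pr _ _ f0 g0; lra.
  + have := ler_normD (F0 w * G1 w) (F1 w * G0 w).
    have := pr _ _ f0 g1; have := pr _ _ f1 g0; lra.
  + have := tr3 (F0 w * G2 w) (F1 w * G1 w) (F2 w * G0 w).
    have := pr _ _ f0 g2; have := pr _ _ f1 g1; have := pr _ _ f2 g0; lra.
- move=> w u; have [f0 f1 f2] := Fb w; have [g0 g1 g2] := Gb w.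
  have [_ FT3] := FT w u; have [_ GT3] := GT w u.
  have /andP[p0 p1] := Phi01 w u; have /andP[q0 q1] := Psi01 w u.
  have pr (x y : R) : `|x| <= K -> `|y| <= L -> `|x * y| <= K * L.
    by move=> ? ?; rewrite normrM ler_pM.
  move: FT3 GT3.
  set p := Phi w u in p0 p1 *; set q := Psi w u in q0 q1 *.
  set r := p - _ - _ - _; set s := q - _ - _ - _ => FT3 GT3.
  set e := _ - _ - _ - _.
  have u0 := normr_ge0 u; have uu := sqr_norm u; have u20 := sqr_ge0 u.
  have u30 : 0 <= `|u| ^+ 3 by rewrite exprn_ge0.
  have KLx (x y z : R) : `|x| <= K -> `|y| <= L -> 0 <= z -> `|x * y * z| <= K * L * z.
    by move=> ? ? z0; rewrite normrM (ger0_norm z0) ler_wpM2r// pr.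
  case: (leP `|u| 1) => u1.
  + have u32 : `|u| ^+ 3 <= u ^+ 2.
      by rewrite -uu exprS ler_piMl// uu.
    have h : `|e| <= (1 + K + 6 * (K * L)) * `|u| ^+ 3.
      have -> : e = F0 w * s + F1 w * u * s + F2 w * u ^+ 2 * s + r * q
          + (F1 w * G2 w + F2 w * G1 w) * u ^+ 3 + F2 w * G2 w * u ^+ 4.
        by rewrite /e /r /s; ring.
      have nu n : `|u ^+ n| <= 1 by rewrite normrX exprn_ile1.
      have nK (x y : R) : `|x| <= K -> `|y| <= 1 -> `|x * y| <= K.
        by move=> ? ?; rewrite normrM -[leRHS]mulr1 ler_pM.
      have t1 : `|F0 w * s| <= K * (L * `|u| ^+ 3) by rewrite normrM ler_pM.
      have t2 : `|F1 w * u * s| <= K * (L * `|u| ^+ 3).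
        by rewrite normrM ler_pM// nK// -[u]expr1.
      have t3 : `|F2 w * u ^+ 2 * s| <= K * (L * `|u| ^+ 3) by rewrite normrM ler_pM// nK.
      have t4 : `|r * q| <= K * `|u| ^+ 3.
        by rewrite normrM -[leRHS]mulr1 ler_pM// ger0_norm.
      have t5 : `|(F1 w * G2 w + F2 w * G1 w) * u ^+ 3| <= (K * L + K * L) * `|u| ^+ 3.
        rewrite normrM normrX ler_wpM2r// (le_trans (ler_normD _ _))// lerD// pr//.
      have t6 : `|F2 w * G2 w * u ^+ 4| <= K * L * `|u| ^+ 3.
        by rewrite normrM ler_pM// ?pr// normrX exprS ler_piMl.
      rewrite (le_trans (ler_norm6 _ _ _ _ _ _))//.
      set z := `|u| ^+ 3 in u30 t1 t2 t3 t4 t5 t6 *.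
      have : 0 <= K * L * z by rewrite mulr_ge0.
      lra.
    split => //; rewrite (le_trans h)// ler_wpM2l//; lra.
  + have u2 : `|u| <= u ^+ 2 by rewrite -uu expr2 ler_peMl// ltW.
    have u21 : 1 <= u ^+ 2 by lra.
    have u23 : u ^+ 2 <= `|u| ^+ 3 by rewrite [leRHS]exprS uu ler_peMl// ltW.
    have h : `|e| <= (1 + K + 6 * (K * L)) * u ^+ 2.
      have -> : e = p * q - F0 w * G0 w - F0 w * G1 w * u - F1 w * G0 w * u
         - F0 w * G2 w * u ^+ 2 - F1 w * G1 w * u ^+ 2 - F2 w * G0 w * u ^+ 2.
        by rewrite /e; ring.
      have t0 : `|p * q| <= u ^+ 2 by rewrite ger0_norm ?mulr_ge0// (le_trans _ u21)// mulr_ile1.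
      have KLu (x y z : R) : `|x| <= K -> `|y| <= L -> `|z| <= u ^+ 2 -> `|x * y * z| <= K * L * u ^+ 2.
        by move=> ? ? ?; rewrite normrM ler_pM// pr.
      have uu2 : `|u ^+ 2| <= u ^+ 2 by rewrite ger0_norm.
      have t1 : `|F0 w * G0 w| <= K * L * u ^+ 2.
        by rewrite -[X in `|X|]mulr1 KLu// normr1.
      have t2 := KLu _ _ _ f0 g1 u2; have t3 := KLu _ _ _ f1 g0 u2.
      have t4 := KLu _ _ _ f0 g2 uu2; have t5 := KLu _ _ _ f1 g1 uu2.
      have t6 := KLu _ _ _ f2 g0 uu2.
      rewrite (le_trans (ler_normB _ _))//.
      have := ler_norm6 (p * q) (- (F0 w * G0 w)) (- (F0 w * G1 w * u)) (- (F1 w * G0 w * u))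
         (- (F0 w * G2 w * u ^+ 2)) (- (F1 w * G1 w * u ^+ 2)).
      rewrite !normrN => t7; have : 0 <= K * u ^+ 2 by rewrite mulr_ge0.
      lra.
    by split => //; rewrite (le_trans h)// ler_wpM2l//; lra.
Qed.


Fixpoint taylor_const (k : R) (n : nat) : R :=
  if n is n'.+1 then 1 + k + 6 * (k * taylor_const k n') else 1.

Lemma taylor_const_ge0 k n : 0 <= k -> 0 <= taylor_const k n.
Proof. by move=> k0; elim: n => //= n IH; have := mulr_ge0 k0 IH; lra. Qed.

Lemma taylor2_prod D k (J : Type) (s : seq J) (Phi : J -> T -> R -> R) : 0 <= k ->
  (forall j, taylor2 D k (Phi j)) ->
  taylor2 D (taylor_const k (size s)) (fun w u => \prod_(j <- s) Phi j w u).
Proof.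
move=> k0 HPhi; elim: s => [|j s IH] /=.
  rewrite (_ : (fun w u => _) = fun _ _ => 1); first exact: taylor2_cst.
  by apply/funext => w; apply/funext => u; rewrite big_nil.
rewrite (_ : (fun w u => _) = fun w u => Phi j w u * \prod_(j <- s) Phi j w u); last first.
  by apply/funext => w; apply/funext => u; rewrite big_cons.
by apply: taylor2M => //; exact: taylor_const_ge0.
Qed.

Definition cubic_min (u : R) := Num.min (u ^+ 2) (`|u| ^+ 3).

Lemma cubic_min_bounds u : 0 <= cubic_min u <= u ^+ 2.
Proof. by rewrite /cubic_min ge_min lexx le_min sqr_ge0 exprn_ge0. Qed.

Lemma measurable_cubic_min : measurable_fun setT cubic_min.
Proof.
apply: measurable_minr; first exact: measurable_funX.
by apply: measurable_funX; exact: normr_measurable.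
Qed.

Section swap.
Variables (D D' : set I) (K : R) (Phi : T -> R -> R).
Hypotheses (DD : D `<=` Dom) (D'D : D' `<=` Dom) (dis : D `&` D' = set0).
Hypotheses (K0 : 0 <= K) (tPhi : taylor2 D K Phi).

Lemma taylor2_ex : exists a c : R, forall (z : T -> R),
  smeas X D' z -> integ P z -> ex P z = 0 -> integ P (fun w => z w ^+ 2) ->
  measurable_fun setT (fun w => Phi w (z w)) ->
  `|ex P (fun w => Phi w (z w)) - (a + c * ex P (fun w => z w ^+ 2))|
    <= K * ex P (fun w => cubic_min (z w)).
Proof.
have [P01 [F0 [F1 [F2 [s0 s1 s2 Fb FT]]]]] := tPhi.
exists (ex P F0), (ex P F2) => z sz Iz ez Iz2 mPhi.
have m0 := smeas_measurable s0; have m1 := smeas_measurable s1.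
have m2 := smeas_measurable s2; have mz := smeas_measurable sz.
have I0 : integ P F0 by apply: (@integ_bounded _ _ _ _ _ K) => // w; case: (Fb w).
have I1 : integ P F1 by apply: (@integ_bounded _ _ _ _ _ K) => // w; case: (Fb w).
have I2 : integ P F2 by apply: (@integ_bounded _ _ _ _ _ K) => // w; case: (Fb w).
have [J1 E1] := integM_ex indX DD D'D dis s1 sz I1 Iz.
have sz2 : smeas X D' (fun w => z w ^+ 2).
  by apply: (@smeas_comp _ _ _ _ _ _ _ z (fun y => y ^+ 2)) => //; exact: measurable_funX.
have [J2 E2] := integM_ex indX DD D'D dis s2 sz2 I2 Iz2.
have IP : integ P (fun w => Phi w (z w)).
  apply: (@integ_bounded _ _ _ _ _ 1) => // w.
  by have /andP[? ?] := P01 w (z w); rewrite ger0_norm.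
have -> : ex P (fun w => Phi w (z w)) - (ex P F0 + ex P F2 * ex P (fun w => z w ^+ 2)) =
   ex P (fun w => Phi w (z w) - F0 w - F1 w * z w - F2 w * z w ^+ 2).
  rewrite exB//; last by apply: integB => //; exact: integB.
  rewrite exB//; last exact: integB.
  by rewrite exB// E1 E2 ez; ring.
have Ic : integ P (fun w => cubic_min (z w)).
  apply: (integ_le _ Iz2); first exact: (measurableT_comp measurable_cubic_min).
  by move=> w; have /andP[? ?] := cubic_min_bounds (z w); rewrite ger0_norm.
rewrite -exZ//; apply: normr_ex_le.
- apply: measurable_funB; last by apply: measurable_funM => //; exact: measurable_funX.
  by apply: measurable_funB; [exact: measurable_funB|exact: measurable_funM].
- exact: integZ.
- move=> w; have [h1 h2] := FT w (z w); rewrite /cubic_min.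
  by case: (leP (z w ^+ 2) (`|z w| ^+ 3)).
Qed.

(** Both expectations expand to the same second-order polynomial in the first two moments,
    because the coefficients are independent of the variable that is swapped. *)
Lemma taylor2_swap (z z' : T -> R) :
  smeas X D' z -> integ P z -> ex P z = 0 -> integ P (fun w => z w ^+ 2) ->
  measurable_fun setT (fun w => Phi w (z w)) ->
  smeas X D' z' -> integ P z' -> ex P z' = 0 -> integ P (fun w => z' w ^+ 2) ->
  measurable_fun setT (fun w => Phi w (z' w)) ->
  ex P (fun w => z w ^+ 2) = ex P (fun w => z' w ^+ 2) ->
  `|ex P (fun w => Phi w (z w)) - ex P (fun w => Phi w (z' w))| <=
    K * (ex P (fun w => cubic_min (z w)) + ex P (fun w => cubic_min (z' w))).
Proof.
have [a [c H]] := taylor2_ex.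
move=> sz Iz ez Iz2 mz sz' Iz' ez' Iz2' mz' e2.
have := H _ sz Iz ez Iz2 mz; have := H _ sz' Iz' ez' Iz2' mz'; rewrite e2.
rewrite !ler_norml => /andP[? ?] /andP[? ?]; apply/andP; split; lra.
Qed.

End swap.

Section chain.
Context {J : eqType} {G : Type}.
Variables (gs : seq G) (k : R).
Hypothesis k1 : 1 <= k.
Variables (c : J -> G -> R) (z z' : J -> T -> R) (sup : J -> set I).
Hypothesis ck : forall j g, `|c j g| <= k.
Hypothesis supD : forall j, sup j `<=` Dom.

(** A smooth version of the indicator of the event that all [V g] are bounded. *)
Definition bumps (V : G -> T -> R) w := \prod_(g <- gs) bump (V g w).

Let C := taylor_const (1 + 8 * k ^+ 3 + 6 * (8 * k ^+ 3 * (8 * k ^+ 3))) (size gs).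

Lemma measurable_bumps V : (forall g, measurable_fun setT (V g)) ->
  measurable_fun setT (bumps V).
Proof.
move=> mV; rewrite /bumps; elim: gs => [|g s IH].
  rewrite (_ : (fun w => _) = fun=> 1); first exact: measurable_cst.
  by apply/funext => w; rewrite big_nil.
rewrite (_ : (fun w => _) = fun w => bump (V g w) * \prod_(g <- s) bump (V g w)); last first.
  by apply/funext => w; rewrite big_cons.
apply: measurable_funM => //; exact: (measurableT_comp measurable_bump).
Qed.

Lemma bumps_taylor2 D (V : G -> T -> R) j : (forall g, smeas X D (V g)) ->
  taylor2 D C (fun w u => bumps (fun g w' => V g w' + c j g * u) w).
Proof.
move=> sV; have k0 : 0 <= 8 * k ^+ 3 by rewrite mulr_ge0// exprn_ge0// (le_trans ler01 k1).
rewrite /bumps; apply: (@taylor2_prod _ _ _ gs (fun g w u => bump (V g w + c j g * u))).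
  have := mulr_ge0 k0 k0; move: k0; set e := 8 * _; lra.
move=> g; rewrite /bump.
rewrite (_ : (fun w u => _) = fun w u => (1 - step ((V g w - 1) + c j g * u)) *
    (1 - step ((- 1 * V g w - 1) + (- c j g) * u))); last first.
  apply/funext => w; apply/funext => u; congr (_ * _); congr (1 - step _); ring.
apply: taylor2M => //; apply: taylor2_step => //.
- by apply: smeasB => //; exact: smeas_cst.
- by apply: smeasB; [apply: smeasM => //|]; exact: smeas_cst.
- by rewrite normrN.
Qed.

(** The variables [z j] are replaced by [z' j] one at a time. [D] holds the indices on which the part
    already treated depends, and [sup j] those that [z j] and [z' j] use. *)
Lemma lindeberg_chain (s : seq J) (D : set I) (V : G -> T -> R) : uniq s ->
  D `<=` Dom -> (forall g, smeas X D (V g)) ->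
  (forall j, j \in s -> D `&` sup j = set0) ->
  (forall i j, i \in s -> j \in s -> i != j -> sup i `&` sup j = set0) ->
  (forall j, j \in s -> [/\ smeas X (sup j) (z j), integ P (z j), ex P (z j) = 0 & integ P (fun w => z j w ^+ 2)]) ->
  (forall j, j \in s -> [/\ smeas X (sup j) (z' j), integ P (z' j), ex P (z' j) = 0 & integ P (fun w => z' j w ^+ 2)]) ->
  (forall j, j \in s -> ex P (fun w => z j w ^+ 2) = ex P (fun w => z' j w ^+ 2)) ->
  `|ex P (bumps (fun g w => V g w + \sum_(j <- s) c j g * z j w)) -
    ex P (bumps (fun g w => V g w + \sum_(j <- s) c j g * z' j w))| <=
  C * \sum_(j <- s) (ex P (fun w => cubic_min (z j w)) + ex P (fun w => cubic_min (z' j w))).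
Proof.
have C0 : 0 <= C.
  have k0 : 0 <= 8 * k ^+ 3 by rewrite mulr_ge0// exprn_ge0// (le_trans ler01 k1).
  apply: taylor_const_ge0; have := mulr_ge0 k0 k0; move: k0; set e := 8 * _; lra.
elim: s D V => [|a s IH] D V /= us DD sV Ds sd Hz Hz' Hv.
  rewrite !big_nil mulr0 (_ : bumps _ = bumps (fun g w => V g w + \sum_(j <- [::]) c j g * z' j w)).
    by rewrite subrr normr0.
  by congr bumps; apply/funext => g; apply/funext => w; rewrite !big_nil.
have /andP[sa us'] := us.
have ins j : j \in s -> j \in a :: s by rewrite inE => ->; rewrite orbT.
have ina : a \in a :: s by rewrite inE eqxx.
have aj j : j \in s -> a != j by move=> sj; apply: contraNneq sa => ->.
have [sza Iza eza Iza2] := Hz a ina.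
have [sza' Iza' eza' Iza2'] := Hz' a ina.
pose D1 := D `|` [set i | exists2 j, j \in s & sup j i].
pose V1 g w := V g w + \sum_(j <- s) c j g * z j w.
pose V2 g w := V g w + c a g * z' a w.
have sV1 g : smeas X D1 (V1 g).
  apply: smeasD; first by apply: smeas_sub (sV g) => i; left.
  rewrite (_ : (fun w => _) = fun w => \sum_(j <- s | j \in s) c j g * z j w); last first.
    by apply/funext => w; rewrite [LHS]big_seq.
  apply: smeas_sum => j sj; apply: smeasM; first exact: smeas_cst.
  have [szj _ _ _] := Hz j (ins _ sj).
  by apply: smeas_sub szj => i ji; right; exists j.
have D1D : D1 `<=` Dom by move=> i [/DD//|[j _ /supD]].
have D1a : D1 `&` sup a = set0.
  apply/seteqP; split => // i [[Di|[j sj ji]] ai].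
    by have := Ds a ina; move/seteqP => [/(_ i) H _]; exact: H.
  have /seteqP[/(_ i) H _] := sd a j ina (ins _ sj) (aj _ sj); exact: H.
have tV1 := @bumps_taylor2 D1 V1 a sV1.
have mV1 (y : T -> R) : measurable_fun setT y ->
    measurable_fun setT (fun w => bumps (fun g w' => V1 g w' + c a g * y w) w).
  move=> my; rewrite (_ : (fun w => _) = bumps (fun g w => V1 g w + c a g * y w))//.
  apply: measurable_bumps => g; apply: measurable_funD; first exact: smeas_measurable (sV1 g).
  exact: measurable_funM.
have S1 := taylor2_swap D1D (@supD a) D1a tV1 sza Iza eza Iza2 (mV1 _ (smeas_measurable sza))
  sza' Iza' eza' Iza2' (mV1 _ (smeas_measurable sza')) (Hv a ina).
have sV2 g : smeas X (D `|` sup a) (V2 g).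
  apply: smeasD; first by apply: smeas_sub (sV g) => i; left.
  apply: smeasM; first exact: smeas_cst.
  by apply: smeas_sub sza' => i; right.
have D2D : D `|` sup a `<=` Dom by move=> i [/DD//|/supD].
have dis2 j : j \in s -> (D `|` sup a) `&` sup j = set0.
  move=> sj; rewrite setIUl (Ds j (ins _ sj)) set0U.
  by apply: sd => //; [exact: ins|exact: aj].
have S2 := IH _ V2 us' D2D sV2 dis2 (fun i j si sj => sd i j (ins _ si) (ins _ sj))
  (fun j sj => Hz j (ins _ sj)) (fun j sj => Hz' j (ins _ sj)) (fun j sj => Hv j (ins _ sj)).
have e1 : bumps (fun g w => V g w + \sum_(j <- a :: s) c j g * z j w) =
    fun w => bumps (fun g w' => V1 g w' + c a g * z a w) w.
  apply/funext => w; rewrite /bumps; apply: eq_bigr => g _; congr bump.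
  by rewrite big_cons /V1; ring.
have e2 : (fun w => bumps (fun g w' => V1 g w' + c a g * z' a w) w) =
    bumps (fun g w => V2 g w + \sum_(j <- s) c j g * z j w).
  apply/funext => w; rewrite /bumps; apply: eq_bigr => g _; congr bump.
  by rewrite /V1 /V2; ring.
have e3 : bumps (fun g w => V g w + \sum_(j <- a :: s) c j g * z' j w) =
    bumps (fun g w => V2 g w + \sum_(j <- s) c j g * z' j w).
  congr bumps; apply/funext => g; apply/funext => w; rewrite big_cons /V2; ring.
rewrite e2 in S1; rewrite e1 e3 big_cons mulrDr.
apply: le_trans (lerD S1 S2).
set x := ex P _; set y := ex P _; set t := ex P _.
have -> : x - y = (x - t) + (t - y) by ring.
exact: ler_normD.
Qed.

End chain.

End lindeberg.

(** * Two independent copies that are close to each other *)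


Section twins.
Context {disp : measure_display} {T : measurableType disp} {R : realType}.
Variable P : probability T R.
Context {d : nat}.
Hypothesis d0 : (0 < d)%N.
Notation idx := {ffun 'I_d -> nat}.
Variables (X : idx -> {RV P >-> R}) (xi : {RV P >-> R}) (mu : R).
Hypothesis indX : mutually_independent positive_index X.
Hypothesis lawX : forall i, positive_index i -> same_law (X i) xi.
Hypotheses (Ixi : integ P xi) (exi : ex P xi = mu).
Hypothesis Ixi2 : integ P (fun w => (xi w - mu) ^+ 2).
Implicit Types (l n : idx).
Local Notation rt := (@rt R d).

(** The cubes of side [K] at these corners are disjoint, and carry the independent copies. *)
Definition corner (K a : nat) : idx :=
  [ffun i => if i == Ordinal d0 then (a * K)%N else 0%N].

Definition cube (K : nat) : idx := [ffun=> K].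

Definition copy_box K a : seq idx := ibox (corner K a) (shift (corner K a) (cube K)).

Lemma copy_box_disjoint K a b : a != b ->
  [set` copy_box K a] `&` [set` copy_box K b] = set0.
Proof.
move=> ab; apply/seteqP; split => // m /=; rewrite !mem_ibox.
move=> [/forallP/(_ (Ordinal d0)) ha /forallP/(_ (Ordinal d0)) hb].
move: ha hb; rewrite !ffunE eqxx.
case: (ltngtP a b) ab => // h _; [have : (a.+1 * K <= b * K)%N|have : (b.+1 * K <= a * K)%N];
  by [rewrite leq_mul2r h orbT|lia].
Qed.

Definition grid_point (G h : nat) (g : {ffun 'I_d -> 'I_G.+1}) : idx :=
  [ffun i => (g i * h)%N].

Lemma floor_grid (G h : nat) n : (0 < h)%N -> (forall i, (n i <= G * h)%N) ->
  exists g : {ffun 'I_d -> 'I_G.+1}, floor_to h n = grid_point h g.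
Proof.
move=> h0 nG.
have gG i : (n i %/ h < G.+1)%N by rewrite ltnS -(mulnK G h0) leq_div2r.
exists [ffun i => Ordinal (gG i)]; apply/ffunP => i.
by rewrite !ffunE.
Qed.

Lemma grid_point_le (G h : nat) (g : {ffun 'I_d -> 'I_G.+1}) i :
  (grid_point h g i <= G * h)%N.
Proof. by rewrite ffunE leq_mul2r -ltnS ltn_ord orbT. Qed.

Lemma theta_small (e : R) : 0 < e -> exists B, theta (R := R) (d := d) ^+ B <= e.
Proof.
move=> e0; have /andP[t0 t1] := @theta_bounds R d d0.
have : (fun k : nat => theta (R := R) (d := d) ^+ k) @ \oo --> (0 : R).
  by apply: cvg_expr; rewrite ger0_norm// ltW.
move/cvgrPdist_le => /(_ _ e0)[B _ H]; exists B.
by have := H B (leqnn _); rewrite /= sub0r normrN; apply: le_trans; exact: ler_norm.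
Qed.

(** On a likely event the field is, up to [eps], given by the codes of its values on a finite grid, and
    the number [nc] of codes depends neither on [J] nor on [B1]. Every copy thus has a
    code of probability at least [1 / (4 * nc)], and among [nc + 1] copies two have this code in
    common; they are independent, so both take it with the squared probability. *)
Lemma twin_boxes (eps : R) : 0 < eps -> exists2 c : R, 0 < c & exists B, forall B1, (B <= B1)%N ->
  exists J0, forall J, (J0 <= J)%N -> exists a b E,
    [/\ a != b, measurable E, c <= prob P E &
      forall w, E w -> forall n, (forall i, (n i <= 2 ^ (J + B1))%N) ->
        `|field X mu (corner (2 ^ (J + B1)) a.+1) n w -
          field X mu (corner (2 ^ (J + B1)) b.+1) n w| <= 3 * eps * rt J * weight J n].
Proof.
move=> e0.
have [KT KT0 HT] := tailbad_bound d0 indX lawX Ixi exi Ixi2.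
have e20 : 0 < eps ^+ 2 by rewrite exprn_gt0.
have [B HB] : exists B, theta (R := R) (d := d) ^+ B <= 8^-1 * eps ^+ 2 / KT.
  by apply: theta_small; rewrite divr_gt0// mulr_gt0// invr_gt0.
have [r Hr] : exists r, forall l J, (r <= J)%N -> prob P (slabbad X mu eps l J B r) <= 8^-1.
  by apply: (slabbad_bound d0 indX lawX Ixi exi Ixi2) => //; rewrite invr_gt0.
have [C C0 HC] := maxdev_chebyshev indX lawX Ixi exi Ixi2.
pose M : R := Num.sqrt (8 * C * (2 ^+ B) ^+ d).
have M0 : 0 < M by rewrite sqrtr_gt0 mulr_gt0 ?mulr_gt0// !exprn_gt0.
have M2 : M ^+ 2 = 8 * C * (2 ^+ B) ^+ d.
  by rewrite sqr_sqrtr// ltW// mulr_gt0 ?mulr_gt0// !exprn_gt0.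
pose G := (2 ^ (B + r))%N.
pose Q := (Num.truncn (2 * M / eps)).+1.
pose codes := {ffun {ffun 'I_d -> 'I_G.+1} -> 'I_Q}.
pose nc : R := #|{: codes}|%:R.
have nc0 : 0 < nc.
  by rewrite ltr0n; apply/card_gt0P; exists [ffun=> ord0].
exists ((4 * nc)^-1 ^+ 2); first by rewrite exprn_gt0// invr_gt0 mulr_gt0.
exists B => B1 BB1; exists r => J rJ.
pose K := (2 ^ (J + B1))%N; pose h := (2 ^ (J - r))%N.
have h0 : (0 < h)%N by rewrite expn_gt0.
have Gh : (G * h = 2 ^ (J + B))%N by rewrite /G /h -expnD; congr (2 ^ _)%N; lia.
have GK : (2 ^ (J + B) <= K)%N by rewrite leq_exp2l// leq_add2l.
have rt0 := @rt_gt0 R d J.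
pose D a := [set` copy_box K a].
pose la a := corner K a.
pose mb a := maxdev X mu d (ibox (la a) (shift (la a) (cube (2 ^ (J + B))))) (M * rt J).
pose good a := ~` tailbad X mu eps (la a) J B (J + B1) `&`
  (~` slabbad X mu eps (la a) J B r `&` ~` mb a).
have sub a : [set` ibox (la a) (shift (la a) (cube (2 ^ (J + B))))] `<=` D a.
  by apply: subset_ibox => i; rewrite !ffunE.
have smb a : sig X (D a) (mb a) by exact: sig_maxdev.
have sgood a : sig X (D a) (good a).
  apply: sigI; first by apply: sigC; exact: sig_tailbad.
  apply: sigI; last exact: sigC.
  by apply: sigC; apply: (sig_sub (sub a)); exact: sig_slabbad.
pose cell a (k : codes) := good a `&` \bigcap_(g : {ffun 'I_d -> 'I_G.+1})
  ([set w | (k g)%:R * eps <= field X mu (la a) (grid_point h g) w / rt J + M] `&`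
   [set w | field X mu (la a) (grid_point h g) w / rt J + M <= (k g).+1%:R * eps]).
have sfield a g : smeas X (D a) (fun w => field X mu (la a) (@grid_point G h g) w / rt J + M).
  apply: smeasD; last exact: smeas_cst.
  apply: smeasM; last exact: smeas_cst.
  apply: smeas_field; apply: subset_ibox => i.
  by rewrite (leq_trans (grid_point_le _ _ _))// Gh ffunE.
have scell a k : sig X (D a) (cell a k).
  apply: sigI => //; apply: sig_bigcap => g; apply: sigI; [exact: sig_le|exact: sig_ge].
have mcell a k : measurable (cell a k) := sig_measurable (scell a k).
have pmb a : prob P (mb a) <= 8^-1.
  apply: (le_trans (HC _ _ (ibox_uniq _ _) (@ibox_positive _ _ _) _)); first by rewrite mulr_gt0.
  rewrite exprMn M2 rt_sqr.
  have S0 : 0 < scale J ^+ d :> R by rewrite exprn_gt0// scale_gt0.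
  have us : (size (ibox (la a) (shift (la a) (cube (2 ^ (J + B))))))%:R <= (2 ^+ B) ^+ d * scale J ^+ d :> R.
    rewrite -exprMn -exprD -!natrX ler_nat (leq_trans (size_ibox _ _))//.
    rewrite -[X in (_ <= _ ^ X)%N](card_ord d) -prod_nat_const leq_prod// => i _.
    by rewrite !ffunE addKn addnC.
  rewrite mulrA ler_pdivrMr; last by rewrite !mulr_gt0// !exprn_gt0.
  have -> : 8^-1 * (8 * C * (2 ^+ B) ^+ d * scale J ^+ d) = C * ((2 ^+ B) ^+ d * scale J ^+ d) by field.
  by rewrite ler_pM2l.
have ptail a : prob P (tailbad X mu eps (la a) J B (J + B1)) <= 8^-1.
  apply: (le_trans (HT _ _ _ _ _ e0)); rewrite ler_pdivrMr//.
  by rewrite mulrC -ler_pdivlMr.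
have mmb a := sig_measurable (smb a).
have pgood a : 2^-1 <= prob P (good a).
  have mt := measurable_tailbad X mu eps (la a) J B (J + B1).
  have ms := measurable_slabbad X mu eps (la a) B rJ.
  have h1 := probI_ge P (measurableC ms) (measurableC (mmb a)).
  have h2 := probI_ge P (measurableC mt) (measurableI _ _ (measurableC ms) (measurableC (mmb a))).
  move: h1 h2; rewrite (probC _ ms) (probC _ (mmb a)) (probC _ mt).
  have := pmb a; have := ptail a; have := Hr (la a) J rJ; rewrite /good; lra.
(* a likely code for every copy *)
have [k Hk] : exists k : nat -> codes, forall a, (4 * nc)^-1 <= prob P (cell a (k a)).
  suff /choice[k Hk] : forall a, exists k, (4 * nc)^-1 <= prob P (cell a k) by exists k.
  move=> a.
  apply: contrapT => /forallNP Hn.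
  suff : prob P (good a) <= \sum_(k : codes) (4 * nc)^-1.
    rewrite sumr_const -[leRHS]mulr_natl -/nc; have := pgood a.
    have -> : nc * (4 * nc)^-1 = 4^-1 by field; rewrite gt_eqF.
    lra.
  apply: (@prob_sum_le _ _ _ P _ predT (cell a)) => //.
  - exact: sig_measurable (sgood a).
  - move=> w gw; have [wt [ws wm]] := gw.
    have fb g : `|field X mu (la a) (@grid_point G h g) w| < M * rt J.
      rewrite ltNge; apply/negP => hge; apply: wm.
      apply: field_maxdev hge => i; by rewrite (leq_trans (grid_point_le _ _ _))// Gh ffunE.
    pose x g := (field X mu (la a) (@grid_point G h g) w / rt J + M) / eps.
    have x0 g : 0 <= x g <= 2 * M / eps.
      have := fb g; rewrite -ltr_pdivrMr// -[X in _ / X](gtr0_norm rt0) -normf_div.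
      rewrite ltr_norml => /andP[? ?]; rewrite /x.
      rewrite ler_pM2r ?invr_gt0// divr_ge0 ?ltW//; lra.
    have xQ g : (Num.truncn (x g) < Q)%N.
      by rewrite ltnS; apply: le_truncn; case/andP: (x0 g).
    exists [ffun g => Ordinal (xQ g)] => //; split => // g _ /=.
    rewrite ffunE /=; have /andP[xg0 _] := x0 g.
    have /andP[h1 h2] := truncn_itv xg0.
    by split; [rewrite -ler_pdivlMr|rewrite -ler_pdivrMr//; exact: ltW].
  - by move=> k _; apply: ltW; rewrite ltNge; apply/negP; exact: Hn.
(* pigeonhole over one more copy than there are codes *)
have [a [b [ab kab]]] : exists a b, a != b /\ k a.+1 = k b.+1.
  pose f (i : 'I_#|{: codes}|.+1) := k i.+1.
  have : ~~ injectiveb f.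
    apply/negP => /injectiveP fi; have := leq_card f fi.
    by rewrite card_ord ltnn.
  move/injectivePn => [a [b ab fab]]; exists (val a), (val b); split => //.
exists a, b, (cell a.+1 (k a.+1) `&` cell b.+1 (k a.+1)); split => //.
- exact: measurableI.
- rewrite (sig_prob_indep indX _ _ _ (scell _ _) (scell _ _)).
  + rewrite expr2 ler_pM ?invr_ge0 ?mulr_ge0 ?(ltW nc0)//.
    by rewrite kab.
  + exact: ibox_positive.
  + exact: ibox_positive.
  + exact: copy_box_disjoint.
move=> w [[[wt [ws wm]] wc] [[wt' [ws' wm']] wc']] n nK.
have w1 : 1 <= weight J n := @weight_ge1 R d J n.
have er0 : 0 < eps * rt J by rewrite mulr_gt0.
rewrite -/(la a.+1) -/(la b.+1).
have [[i ni]|] := pselect (exists i, (2 ^ (J + B) < n i)%N).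
  have bnd l : ~ tailbad X mu eps l J B (J + B1) w -> `|field X mu l n w| <= eps * rt J * weight J n.
    move=> nt; rewrite leNgt; apply/negP => hlt; apply: nt; exists n => //.
    by split => //; exists i.
  have := ler_normB (field X mu (la a.+1) n w) (field X mu (la b.+1) n w).
  have := bnd _ wt; have := bnd _ wt'.
  have : 0 <= eps * rt J * weight J n by rewrite mulr_ge0 ?ltW//; lra.
  rewrite -!mulrA; set t := eps * _; lra.
move=> /forallNP nn.
have nB i : (n i <= 2 ^ (J + B))%N by rewrite leqNgt; apply/negP; exact: nn.
have nGh i : (n i <= G * h)%N by rewrite Gh.
have [g fg] := floor_grid h0 nGh.
have osc l : ~ slabbad X mu eps l J B r w ->
    `|field X mu l n w - field X mu l (grid_point h g) w| <= eps * rt J.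
  move=> nsl; have dR : 0 < d%:R :> R by rewrite ltr0n.
  rewrite -fg; have -> : eps * rt J = d%:R * (eps * rt J / d%:R) by field; rewrite gt_eqF.
  apply: (@slab_osc _ _ _ P d X mu l h G) => //; first by rewrite divr_ge0// ltW.
  move=> i' k' k'G; rewrite Gh => hm; apply: nsl.
  by exists (i', Ordinal k'G).
have o1 := osc _ ws; have o2 := osc _ ws'.
have [c1 c2] := wc g I; have [c3 c4] := wc' g I.
move: c1 c2 c3 c4 => /=.
set x := field _ _ _ (grid_point _ _) _ in o1 *.
set y := field _ _ (la b.+1) (grid_point _ _) _ in o2 *.
rewrite -[(nat_of_ord _).+1%:R]natr1 mulrDl mul1r; set q := _%:R * eps => c1 c2 c3 c4.
have xy : `|x - y| <= eps * rt J.
  have : x / rt J - y / rt J <= eps by lra.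
  have : - eps <= x / rt J - y / rt J by lra.
  rewrite -mulrBl ler_pdivlMr// ler_pdivrMr// mulNr => ? ?.
  by rewrite ler_norml; apply/andP; split.
set f1 := field _ _ _ _ _ in o1 *; set f2 := field _ _ _ _ _ in o2 *.
have : `|f1 - f2| <= 3 * (eps * rt J).
  move: o1 o2 xy; rewrite !ler_norml => /andP[? ?] /andP[? ?] /andP[? ?].
  by apply/andP; split; lra.
move=> /le_trans; apply; rewrite -[X in _ <= X * _]mulrA ler_peMr//.
by rewrite mulr_ge0// ltW.
Qed.

End twins.

(** * Small balls of the field *)


Section prelim.
Context {R : realType}.

Lemma cubic_minE (u : R) : cubic_min u = if `|u| <= 1 then `|u| ^+ 3 else `|u| ^+ 2.
Proof.
rewrite /cubic_min -sqr_norm; have u0 := normr_ge0 u; case: (leP `|u| 1) => u1.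
  by rewrite min_r// exprS ler_piMl// exprn_ge0.
by rewrite min_l// exprS ler_peMl ?exprn_ge0// ltW.
Qed.

Lemma cubic_min_dbl (u s : R) : `|u| <= 2 * `|s| -> cubic_min u <= 8 * cubic_min s.
Proof.
move=> us; rewrite !cubic_minE.
have u0 := normr_ge0 u; have s0 := normr_ge0 s.
set a := `|u| in us u0 *; set b := `|s| in us s0 *.
have h2 : a ^+ 2 <= 4 * b ^+ 2.
  have -> : 4 * b ^+ 2 = (2 * b) ^+ 2 by ring.
  by rewrite lerXn2r// nnegrE mulr_ge0.
have h3 : a ^+ 3 <= 8 * b ^+ 3.
  have -> : 8 * b ^+ 3 = (2 * b) ^+ 3 by ring.
  by rewrite lerXn2r// nnegrE mulr_ge0.
have a2 := exprn_ge0 2 u0; have b2 := exprn_ge0 2 s0.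
case: (leP a 1) => a1; case: (leP b 1) => b1 //.
- have : a ^+ 3 <= a ^+ 2 by rewrite exprS ler_piMl.
  lra.
- have : a ^+ 2 <= a ^+ 3 by rewrite exprS ler_peMl// ltW.
  lra.
- lra.
Qed.

Lemma cubic_min_sub (x y t : R) : 0 <= t <= 1 ->
  cubic_min ((x - y) * t) <= 8 * (cubic_min x + cubic_min y).
Proof.
move=> /andP[t0 t1].
have /andP[cx _] := cubic_min_bounds x; have /andP[cy _] := cubic_min_bounds y.
have h : `|(x - y) * t| <= `|x| + `|y|.
  rewrite normrM (ger0_norm t0) -[leRHS]mulr1 ler_pM//.
  exact: ler_normB.
have [xy|yx] := leP `|x| `|y|.
  have : cubic_min ((x - y) * t) <= 8 * cubic_min y by apply: cubic_min_dbl; lra.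
  lra.
have : cubic_min ((x - y) * t) <= 8 * cubic_min x by apply: cubic_min_dbl; lra.
lra.
Qed.

End prelim.

Section copies.
Context {d : nat}.
Hypothesis d0 : (0 < d)%N.
Notation idx := {ffun 'I_d -> nat}.

Definition cell_support (K : nat) (m : idx) : set idx :=
  [set k | positive_index k /\ exists a, k = shift (corner d0 K a) m].

Lemma cell_support_disjoint K (m m' : idx) : m \in ibox (cube 0) (cube K) ->
  m' \in ibox (cube 0) (cube K) -> m != m' ->
  cell_support K m `&` cell_support K m' = set0.
Proof.
rewrite !mem_ibox => /forallP Hm /forallP Hm' mm'; apply/seteqP; split => // k /=.
move=> [[_ [a ->]] [_ [b /ffunP E]]]; case/eqP: mm'.
have E0 := E (Ordinal d0); have := Hm (Ordinal d0); have := Hm' (Ordinal d0).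
move: E0; rewrite !ffunE eqxx.
set x := m _; set y := m' _ => E0 yK xK.
have ab : a = b.
  case: (ltngtP a b) => // h; [have : (a.+1 * K <= b * K)%N|have : (b.+1 * K <= a * K)%N];
    by [rewrite leq_mul2r h orbT|lia].
apply/ffunP => i; have := E i; rewrite !ffunE ab.
by move/addnI.
Qed.

Lemma corner0 K : corner d0 K 0 = cube 0 :> idx.
Proof. by apply/ffunP => i; rewrite !ffunE mul0n if_same. Qed.

Lemma shift0 (m : idx) : shift (cube 0) m = m.
Proof. by apply/ffunP => i; rewrite !ffunE. Qed.

End copies.

Section shifted_field.
Context {disp : measure_display} {T : measurableType disp} {R : realType}.
Variable P : probability T R.
Context {d : nat}.
Notation idx := {ffun 'I_d -> nat}.
Variables (X : idx -> {RV P >-> R}) (mu : R).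

Lemma field_shift (l n : idx) (K : nat) w : (forall i, n i <= K)%N ->
  \sum_(m <- ibox (cube 0) (cube K) | [forall i, (m i <= n i)%N]) (X (shift l m) w - mu) =
  field X mu l n w.
Proof.
move=> nK; rewrite -big_filter -(big_map (shift l) predT (fun m => X m w - mu)).
apply: perm_big; apply: uniq_perm.
- rewrite map_inj_uniq ?filter_uniq ?ibox_uniq// => m m' /ffunP mm'.
  by apply/ffunP => i; have := mm' i; rewrite !ffunE => /addnI.
- exact: ibox_uniq.
suff key (m : idx) : (m \in [seq shift l i | i <- [seq m : idx <- ibox (cube 0) (cube K) |
    [forall i, (m i <= n i)%N]]]) = inbox l (shift l n) m.
  by move=> m; rewrite mem_ibox; exact: key.
apply/mapP/forallP.
  move=> [k]; rewrite mem_filter mem_ibox => /andP[/forallP kn /forallP k0] -> i.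
  by have := kn i; have := k0 i; rewrite !ffunE; lia.
move=> H; exists [ffun i => (m i - l i)%N].
  rewrite mem_filter mem_ibox; apply/andP; split; apply/forallP => i;
    by have := H i; have := nK i; rewrite !ffunE; lia.
by apply/ffunP => i; have /andP[li _] := H i; rewrite !ffunE subnKC// ltnW.
Qed.

End shifted_field.

Section small_ball.
Context {disp : measure_display} {T : measurableType disp} {R : realType}.
Variable P : probability T R.
Context {d : nat}.
Hypothesis d0 : (0 < d)%N.
Notation idx := {ffun 'I_d -> nat}.
Variables (X : idx -> {RV P >-> R}) (xi : {RV P >-> R}) (mu : R).
Hypothesis indX : mutually_independent positive_index X.
Hypothesis lawX : forall i, positive_index i -> same_law (X i) xi.
Hypotheses (Ixi : integ P xi) (exi : ex P xi = mu).
Hypothesis Ixi2 : integ P (fun w => (xi w - mu) ^+ 2).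
Implicit Types (l n : idx).
Local Notation rt := (@rt R d).
Let v := ex P (fun w => (xi w - mu) ^+ 2).

Lemma rt_large (A : R) : exists N, forall J, (N <= J)%N -> A <= rt J.
Proof.
have [A0|A0] := leP A 0; first by exists 0%N => J _; rewrite (le_trans A0)// ltW// rt_gt0.
exists (Num.bound (A ^+ 2)) => J NJ.
rewrite -(@ler_pXn2r _ 2)// ?nnegrE ?(ltW A0) ?(ltW (rt_gt0 _))//.
rewrite rt_sqr (le_trans (ltW (archi_boundP (sqr_ge0 A))))//.
apply: (@le_trans _ _ J%:R); first by rewrite ler_nat.
apply: (@le_trans _ _ (scale J)).
  by rewrite /scale -natrX ler_nat ltnW// ltn_expl.
rewrite -[leLHS]expr1; apply: ler_weXn2l => //.
by rewrite /scale exprn_ege1// ler1n.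
Qed.

Lemma centered_moments k : positive_index k ->
  [/\ integ P (fun w => X k w - mu), ex P (fun w => X k w - mu) = 0,
      integ P (fun w => (X k w - mu) ^+ 2) & ex P (fun w => (X k w - mu) ^+ 2) = v].
Proof.
move=> Dk; have L := lawX Dk.
have mphi : measurable_fun setT (fun y : R => y - mu) by exact: measurable_funB.
have Ixm : integ P (fun w => xi w - mu) by apply: integB => //; exact: integ_cst.
have exm : ex P (fun w => xi w - mu) = 0.
  by rewrite exB// ?ex_cst ?exi ?subrr//; exact: integ_cst.
have [? e1] := law_ex L mphi Ixm.
have [||? ?] := @law_ex _ _ _ _ _ _ (fun y => (y - mu) ^+ 2) L; [by apply: measurable_funX|by []|].
by split => //; rewrite -exm -e1.
Qed.


(** The difference of the two copies from [twin_boxes], divided by [sqrt 2], has the same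
    covariances as the field. By [lindeberg_chain] the smoothed probabilities that the grid values are
    small nearly agree, so the field itself is small on the grid with probability at least [c / 2];
    [slab_osc] fills the gaps of the grid. *)
Lemma small_ball (eps : R) : 0 < eps -> exists2 c : R, 0 < c & exists B, forall B1, (B <= B1)%N ->
  exists J0, forall J, (J0 <= J)%N -> exists E,
    [/\ measurable E, c <= prob P E &
      forall w, E w -> forall n, (forall i, (n i <= 2 ^ (J + B1))%N) ->
        `|field X mu (cube 0) n w| <= eps * rt J * weight J n].
Proof.
move=> eps0.
(* The bump vanishes only beyond 4, the weight at the grid point may be twice that at n, and
   half of eps is kept for the oscillation: 4 * 2 * e1 = eps / 2. *)
pose e1 := eps / 16; have e10 : 0 < e1 by rewrite divr_gt0.
have e3 : 0 < e1 / 3 by rewrite divr_gt0.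
have [c c0 [B HB]] := twin_boxes d0 indX lawX Ixi exi Ixi2 e3.
exists (c / 2); first by rewrite divr_gt0.
exists B => B1 BB1.
have [J1 HJ1] := HB B1 BB1.
have eps20 : 0 < eps / 2 by rewrite divr_gt0.
have c40 : 0 < c / 4 by rewrite divr_gt0.
have [r Hr] := slabbad_bound d0 indX lawX Ixi exi Ixi2 B1 eps20 c40.
pose G := (2 ^ (B1 + r))%N.
pose gs := index_enum {ffun 'I_d -> 'I_G.+1}.
pose k := 1 + e1^-1.
have k1 : 1 <= k by rewrite lerDl invr_ge0 ltW.
pose C := taylor_const (1 + 8 * k ^+ 3 + 6 * (8 * k ^+ 3 * (8 * k ^+ 3))) (size gs).
have C0 : 0 <= C.
  have k0 : 0 <= 8 * k ^+ 3 by rewrite mulr_ge0// exprn_ge0// (le_trans ler01 k1).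
  apply: taylor_const_ge0; have := mulr_ge0 k0 k0; move: k0; set e := 8 * _; lra.
pose h J w := rt J ^+ 2 * cubic_min ((xi w - mu) / rt J).
have [J2 HJ2] : exists J2, forall J, (J2 <= J)%N ->
    ex P (h J) <= c / 4 / (C * (17 * (2 ^+ B1) ^+ d) + 1).
  apply: (@ex_vanish _ _ _ _ h (fun w => (xi w - mu) ^+ 2)) => //.
  - move=> J; apply: measurable_funM => //; apply: (measurableT_comp measurable_cubic_min).
    by apply: measurable_funM => //; exact: measurable_funB.
  - move=> J w; have /andP[h1 h2] := cubic_min_bounds ((xi w - mu) / rt J).
    rewrite /h ger0_norm; last by rewrite mulr_ge0// sqr_ge0.
    rewrite (le_trans (ler_wpM2l (sqr_ge0 _) h2))// expr_div_n mulrC divfK//.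
    by rewrite expf_neq0// gt_eqF// rt_gt0.
  - move=> w e e0; have [N HN] := rt_large (`|xi w - mu| ^+ 3 / e).
    exists N => J NJ; have rJ := @rt_gt0 R d J.
    have /andP[h1 h2] := cubic_min_bounds ((xi w - mu) / rt J).
    rewrite /h ger0_norm; last by rewrite mulr_ge0// sqr_ge0.
    have h3 : cubic_min ((xi w - mu) / rt J) <= `|(xi w - mu) / rt J| ^+ 3.
      by rewrite /cubic_min ge_min lexx orbT.
    rewrite (le_trans (ler_wpM2l (sqr_ge0 _) h3))// normf_div (gtr0_norm rJ) expr_div_n.
    have -> : rt J ^+ 2 * (`|xi w - mu| ^+ 3 / rt J ^+ 3) = `|xi w - mu| ^+ 3 / rt J.
      by field; rewrite gt_eqF.
    by rewrite ler_pdivrMr// mulrC -ler_pdivrMr//; exact: HN.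
  - rewrite divr_gt0//; apply: ltr_wpDl => //; rewrite mulr_ge0// mulr_ge0// exprn_ge0// exprn_ge0//.
exists (maxn J1 (maxn r J2)) => J; rewrite !geq_max => /andP[J1J /andP[rJ J2J]].
have [a [b [Etw [ab mEtw cEtw HEtw]]]] := HJ1 J J1J.
pose K := (2 ^ (J + B1))%N; pose hh := (2 ^ (J - r))%N.
have hh0 : (0 < hh)%N by rewrite expn_gt0.
have GK : (G * hh = K)%N by rewrite /G /hh -expnD -addnA subnKC// addnC.
have rt0 := @rt_gt0 R d J.
pose gp (g : {ffun 'I_d -> 'I_G.+1}) := grid_point hh g.
have gpK g i : (gp g i <= K)%N by rewrite -GK; exact: grid_point_le.
pose s := ibox (cube 0 : idx) (cube K).
pose la := corner d0 K a.+1; pose lb := corner d0 K b.+1.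
pose Y (k : idx) w := X k w - mu.
pose z m w := (rt J)^-1 * Y m w.
pose z' m w := (Num.sqrt 2 * rt J)^-1 * (Y (shift la m) w - Y (shift lb m) w).
pose cc (m : idx) g := if [forall i, (m i <= gp g i)%N] then (e1 * weight J (gp g))^-1 else 0.
have W1 n : 1 <= weight J n := @weight_ge1 R d J n.
have e1W g : 0 < e1 * weight J (gp g) by rewrite mulr_gt0// (lt_le_trans ltr01).
have sumz g w : \sum_(m <- s) cc m g * z m w =
    (e1 * weight J (gp g))^-1 * ((rt J)^-1 * field X mu (cube 0) (gp g) w).
  rewrite -(@field_shift _ _ _ P _ X mu (cube 0) _ _ w (gpK g)) !mulr_sumr [RHS]big_mkcond/=.
  apply: eq_bigr => m _; rewrite /cc shift0; case: ifP => // _; exact: mul0r.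
have sumz' g w : \sum_(m <- s) cc m g * z' m w =
    (e1 * weight J (gp g))^-1 * ((Num.sqrt 2 * rt J)^-1 *
     (field X mu la (gp g) w - field X mu lb (gp g) w)).
  rewrite -(@field_shift _ _ _ P _ X mu la _ _ w (gpK g)) -(@field_shift _ _ _ P _ X mu lb _ _ w (gpK g)) -sumrB !mulr_sumr [RHS]big_mkcond/=.
  by apply: eq_bigr => m _; rewrite /cc; case: ifP => // _; exact: mul0r.
have ck m g : `|cc m g| <= k.
  rewrite /cc; case: ifP => _; last by rewrite normr0 (le_trans ler01 k1).
  rewrite ger0_norm ?invr_ge0 ?(ltW (e1W g))//.
  apply: (@le_trans _ _ e1^-1); last by rewrite lerDr.
  by rewrite lef_pV2 ?posrE// ler_peMr ?(ltW e10).
have supD m : cell_support d0 K m `<=` positive_index by move=> i [].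
have spos m : m \in s -> forall l, positive_index (shift l m).
  rewrite mem_ibox => /forallP H l i; have := H i; rewrite !ffunE => /andP[m0 _].
  by rewrite addn_gt0 m0 orbT.
have sY m a' : m \in s -> smeas X (cell_support d0 K m) (Y (shift (corner d0 K a') m)).
  move=> ms; apply: smeasB; last exact: smeas_cst.
  by apply: smeasX; split; [exact: spos|exists a'].
have pY m l : m \in s -> _ := fun ms => centered_moments (spos m ms l).
have Hz m : m \in s -> [/\ smeas X (cell_support d0 K m) (z m), integ P (z m), ex P (z m) = 0 &
    integ P (fun w => z m w ^+ 2)] /\ ex P (fun w => z m w ^+ 2) = v / rt J ^+ 2.
  move=> ms; have := pY m (cube 0) ms; rewrite shift0 => -[I1 E1 I2 E2].
  have zz : (fun w => z m w ^+ 2) = fun w => (rt J)^-1 ^+ 2 * Y m w ^+ 2.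
    by apply/funext => w; rewrite exprMn.
  split; last by rewrite zz exZ// E2 exprVn mulrC.
  split.
  - by apply: smeasM; [exact: smeas_cst|have := sY m 0%N ms; rewrite corner0 shift0].
  - exact: integZ.
  - by rewrite exZ// E1 mulr0.
  - by rewrite zz; exact: integZ.
have Hz' m : m \in s -> [/\ smeas X (cell_support d0 K m) (z' m), integ P (z' m), ex P (z' m) = 0 &
    integ P (fun w => z' m w ^+ 2)] /\ ex P (fun w => z' m w ^+ 2) = v / rt J ^+ 2.
  move=> ms; have [I1 E1 I2 E2] := pY m la ms; have [I1' E1' I2' E2'] := pY m lb ms.
  have dis : [set shift la m] `&` [set shift lb m] = set0.
    apply/seteqP; split => // i /= [-> /ffunP/(_ (Ordinal d0))].
    rewrite !ffunE eqxx => /addIn/eqP.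
    by rewrite eqn_pmul2r ?expn_gt0// eqSS (negbTE ab).
  have sa : smeas X [set shift la m] (Y (shift la m)).
    by apply: smeasB; [exact: smeasX|exact: smeas_cst].
  have sb : smeas X [set shift lb m] (Y (shift lb m)).
    by apply: smeasB; [exact: smeasX|exact: smeas_cst].
  have [Iab Eab] := integM_ex indX (D1 := [set shift la m]) (D2 := [set shift lb m])
    (fun i H => ltac:(rewrite H; exact: spos)) (fun i H => ltac:(rewrite H; exact: spos)) dis sa sb I1 I1'.
  have s2 : Num.sqrt 2 ^+ 2 = 2 :> R by rewrite sqr_sqrtr.
  have zz : (fun w => z' m w ^+ 2) = fun w => (2 * rt J ^+ 2)^-1 *
      (Y (shift la m) w ^+ 2 - (2 * (Y (shift la m) w * Y (shift lb m) w) - Y (shift lb m) w ^+ 2)).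
    by apply/funext => w; rewrite exprMn exprVn exprMn s2; congr (_ * _); ring.
  have J1' := integZ 2 Iab.
  have J2' := integB J1' I2'.
  split; last first.
    rewrite zz exZ//; last exact: integB.
    rewrite exB// exB// exZ// Eab E1 E2 E2' mul0r mulr0 sub0r opprK.
    by field; rewrite gt_eqF.
  split.
  - by apply: smeasM; [exact: smeas_cst|apply: smeasB; exact: sY].
  - by apply: integZ; exact: integB.
  - by rewrite exZ; [rewrite exB// E1 E1' subrr mulr0|exact: integB].
  - by rewrite zz; apply: integZ; exact: integB.
have chain := @lindeberg_chain _ _ _ P _ positive_index X indX _ _ gs k k1 cc z z'
  (cell_support d0 K) ck supD s set0 (fun _ _ => 0) (ibox_uniq _ _) (@sub0set _ _)
  (fun g => @smeas_cst _ _ _ _ _ X set0 0) (fun j _ => set0I _)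
  (fun i j si sj ij => cell_support_disjoint d0 si sj ij)
  (fun j sj => (Hz j sj).1) (fun j sj => (Hz' j sj).1)
  (fun j sj => etrans (Hz j sj).2 (esym (Hz' j sj).2)).
pose bz := bumps gs (fun g w => 0 + \sum_(m <- s) cc m g * z m w).
pose bz' := bumps gs (fun g w => 0 + \sum_(m <- s) cc m g * z' m w).
move: chain; rewrite -/bz -/bz' -/C => chain.
have mfun q : (forall m, m \in s -> smeas X (cell_support d0 K m) (q m)) ->
    measurable_fun setT (bumps gs (fun g w => 0 + \sum_(m <- s) cc m g * q m w)).
  move=> mq; apply: measurable_bumps => g.
  apply: (@smeas_measurable _ _ _ P _ X positive_index).
  apply: smeasD; first exact: smeas_cst.
  rewrite (_ : (fun w => _) = fun w => \sum_(m <- s | m \in s) cc m g * q m w); last first.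
    by apply/funext => w; rewrite [LHS]big_seq.
  apply: smeas_sum => m ms; apply: smeasM; first exact: smeas_cst.
  by apply: smeas_sub (mq m ms); exact: supD.
have mbz : measurable_fun setT bz by apply: mfun => m ms; have [[]] := Hz m ms.
have mbz' : measurable_fun setT bz' by apply: mfun => m ms; have [[]] := Hz' m ms.
have b01 (V : {ffun 'I_d -> 'I_G.+1} -> T -> R) (w : T) : 0 <= bumps gs V w <= 1.
  rewrite /bumps prodr_ge0/=; last by move=> g _; case/andP: (bump_bounds (V g w)).
  rewrite prodr_ile1// => g _; exact: bump_bounds.
have bz01 w : 0 <= bz w <= 1 by exact: b01.
have bz01' w : 0 <= bz' w <= 1 by exact: b01.
have Ibz : integ P bz.
  by apply: (@integ_bounded _ _ _ _ _ 1) => // w; have /andP[? ?] := bz01 w; rewrite ger0_norm.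
have Ibz' : integ P bz'.
  by apply: (@integ_bounded _ _ _ _ _ 1) => // w; have /andP[? ?] := bz01' w; rewrite ger0_norm.
pose cm w := cubic_min ((rt J)^-1 * (xi w - mu)).
have mq : measurable_fun setT (fun y : R => cubic_min ((rt J)^-1 * (y - mu))).
  apply: (measurableT_comp measurable_cubic_min).
  by apply: measurable_funM => //; exact: measurable_funB.
have Icm : integ P cm.
  apply: (@integ_le _ _ _ _ _ (fun w => (rt J)^-1 ^+ 2 * (xi w - mu) ^+ 2)).
  - exact: (measurableT_comp mq).
  - exact: integZ.
  - move=> w; have /andP[? ?] := cubic_min_bounds ((rt J)^-1 * (xi w - mu)).
    by rewrite ger0_norm// -exprMn.
have cY m l : m \in s -> integ P (fun w => cubic_min ((rt J)^-1 * Y (shift l m) w)) /\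
    ex P (fun w => cubic_min ((rt J)^-1 * Y (shift l m) w)) = ex P cm.
  move=> ms; have [//|I1 E1] := law_ex (lawX (spos m ms l)) mq.
  by split.
have hcm : rt J ^+ 2 * ex P cm = ex P (h J).
  rewrite -exZ//; apply: eq_ex => w; congr (_ * cubic_min _); exact: mulrC.
have cm0 : 0 <= ex P cm by apply: ex_ge0 => w; case/andP: (cubic_min_bounds ((rt J)^-1 * (xi w - mu))).
have cz m : m \in s -> ex P (fun w => cubic_min (z m w)) <= ex P cm.
  by move=> ms; have [_] := cY m (cube 0) ms; rewrite shift0 => <-.
have s21 : 0 <= (Num.sqrt 2 : R)^-1 <= 1.
  rewrite invr_ge0 sqrtr_ge0 invf_le1 ?sqrtr_gt0//.
  by rewrite -[leLHS]sqrtr1 ler_sqrt// ler1n.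
have cz' m : m \in s -> ex P (fun w => cubic_min (z' m w)) <= 16 * ex P cm.
  move=> ms; have [I1 E1] := cY m la ms; have [I2 E2] := cY m lb ms.
  have -> : 16 * ex P cm = 8 * (ex P cm + ex P cm) by ring.
  rewrite -[X in X + _]E1 -[X in _ + X]E2 -exD// -exZ; last exact: integD.
  have pw w : cubic_min (z' m w) <= 8 * (cubic_min ((rt J)^-1 * Y (shift la m) w) +
      cubic_min ((rt J)^-1 * Y (shift lb m) w)).
    rewrite /z' invfM -mulrA mulrC mulrBr; exact: cubic_min_sub.
  have IR := integZ 8 (integD I1 I2).
  apply: ex_le => //; apply: integ_le IR _.
    apply: (measurableT_comp measurable_cubic_min).
    by have [[sz _ _ _] _] := Hz' m ms; exact: smeas_measurable sz.
  move=> w; rewrite ger0_norm//; by case/andP: (cubic_min_bounds (z' m w)).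
have chain2 : `|ex P bz - ex P bz'| <= c / 4.
  apply: (le_trans chain).
  have S1 : \sum_(m <- s) (ex P (fun w => cubic_min (z m w)) + ex P (fun w => cubic_min (z' m w)))
      <= (size s)%:R * (17 * ex P cm).
    rewrite mulr_natl -sum1_size -sumrMnr -[leRHS]/(_) big_seq [leRHS]big_seq.
    by apply: ler_sum => m ms; have := cz m ms; have := cz' m ms; lra.
  have S2 : (size s)%:R <= (2 ^+ B1) ^+ d * rt J ^+ 2 :> R.
    rewrite rt_sqr -exprMn -exprD -!natrX ler_nat (leq_trans (size_ibox _ _))//.
    rewrite -[X in (_ <= _ ^ X)%N](card_ord d) -prod_nat_const leq_prod// => i _.
    by rewrite !ffunE subn0 addnC.
  apply: (le_trans (ler_wpM2l C0 S1)).
  apply: (@le_trans _ _ (C * (17 * (2 ^+ B1) ^+ d) * ex P (h J))).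
    rewrite -hcm -mulrA ler_wpM2l//.
    have -> : 17 * (2 ^+ B1) ^+ d * (rt J ^+ 2 * ex P cm) =
      ((2 ^+ B1) ^+ d * rt J ^+ 2) * (17 * ex P cm) by ring.
    by rewrite ler_wpM2r// mulr_ge0.
  have := HJ2 J J2J; set A := C * _.
  have A0 : 0 <= A by rewrite mulr_ge0// mulr_ge0// exprn_ge0// exprn_ge0.
  have A1 : 0 < A + 1 by lra.
  move=> hJ; apply: (le_trans (ler_wpM2l A0 hJ)).
  rewrite mulrA ler_pdivrMr//; nra.
(* on the twin event all bumps equal 1 *)
have lo : c <= ex P bz'.
  apply: (le_trans cEtw); rewrite -ex_indic//; apply: ex_le => //; first exact: integ_indic.
  move=> w; rewrite indicE; have /andP[? ?] := bz01' w.
  case: (boolP (w \in Etw)) => //= /set_mem wE.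
  rewrite /bz' /bumps big1// => g _; apply: bump_eq1; rewrite add0r sumz'.
  have := HEtw w wE (gp g) (gpK g).
  rewrite -/la -/lb; set D := field _ _ _ _ _ - _ => hD.
  rewrite !normrM (ger0_norm (_ : 0 <= (e1 * weight J (gp g))^-1)); last first.
    by rewrite invr_ge0 ltW.
  rewrite ler_pdivrMl// mulr1 ger0_norm; last by rewrite invr_ge0 mulr_ge0 ?sqrtr_ge0// ltW.
  case/andP: s21 => q0 q1; apply: (@le_trans _ _ ((rt J)^-1 * `|D|)).
    by rewrite ler_wpM2r// invfM ler_piMl// invr_ge0 ltW.
  by rewrite mulrC ler_pdivrMr// (le_trans hD)//; lra.
pose F := \bigcap_(g : {ffun 'I_d -> 'I_G.+1})
  [set w | `|field X mu (cube 0) (gp g) w| <= 4 * e1 * rt J * weight J (gp g)].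
have mF : measurable F.
  apply: (@sig_measurable _ _ _ P _ X positive_index); apply: sig_bigcap => g.
  by apply: sig_ge; apply: smeas_norm; apply: smeas_field; exact: ibox_positive.
(* outside F some bump vanishes *)
have hi : ex P bz <= prob P F.
  rewrite -ex_indic//; apply: ex_le => //; first exact: integ_indic.
  move=> w; rewrite indicE; have /andP[? ?] := bz01 w.
  case: (boolP (w \in F)) => //= wF.
  have /existsNP[g] : ~ forall g : {ffun 'I_d -> 'I_G.+1},
      `|field X mu (cube 0) (gp g) w| <= 4 * e1 * rt J * weight J (gp g).
    by move=> H; move/negP: wF; apply; apply: mem_set => g _; exact: H.
  move/negP; rewrite -ltNge => hg.
  rewrite /bz /bumps (bigD1_seq g) ?mem_index_enum ?index_enum_uniq//=.
  rewrite bump_eq0 ?mul0r//; rewrite add0r sumz !normrM.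
  rewrite (ger0_norm (_ : 0 <= (e1 * weight J (gp g))^-1)); last by rewrite invr_ge0 ltW.
  rewrite (ger0_norm (_ : 0 <= (rt J)^-1)); last by rewrite invr_ge0 ltW.
  rewrite ler_pdivlMl// ler_pdivlMl// (le_trans _ (ltW hg))//; lra.
exists (F `&` ~` slabbad X mu (eps / 2) (cube 0) J B1 r).
have ms := measurable_slabbad X mu (eps / 2) (cube 0) B1 rJ.
split.
- by apply: measurableI => //; exact: measurableC.
- have := probI_ge P mF (measurableC ms); rewrite (probC P ms).
  have := Hr (cube 0) J rJ; move: chain2; rewrite ler_norml => /andP[? ?]; lra.
move=> w [wF wS] n nK.
have nG i : (n i <= G * hh)%N by rewrite GK; exact: nK.
have [g fg] := floor_grid hh0 nG.
have osc : `|field X mu (cube 0) n w - field X mu (cube 0) (gp g) w| <= eps / 2 * rt J.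
  have dR : 0 < d%:R :> R by rewrite ltr0n.
  rewrite -[gp g]fg; have -> : eps / 2 * rt J = d%:R * (eps / 2 * rt J / d%:R) by field; rewrite gt_eqF.
  apply: (@slab_osc _ _ _ P d X mu (cube 0) hh G) => //.
    by rewrite divr_ge0// mulr_ge0// ltW.
  by move=> i k' k'G; rewrite GK => hm; apply: wS; exists (i, Ordinal k'G).
have Wn := W1 n.
have fgp : `|field X mu (cube 0) (gp g) w| <= eps / 2 * rt J * weight J n.
  have [[i gi]|/forallNP g0] := pselect (exists i, gp g i = 0%N).
    by rewrite (@field0 _ _ _ _ _ X mu _ _ w i gi) normr0 (mulr_ge0 (mulr_ge0 (ltW eps20) (ltW rt0)))// (le_trans ler01 Wn).
  have gpos i : (0 < gp g i)%N by rewrite lt0n; apply/eqP; exact: g0.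
  apply: (le_trans (wF g I)).
  have hW : weight J (gp g) <= 2 * weight J n :> R.
    apply: weight_floor => // i; rewrite -[gp g]fg ffunE.
      exact: leq_trunc_div.
    have := gpos i; rewrite -[gp g]fg ffunE => q0.
    have q1 : (0 < n i %/ hh)%N by move: q0; case: (n i %/ hh)%N.
    have /ltnW/leq_trans := ltn_ceil (n i) hh0; apply.
    by rewrite mulSn mul2n -addnn leq_add2r leq_pmull.
  have r0 : 0 <= 4 * e1 * rt J by rewrite (mulr_ge0 (mulr_ge0 _ (ltW e10)) (ltW rt0)).
  apply: (le_trans (ler_wpM2l r0 hW)); rewrite le_eqVlt; apply/orP; left; apply/eqP.
  by rewrite /e1; field.
have := ler_normD (field X mu (cube 0) n w - field X mu (cube 0) (gp g) w) (field X mu (cube 0) (gp g) w).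
rewrite subrK => tri.
have er : eps / 2 * rt J <= eps / 2 * rt J * weight J n.
  by rewrite ler_peMr// mulr_ge0 ?ltW.
have -> : eps * rt J * weight J n = eps / 2 * rt J * weight J n + eps / 2 * rt J * weight J n by field.
lra.
Qed.

End small_ball.

(** * Small fluctuations infinitely often *)


Section null_sets.
Context {disp : measure_display} {T : measurableType disp} {R : realType}.
Variable P : probability T R.

Lemma negligible_small (S : set T) :
  (forall eta, 0 < eta -> exists E, [/\ measurable E, prob P E <= eta & S `<=` E]) ->
  P.-negligible S.
Proof.
move=> H.
have H' (n : nat) : exists E, [/\ measurable E, prob P E <= n.+1%:R^-1 & S `<=` E].
  by apply: H; rewrite invr_gt0.
have [E HE] := choice H'.
have mI : measurable (\bigcap_n E n) by apply: bigcapT_measurable => n; case: (HE n).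
exists (\bigcap_n E n); split => //.
  have p0 : prob P (\bigcap_n E n) = 0.
    apply/eqP; rewrite eq_le prob_ge0 andbT; apply/ler_addgt0Pr => e e0; rewrite add0r.
    have [mE pE _] := HE (Num.bound e^-1).
    apply: (le_trans (le_prob P mI mE _)); first by move=> w; exact.
    apply: (le_trans pE); rewrite invf_ple ?posrE//.
    have e'0 : 0 <= e^-1 by rewrite invr_ge0 ltW.
    by rewrite (le_trans (ltW (archi_boundP e'0)))// ler_nat.
  by rewrite probE// p0.
by move=> w Sw n _; case: (HE n) => _ _; exact.
Qed.

Lemma integ_sum (J : Type) (s : seq J) (f : J -> T -> R) : (forall j, integ P (f j)) ->
  integ P (fun w => \sum_(j <- s) f j w).
Proof.
move=> If; elim: s => [|j s IH].
  rewrite (_ : (fun w => _) = fun=> 0); first exact: integ_cst.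
  by apply/funext => w; rewrite big_nil.
rewrite (_ : (fun w => _) = fun w => f j w + \sum_(j <- s) f j w); first exact: integD.
by apply/funext => w; rewrite big_cons.
Qed.

End null_sets.

Section infinitely_often.
Context {disp : measure_display} {T : measurableType disp} {R : realType}.
Variable P : probability T R.
Context {d : nat}.
Hypothesis d0 : (0 < d)%N.
Notation idx := {ffun 'I_d -> nat}.
Variables (X : idx -> {RV P >-> R}) (xi : {RV P >-> R}) (mu : R).
Hypothesis indX : mutually_independent positive_index X.
Hypothesis lawX : forall i, positive_index i -> same_law (X i) xi.
Hypotheses (Ixi : integ P xi) (exi : ex P xi = mu).
Hypothesis Ixi2 : integ P (fun w => (xi w - mu) ^+ 2).
Implicit Types (l n : idx).
Local Notation rt := (@rt R d).
Local Notation obox K := (ibox (cube 0 : idx) (cube K)).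
Local Notation fld := (field X mu (cube 0)).

Definition abs_sum (s : seq idx) w := \sum_(m <- s) `|X m w - mu|.

Lemma smeas_abs_sum (s : seq idx) D : [set` s] `<=` D -> smeas X D (abs_sum s).
Proof.
move=> sD; rewrite (_ : abs_sum s = fun w => \sum_(m <- s | m \in s) `|X m w - mu|).
  apply: smeas_sum => m ms; apply: smeas_norm; apply: smeasB; last exact: smeas_cst.
  by apply: smeasX; exact: sD.
by apply/funext => w; rewrite /abs_sum big_seq.
Qed.

Lemma abs_sum_negligible (s : seq idx) (a eta : R) : [set` s] `<=` positive_index ->
  0 < a -> 0 < eta ->
  exists J0, forall J, (J0 <= J)%N -> prob P [set w | a * rt J <= abs_sum s w] <= eta.
Proof.
move=> sD a0 eta0.
have Is : integ P (abs_sum s).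
  rewrite (_ : abs_sum s = fun w => \sum_(m <- s) (if m \in s then `|X m w - mu| else 0)); last first.
    by apply/funext => w; rewrite /abs_sum big_seq big_mkcond.
  apply: integ_sum => m; case ms : (m \in s); last exact: integ_cst.
  have [I1 _ _ _] := centered_moments lawX Ixi exi Ixi2 (sD m ms).
  exact: integrable_norm.
have [J0 HJ] := rt_large d0 (ex P (abs_sum s) / (a * eta)).
exists J0 => J J0J; have r0 := @rt_gt0 R d J.
have a0s w : 0 <= abs_sum s w by apply: sumr_ge0.
apply: (le_trans (markov_prob _ Is a0s (mulr_gt0 a0 r0) _)) => //.
  by apply: (@sig_measurable _ _ _ P _ X [set` s]); apply: sig_le; exact: smeas_abs_sum.
have := HJ J J0J; rewrite !ler_pdivrMr ?mulr_gt0//.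
by move=> h; rewrite (le_trans h)// le_eqVlt; apply/orP; left; apply/eqP; ring.
Qed.

Definition good eps J : set T := [set w | forall n, `|fld n w| <= eps * rt J * weight J n].

(** The field without the variables used by the earlier trials. *)
Definition reduced K n w : R :=
  csum X mu [seq m <- ibox (cube 0) (shift (cube 0) n) | m \notin obox K] w.

Lemma reduced_diff K n w : `|fld n w - reduced K n w| <= abs_sum (obox K) w.
Proof.
rewrite /field (csum_filter X mu _ (fun m => m \in obox K)) addrK /csum big_filter.
rewrite (le_trans (ler_norm_sum _ _ _))// /abs_sum -big_filter.
set s1 := [seq _ <- _ | _]; rewrite [leRHS](bigID (mem s1) predT)/= -[leLHS]addr0.
apply: lerD; last by apply: sumr_ge0.
rewrite -[X in _ <= X]big_filter le_eqVlt; apply/orP; left; apply/eqP.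
apply: perm_big; apply: uniq_perm; rewrite ?filter_uniq ?ibox_uniq//.
by move=> m; rewrite [RHS]mem_filter /s1 !mem_filter andbAC andbb.
Qed.

Lemma obox_sub K K' : (K <= K')%N -> [set` obox K] `<=` [set` obox K'].
Proof.
move=> KK' m /=; rewrite !mem_ibox => /forallP H; apply/forallP => i.
by have := H i; rewrite !ffunE => /andP[-> h]; exact: leq_trans KK'.
Qed.

Lemma obox_positive K : [set` obox K] `<=` positive_index.
Proof. exact: ibox_positive. Qed.

(** Choose the scale of each new trial so large that the variables used before contribute a negligible
    part of [rt J]. Up to an event [F] of small probability the trials are then independent, and each
    succeeds with probability at least [c / 2]. The outer indices, beyond [2 ^ (J + B1)], are handled
    by [tailbad_bound]. *)
Lemma trials (eps : R) : 0 < eps -> exists2 c : R, 0 < c <= 1 & forall b J0 eta, 0 < eta ->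
  exists K A F, [/\ sig X [set` obox K] A, prob P A <= (1 - c) ^+ b,
    measurable F, prob P F <= eta &
    forall w, (forall J, (J0 <= J)%N -> ~ good eps J w) -> A w \/ F w].
Proof.
move=> eps0.
pose e := eps / 4; have e0 : 0 < e by rewrite divr_gt0.
have [c c0 [B HB]] := small_ball d0 indX lawX Ixi exi Ixi2 e0.
have [KT KT0 HT] := tailbad_bound d0 indX lawX Ixi exi Ixi2.
have c1 : c <= 1.
  have [J0 /(_ _ (leqnn _))[E [mE cE _]]] := HB B (leqnn B).
  exact: le_trans cE (prob_le1 P mE).
exists (c / 2); first by apply/andP; split; lra.
move=> b J0; elim: b => [|b IH] eta eta0.
  exists 0%N, setT, set0; split => //.
  - exact: (@measurableT _ (g_sigma_algebraType (info X [set` obox 0]))).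
  - by rewrite probT expr0.
  - by rewrite /prob measure0 ltW.
  - by move=> w _; left.
have [//|K [A [F [sA pA mF pF HAF]]]] := IH (eta / 2); first lra.
have [B' HB'] : exists B', theta (R := R) (d := d) ^+ B' <= eta / 4 * e ^+ 2 / KT.
  by apply: (theta_small d0); rewrite divr_gt0// mulr_gt0 ?exprn_gt0//; lra.
pose B1 := maxn B B'.
have [J1 HJ1] := HB B1 (leq_maxl _ _).
pose eta' := Num.min (eta / 4) (c / 2).
have eta'0 : 0 < eta' by rewrite lt_min; apply/andP; split; lra.
have [J2 HJ2] := abs_sum_negligible (@obox_positive K) e0 eta'0.
pose J := maxn J0 (maxn K (maxn J1 J2)).
have J0J : (J0 <= J)%N by rewrite leq_maxl.
have KJ : (K <= J)%N by rewrite /J !leq_max leqnn !orbT.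
have J1J : (J1 <= J)%N by rewrite /J !leq_max leqnn !orbT.
have J2J : (J2 <= J)%N by rewrite /J !leq_max leqnn !orbT.
have [E [mE cE HE]] := HJ1 J J1J.
pose K' := (2 ^ (J + B1))%N.
have KK' : (K <= K')%N.
  rewrite (leq_trans KJ)// (leq_trans (ltnW (ltn_expl J (isT : 1 < 2)%N)))//.
  by rewrite leq_exp2l// leq_addr.
pose D := [set m : idx | m \in obox K' /\ m \notin obox K].
pose Z := [set w | e * rt J <= abs_sum (obox K) w].
have mZ : measurable Z.
  by apply: (@sig_measurable _ _ _ P _ X [set` obox K]); apply: sig_le; exact: smeas_abs_sum.
have pZ := HJ2 J J2J; rewrite -/Z le_min in pZ; have /andP[pZ1 pZ2] := pZ.
pose far := \bigcup_Q tailbad X mu e (cube 0) J B1 Q.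
have mtb Q : measurable (tailbad X mu e (cube 0) J B1 Q) by exact: measurable_tailbad.
have mfar : measurable far by exact: bigcup_measurable.
have pfar : prob P far <= eta / 4.
  apply: prob_bigcup_le => //.
    move=> Q Q' QQ' w [n [/= nQ ni] bn]; exists n => //; split => // i.
    by rewrite (leq_trans (nQ i))// leq_exp2l.
  move=> Q; apply: (le_trans (HT _ _ _ _ _ e0)).
  rewrite ler_pdivrMr ?exprn_gt0// mulrC -ler_pdivlMr//.
  apply: le_trans HB'; have /andP[t0 t1] := @theta_bounds R d d0.
  by apply: ler_wiXn2l; rewrite ?leq_maxr ?(ltW t0) ?(ltW t1).
have W1 n : 1 <= weight J n := @weight_ge1 R d J n.
have er0 : 0 < e * rt J by rewrite mulr_gt0// rt_gt0.
pose S := \bigcap_(n in [set n : idx | forall i, (n i <= K')%N])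
  [set w | `|reduced K n w| <= 2 * (e * rt J) * weight J n].
have sS : sig X D S.
  rewrite -[S]setCK setC_bigcap; apply: sigC; apply: sig_bigcup_in => n nK'.
  apply: sigC; apply: sig_ge; apply: smeas_norm; apply: smeas_csum => m /=.
  rewrite mem_filter => /andP[mK mn]; split => //.
  move: mn; rewrite !mem_ibox => /forallP H; apply/forallP => i.
  have := H i; rewrite !ffunE add0n => /andP[-> h]; exact: leq_trans (nK' i).
have mS := sig_measurable sS.
have pS : c / 2 <= prob P S.
  have : prob P (E `&` ~` Z) <= prob P S.
    apply: le_prob => //; first by apply: measurableI => //; exact: measurableC.
    move=> w [wE wZ] n nK' /=.
    have Zlt : abs_sum (obox K) w < e * rt J by rewrite ltNge; apply/negP.
    have h1 := HE w wE n nK'; have h2 := reduced_diff K n w.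
    have h3 := ler_normB (fld n w) (fld n w - reduced K n w).
    rewrite opprB addrC subrK in h3.
    have h4 : e * rt J <= e * rt J * weight J n by rewrite ler_peMr// ltW.
    lra.
  have := probI_ge P mE (measurableC mZ); rewrite (probC P mZ); lra.
exists K', (A `&` ~` S), (F `|` (Z `|` far)); split.
- apply: sigI; first exact: sig_sub (obox_sub KK') _ sA.
  by apply: sigC; apply: sig_sub sS => m [].
- rewrite (sig_prob_indep indX (@obox_positive K) _ _ sA (sigC sS)).
  + rewrite exprSr ler_pM ?prob_ge0// (probC P mS); lra.
  + by move=> m [/obox_positive].
  + by apply/seteqP; split => // m /= [mK [_]]; rewrite mK.
- by apply: measurableU => //; exact: measurableU.
- have := probU_le P mF (measurableU _ _ mZ mfar); have := probU_le P mZ mfar; lra.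
move=> w Hw; have [Aw|Fw] := HAF w Hw; last by right; left.
have [wZ|wZ] := pselect (Z w); first by right; right; left.
have [wf|wf] := pselect (far w); first by right; right; right.
left; split => // wS; apply: (Hw J J0J) => n.
have er1 : e * rt J * weight J n <= eps * rt J * weight J n.
  rewrite !ler_wpM2r ?(ltW (rt_gt0 _))//; first exact: le_trans (W1 n).
  by rewrite /e; lra.
have [[i ni]|/forallNP nn] := pselect (exists i, (K' < n i)%N).
  rewrite leNgt; apply/negP => hlt; apply: wf.
  exists (\max_i up_log 2 (n i)) => //; exists n => /=; last exact: le_lt_trans hlt.
  split; last by exists i.
  move=> j; rewrite (leq_trans (up_logP _ (isT : 1 < 2)%N))// leq_exp2l//.
  exact: (leq_bigmax j).
have nK' i : (n i <= K')%N by rewrite leqNgt; apply/negP; exact: nn.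
have Zlt : abs_sum (obox K) w < e * rt J by rewrite ltNge; apply/negP.
have h1 := wS n nK'; have h2 := reduced_diff K n w; rewrite /= in h1.
have h3 := ler_normD (fld n w - reduced K n w) (reduced K n w).
rewrite subrK in h3.
have h4 : e * rt J <= e * rt J * weight J n by rewrite ler_peMr// ltW.
have -> : eps * rt J * weight J n = 4 * (e * rt J * weight J n) by rewrite /e; field.
have : 0 <= e * rt J * weight J n by rewrite (mulr_ge0 (ltW er0))// (le_trans ler01 (W1 n)).
lra.
Qed.

Lemma good_infinitely_often (eps : R) : 0 < eps ->
  {ae P, forall w, forall J0, exists2 J, (J0 <= J)%N & good eps J w}.
Proof.
move=> eps0; have [c /andP[c0 c1] H] := trials eps0.
pose S J0 := [set w | forall J, (J0 <= J)%N -> ~ good eps J w].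
apply: (@negligibleS _ _ _ _ (\bigcup_J0 S J0)).
  move=> w /= /existsNP[J0 HJ]; exists J0 => // J J0J gJ; apply: HJ; by exists J.
apply: negligible_bigcup => J0; apply: negligible_small => eta eta0.
have e20 : 0 < eta / 2 by rewrite divr_gt0.
have [b Hb] : exists b, (1 - c) ^+ b <= eta / 2.
  have : (fun k : nat => (1 - c) ^+ k) @ \oo --> (0 : R).
    by apply: cvg_expr; rewrite ger0_norm; lra.
  move/cvgrPdist_le => /(_ _ e20)[b _ Hb]; exists b.
  by have := Hb b (leqnn _); rewrite /= sub0r normrN; apply: le_trans; exact: ler_norm.
have [K [A [F [sA pA mF pF HAF]]]] := H b J0 (eta / 2) e20.
have mA := sig_measurable sA.
exists (A `|` F); split; first exact: measurableU.
  have := probU_le P mA mF; lra.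
by move=> w Sw; exact: HAF.
Qed.

End infinitely_often.

(** * Multilinear interpolation *)


Section interpolation.
Context {R : realType} {d : nat}.
Notation idx := {ffun 'I_d -> nat}.
Implicit Types (m n : idx) (xi : idx -> R) (x y : 'rV[R]_d).

Definition cube0 : idx := [ffun=> 0%N].

Definition succ_index K (f : {ffun 'I_d -> 'I_K}) : idx := [ffun i => (f i).+1].

Lemma succ_index_inj K : injective (@succ_index K).
Proof.
move=> f g /ffunP fg; apply/ffunP => i; apply: val_inj.
by have := fg i; rewrite !ffunE => -[].
Qed.

Lemma partial_sum_ibox xi n : partial_sum xi n = \sum_(m <- ibox cube0 n) xi m.
Proof.
rewrite fsbig_seq ?ibox_uniq//; congr (\sum_(i \in _) _).
apply/seteqP; split => m /=; rewrite mem_ibox.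
  by move=> H; apply/forallP => i; rewrite ffunE; exact: H.
by move/forallP => H i; have := H i; rewrite ffunE.
Qed.

Lemma prod_indicator (I : finType) (p : pred I) :
  \prod_i ((p i)%:R : R) = [forall i, p i]%:R.
Proof.
case: (boolP [forall i, p i]) => [/forallP pP|].
  by rewrite big1// => i _; rewrite pP.
by rewrite negb_forall => /existsP[i pi]; rewrite (bigD1 i)//= (negbTE pi) mul0r.
Qed.

(** A product of indicators makes the dependence on [n] multiplicative over the
    coordinates, so that interpolation can act on each coordinate separately. *)
Lemma partial_sumE K xi n : (forall i, n i <= K)%N ->
  partial_sum xi n =
  \sum_(f : {ffun 'I_d -> 'I_K}) xi (succ_index f) * \prod_i ((f i < n i)%N)%:R.
Proof.
move=> nK; rewrite partial_sum_ibox.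
transitivity (\sum_(f : {ffun 'I_d -> 'I_K} | [forall i, (f i < n i)%N]) xi (succ_index f)); last first.
  rewrite big_mkcond/=; apply: eq_bigr => f _.
  by rewrite (prod_indicator (fun i => f i < n i)%N); case: ifP; rewrite ?mulr1 ?mulr0.
rewrite -[RHS]big_filter -[RHS](big_map (@succ_index K) predT xi).
apply: perm_big; apply: uniq_perm.
- exact: ibox_uniq.
- by rewrite map_inj_uniq ?filter_uniq ?index_enum_uniq//; exact: succ_index_inj.
suff key m : (m \in ibox cube0 n) = (m \in [seq succ_index i |
   i <- [seq f : {ffun 'I_d -> 'I_K} <- index_enum {ffun 'I_d -> 'I_K} | [forall i, (f i < n i)%N]]]) by exact: key.
rewrite mem_ibox; apply/forallP/mapP.
  move=> H; have mK i : ((m i).-1 < K)%N.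
    by have := H i; have := nK i; rewrite ffunE; lia.
  exists [ffun i => Ordinal (mK i)].
    rewrite mem_filter mem_index_enum andbT; apply/forallP => i; rewrite ffunE /=.
    by have := H i; rewrite ffunE; lia.
  by apply/ffunP => i; have := H i; rewrite !ffunE /=; lia.
move=> [f]; rewrite mem_filter mem_index_enum andbT => /forallP H -> i.
by have := H i; rewrite !ffunE.
Qed.

Lemma sum_prod_indicator K n : (forall i, n i <= K)%N ->
  \sum_(f : {ffun 'I_d -> 'I_K}) \prod_i ((f i < n i)%N)%:R = vol n :> R.
Proof.
move=> nK; rewrite -(bigA_distr_bigA (fun i (j : 'I_K) => ((j < n i)%N)%:R))/=.
apply: eq_bigr => i _; rewrite -natr_sum; congr _%:R.
rewrite (eq_bigr (fun j : 'I_K => if (j < n i)%N then 1%N else 0%N)); last by move=> j _; case: ifP.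
by rewrite -big_mkcond/= (big_ord_narrow (nK i)) sum_nat_const card_ord muln1.
Qed.

Lemma partial_sum_centered xi mu n :
  partial_sum (fun m => xi m - mu) n = partial_sum xi n - mu * vol n.
Proof.
have nK i : (n i <= \max_j n j)%N by exact: leq_bigmax.
rewrite !(partial_sumE _ nK) -(sum_prod_indicator nK) mulr_sumr -sumrB.
by apply: eq_bigr => f _; rewrite mulrBl.
Qed.

(** The length of the part of the interval from [j] to [j + 1] that lies below [y]. *)
Definition overlap (y : R) (j : nat) : R := Num.max 0 (Num.min 1 (y - j%:R)).

Lemma overlap_ge0 (y : R) j : 0 <= overlap y j.
Proof. by rewrite /overlap le_max lexx. Qed.

Lemma le_overlap (y y' : R) j : y <= y' -> overlap y j <= overlap y' j.
Proof.
move=> yy; rewrite /overlap !(maxEle, minEle).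
by do ! case: ifPn; rewrite -?ltNge; lra.
Qed.

Lemma corner_weights (y : R) j : 0 <= y ->
  \sum_(b : bool) `|y - (Num.truncn y + b)%:R| * ((j < Num.truncn y + ~~ b)%N)%:R =
  overlap y j.
Proof.
move=> y0; have /andP[ky yk] := truncn_itv y0; set k := Num.truncn y in ky yk *.
have eb (F : bool -> R) : \sum_(b : bool) F b = F true + F false.
  by rewrite big_bool.
rewrite eb /= addn0 addn1 -natr1 in yk *; rewrite /overlap.
rewrite (ltr0_norm (_ : y - (k%:R + 1) < 0)); last by lra.
rewrite (ger0_norm (_ : 0 <= y - k%:R)); last by lra.
have -> : (j < k.+1)%N = (j <= k)%N by rewrite ltnS.
case: (ltngtP j k) => jk.
- have : j%:R + 1 <= k%:R :> R by rewrite natr1 ler_nat.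
  by move=> ?; rewrite /= !mulr1 min_l ?max_r//; lra.
- have : k%:R + 1 <= j%:R :> R by rewrite natr1 ler_nat.
  by move=> ?; rewrite /= !mulr0 min_r ?max_l//; lra.
- by rewrite jk; rewrite mulr0 mulr1 add0r min_r ?max_r//; lra.
Qed.

(** The interpolated sum integrates the variables over the box between 0 and [x], each
    being spread uniformly over its unit cell. Monotonicity in [x] can be read off. *)
Lemma interpolated_sumE K xi x : orthant x ->
    (forall i, Num.truncn (x 0%R i) < K)%N ->
  interpolated_sum xi x =
  \sum_(f : {ffun 'I_d -> 'I_K})
     xi (succ_index f) * \prod_i overlap (x 0 i) (f i).
Proof.
move=> x0 xK; rewrite /interpolated_sum.
transitivity (\sum_(e : {ffun 'I_d -> bool}) \sum_(f : {ffun 'I_d -> 'I_K})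
   xi (succ_index f) * \prod_i (`|x 0 i - (Num.truncn (x 0 i) + e i)%:R| *
        ((f i < Num.truncn (x 0%R i) + ~~ e i)%N)%:R)).
  apply: eq_bigr => e _; rewrite (@partial_sumE K).
    rewrite mulr_sumr; apply: eq_bigr => f _; rewrite mulrCA big_split/=.
    by congr (_ * (_ * _)); apply: eq_bigr => i _; rewrite !ffunE.
  by move=> i; rewrite !ffunE; have := xK i; case: (e i) => /=; lia.
rewrite exchange_big/=; apply: eq_bigr => f _; rewrite -mulr_sumr; congr (_ * _).
rewrite -(bigA_distr_bigA (fun i (b : bool) => `|x 0 i - (Num.truncn (x 0 i) + b)%:R| *
        ((f i < Num.truncn (x 0%R i) + ~~ b)%N)%:R)).
by apply: eq_bigr => i _; exact: corner_weights.
Qed.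

Lemma le_interpolated_sum xi x y :
    (forall m, positive_index m -> 0 <= xi m) -> orthant x ->
    (forall i, x 0 i <= y 0 i) ->
  interpolated_sum xi x <= interpolated_sum xi y.
Proof.
move=> xi0 x0 xy; have y0 : orthant y by move=> i; exact: le_trans (x0 i) (xy i).
pose K := (\max_i Num.truncn (y 0%R i)).+1.
have yK i : (Num.truncn (y 0%R i) < K)%N by rewrite ltnS; exact: (leq_bigmax i).
have xK i : (Num.truncn (x 0%R i) < K)%N.
  by apply: leq_ltn_trans (yK i); exact: le_truncn.
rewrite !(@interpolated_sumE K)//; apply: ler_sum => f _; apply: ler_wpM2l.
  by apply: xi0 => i; rewrite ffunE.
by apply: ler_prod => i _; rewrite overlap_ge0 le_overlap.
Qed.

Lemma interpolated_sum_axis xi x i : orthant x -> x 0 i = 0 ->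
  interpolated_sum xi x = 0.
Proof.
move=> x0 xi0.
pose K := (\max_i Num.truncn (x 0%R i)).+1.
have xK j : (Num.truncn (x 0%R j) < K)%N by rewrite ltnS; exact: (leq_bigmax j).
rewrite (@interpolated_sumE K)// big1// => f _.
rewrite (bigD1 i)//= xi0 [overlap _ _]max_l ?mul0r ?mulr0// ge_min sub0r oppr_le0 ler0n orbT.
Qed.

Lemma sum_corner_weight (y : R) : 0 <= y ->
  \sum_(b : bool) `|y - (Num.truncn y + b)%:R| = 1.
Proof.
move=> y0; have /andP[ky yk] := truncn_itv y0; set k := Num.truncn y in ky yk *.
rewrite big_bool /= addn0 addn1 -natr1 in yk *.
rewrite (ltr0_norm (_ : y - (k%:R + 1) < 0)); last by lra.
by rewrite (ger0_norm (_ : 0 <= y - k%:R)); lra.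
Qed.

Lemma mean_corner_weight (y : R) : 0 <= y ->
  \sum_(b : bool) `|y - (Num.truncn y + b)%:R| * (Num.truncn y + ~~ b)%:R = y.
Proof.
move=> y0; have /andP[ky yk] := truncn_itv y0; set k := Num.truncn y in ky yk *.
rewrite big_bool /= addn0 addn1 -natr1 in yk *.
rewrite (ltr0_norm (_ : y - (k%:R + 1) < 0)); last by lra.
by rewrite (ger0_norm (_ : 0 <= y - k%:R)); lra.
Qed.

(** The interpolation weights are nonnegative and sum to 1, and reproduce the product
    function, which is multilinear: the deviation at [x] is an average of deviations at vertices. A
    vertex with a zero coordinate contributes 0, and the others satisfy [n i >= x i / 2]. *)
Lemma interpolated_sum_dev xi mu x (c s : R) : orthant x -> 0 <= c -> 0 < s ->
    (forall n, positive_index n -> (forall i, x 0 i / 2 <= (n i)%:R) ->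
       `|partial_sum xi n - mu * vol n| <= c * (1 + vol n / s)) ->
  `|interpolated_sum xi x - mu * \prod_i x 0 i| <= c * (1 + (\prod_i x 0 i) / s).
Proof.
move=> x0 c0 s0 H.
pose w (e : {ffun 'I_d -> bool}) := \prod_(i < d) `|x 0 i - (cube_vertex x e i)%:R|.
pose v e := cube_vertex x (opposite e).
have w0 e : 0 <= w e by apply: prodr_ge0.
have w1 : \sum_e w e = 1.
  rewrite /w (eq_bigr (fun e : {ffun 'I_d -> bool} =>
    \prod_i `|x 0 i - (Num.truncn (x 0 i) + e i)%:R|)); last first.
    by move=> e _; apply: eq_bigr => i _; rewrite ffunE.
  rewrite -(bigA_distr_bigA (fun i (b : bool) => `|x 0 i - (Num.truncn (x 0 i) + b)%:R|))/=.
  by rewrite big1// => i _; exact: sum_corner_weight.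
have wv : \sum_e w e * vol (v e) = \prod_i x 0 i.
  rewrite (eq_bigr (fun e : {ffun 'I_d -> bool} =>
    \prod_i (`|x 0 i - (Num.truncn (x 0 i) + e i)%:R| * (Num.truncn (x 0 i) + ~~ e i)%:R))); last first.
    by move=> e _; rewrite big_split/=; congr (_ * _); apply: eq_bigr => i _; rewrite !ffunE.
  rewrite -(bigA_distr_bigA (fun i (b : bool) => `|x 0 i - (Num.truncn (x 0 i) + b)%:R|
    * (Num.truncn (x 0 i) + ~~ b)%:R))/=.
  by apply: eq_bigr => i _; exact: mean_corner_weight.
have -> : interpolated_sum xi x - mu * \prod_i x 0 i =
    \sum_e w e * (partial_sum xi (v e) - mu * vol (v e)).
  rewrite -wv mulr_sumr -sumrB; apply: eq_bigr => e _.
  by rewrite mulrBr (mulrCA mu).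
have -> : c * (1 + (\prod_i x 0 i) / s) = \sum_e w e * (c * (1 + vol (v e) / s)).
  rewrite -wv -{1}w1 mulr_suml -big_split/= mulr_sumr.
  by apply: eq_bigr => e _; field; rewrite gt_eqF.
apply: le_trans (ler_norm_sum _ _ _) _; apply: ler_sum => e _.
rewrite normrM ger0_norm//; apply: ler_wpM2l => //.
have [/forallP vpos|] := boolP [forall i, (0 < v e i)%N].
  apply: H => // i; have := vpos i.
  have /andP[ky yk] := truncn_itv (x0 i); rewrite !ffunE => vp.
  have [k0|k0] := posnP (Num.truncn (x 0 i)).
    rewrite k0 in vp yk *; have : 1 <= (0 + ~~ e i)%:R :> R by rewrite ler1n.
    by move: yk; rewrite add0n => ? ?; lra.
  have : 1 <= (Num.truncn (x 0 i))%:R :> R by rewrite ler1n.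
  by rewrite natrD; move: yk; rewrite -natr1; case: (~~ _) => /=; lra.
rewrite negb_forall => /existsP[i]; rewrite -eqn0Ngt => /eqP vi.
have -> : partial_sum xi (v e) = 0.
  rewrite partial_sum_ibox big1_seq// => m /andP[_]; rewrite mem_ibox => /forallP/(_ i).
  by rewrite vi ffunE; lia.
have -> : vol (v e) = 0 :> R by rewrite /vol (bigD1 i)//= vi mul0r.
by rewrite mulr0 subrr normr0 mul0r addr0 mulr1.
Qed.

End interpolation.

(** * Level sets close to a hyperboloid *)


Section coordinates.
Context {R : realType} {d : nat}.
Implicit Types x y z : 'rV[R]_d.

Definition move_along y (j : 'I_d) (s : R) : 'rV[R]_d :=
  \row_i (y 0 i + (if i == j then s else 0)).

Lemma move_along_ge y j s i : 0 <= s -> y 0 i <= move_along y j s 0 i.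
Proof. by move=> s0; rewrite mxE; case: ifP; rewrite lerDl. Qed.

Lemma prod_move_along y j s : y 0 j != 0 ->
  \prod_i move_along y j s 0 i = (1 + s / y 0 j) * \prod_i y 0 i.
Proof.
move=> yj; rewrite (bigD1 j)//= [in RHS](bigD1 j)//= mxE eqxx mulrA.
congr (_ * _); first by field.
by apply: eq_bigr => i /negbTE ij; rewrite mxE ij addr0.
Qed.

Lemma dist_move_along y j s : 0 <= s -> euclidean_dist y (move_along y j s) = s.
Proof.
move=> s0; rewrite /euclidean_dist (bigD1 j)//= big1 => [|i /negbTE ij].
  by rewrite mxE eqxx addr0 opprD addNKr sqrrN sqrtr_sqr ger0_norm.
by rewrite mxE ij addr0 subrr expr0n.
Qed.

Lemma euclidean_distC x y : euclidean_dist x y = euclidean_dist y x.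
Proof.
by rewrite /euclidean_dist; congr Num.sqrt; apply: eq_bigr => i _; rewrite -sqrrN opprB.
Qed.

Lemma exists_min_coord y : (0 < d)%N -> exists j, forall i, y 0 j <= y 0 i.
Proof.
move=> d0; have i0 : 'I_d := Ordinal d0.
by case: (@arg_minP _ _ _ i0 predT (fun i => y 0 i)) => // j _ H; exists j => i; exact: H.
Qed.

(** Either [a <= 1] or [a <= a ^+ d]. *)
Lemma min_coord_le y a : (0 < d)%N -> 0 <= a -> (forall i, a <= y 0 i) ->
  a <= 1 + \prod_i y 0 i.
Proof.
move=> d0 a0 ay; have : a ^+ d <= \prod_i y 0 i.
  rewrite -[d in a ^+ d]card_ord -prodr_const.
  by apply: ler_prod => i _; rewrite a0 ay.
have [a1|a1] := leP a 1.
  suff : 0 <= \prod_i y 0 i by lra.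
  by apply: prodr_ge0 => i _; exact: le_trans (ay i).
have : a <= a ^+ d by apply: ler_eXnr => //; exact: ltW.
by lra.
Qed.

Lemma coord_ge_prod y (rho Rb : R) i : orthant y -> 1 <= Rb ->
    (forall i, y 0 i <= Rb) -> rho <= \prod_i y 0 i ->
  rho / Rb ^+ d <= y 0 i.
Proof.
move=> y0 Rb1 yRb rhoy; rewrite ler_pdivrMr ?exprn_gt0//; last by lra.
apply: le_trans rhoy _; rewrite (bigD1 i)//=; apply: ler_wpM2l => //.
have : \prod_(j < d | j != i) y 0 j <= \prod_(j < d) Rb.
  rewrite [leRHS](bigD1 i)//= -[leLHS]mul1r; apply: ler_pM => //.
    by apply: prodr_ge0.
  by apply: ler_prod => j _; rewrite y0 yRb.
by rewrite prodr_const card_ord.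
Qed.

Lemma sum_inv_le y a : 0 < a -> (forall i, a <= y 0 i) ->
  \sum_i (y 0 i)^-1 <= d%:R / a.
Proof.
move=> a0 ay; have -> : d%:R / a = \sum_(i < d) a^-1 by rewrite sumr_const card_ord mulr_natl.
by apply: ler_sum => i _; rewrite lef_pV2// posrE//; exact: lt_le_trans (ay i).
Qed.

End coordinates.

Section level_sets.
Context {R : realType} {d : nat} (d0 : (0 < d)%N).
Implicit Types x y z h : 'rV[R]_d.
Local Notation vol_of y := (\prod_i y 0 i).
Variables (mu eta eps : R) (G : 'rV[R]_d -> R).
Hypothesis mu0 : 0 < mu.
Hypothesis eta0 : 0 <= eta.
Hypothesis eps_small : eps * (1 + 2 / mu) <= 4^-1.
Hypothesis eps0 : 0 <= eps.
Hypothesis leG : forall x y, orthant x -> (forall i, x 0 i <= y 0 i) -> G x <= G y.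
Hypothesis axisG : forall x i, orthant x -> x 0 i = 0 -> G x = 0.
Hypothesis nearG : forall x, open_orthant x ->
  `|G x - mu * vol_of x| <= eta * (1 + vol_of x) * (1 + 2 * \sum_i (x 0 i)^-1).
Hypothesis boundG : forall x, open_orthant x ->
  `|G x - mu * vol_of x| <= eps * (1 + vol_of x).

Let M := [set x : 'rV[R]_d | orthant x /\ 1 <= G x].
Let H := hyperbolic_set mu : set 'rV[R]_d.

Lemma vol_gt0 x : open_orthant x -> 0 < vol_of x.
Proof. by move=> x0; apply: prodr_gt0. Qed.

Lemma orthant_open x : orthant x -> (forall i, x 0 i != 0) -> open_orthant x.
Proof. by move=> x0 xn i; rewrite lt_neqAle eq_sym xn x0. Qed.

Lemma near_away x a : open_orthant x -> vol_of x <= 2 / mu ->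
    0 < a -> (forall i, a <= x 0 i) ->
  `|G x - mu * vol_of x| <= eta * ((1 + 2 / mu) * (1 + 2 * d%:R / a)).
Proof.
move=> x0 x2 a0 ax; apply: le_trans (nearG x0) _; rewrite -mulrA ler_wpM2l//.
have := vol_gt0 x0; have := sum_inv_le a0 ax => s1 v0.
have s0 : 0 <= \sum_i (x 0 i)^-1 by apply: sumr_ge0 => i _; rewrite invr_ge0; exact: ltW.
by apply: ler_pM; lra.
Qed.

Lemma renewal_out x : M x -> ~ H x ->
  [/\ open_orthant x, (2 * mu)^-1 <= vol_of x & vol_of x < mu^-1].
Proof.
move=> [x0 Gx] Hx.
have xo : open_orthant x.
  apply: orthant_open => // i; apply/eqP => xi.
  by have := axisG x0 xi; lra.
have xv : vol_of x < mu^-1 by rewrite ltNge; apply/negP => ?; apply: Hx.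
split => //; rewrite leNgt; apply/negP => xs.
have v0 := vol_gt0 xo; have := boundG xo.
have mv : mu * vol_of x < 2^-1.
  by move: xs; rewrite invfM ltr_pdivlMr// mulrC.
have : eps * (1 + vol_of x) <= 4^-1.
  apply: le_trans eps_small; apply: ler_wpM2l => //.
  have : 0 < mu^-1 by rewrite invr_gt0.
  move: xs; rewrite invfM => xs p0; lra.
rewrite ler_norml => ? /andP[_ ?]; lra.
Qed.

Lemma renewal_in x : orthant x -> H x -> ~ M x ->
  [/\ open_orthant x, mu^-1 <= vol_of x & vol_of x <= 2 / mu].
Proof.
move=> x0 [_ Hx] Mx.
have p0 : 0 < mu^-1 by rewrite invr_gt0.
have xo : open_orthant x.
  apply: orthant_open => // i; apply/eqP => xi.
  by move: Hx; rewrite (bigD1 i)//= xi mul0r; lra.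
split => //; rewrite leNgt; apply/negP => xs.
have G1 : G x < 1 by rewrite ltNge; apply/negP => ?; apply: Mx.
have := boundG xo; rewrite ler_norml => /andP[+ _].
set v := vol_of x in Hx xs *.
have epm : eps * (1 + v) <= mu * v / 4.
  have : (1 + v) * 2^-1 * mu^-1 <= (1 + 2 / mu) * (v / 2).
    nra.
  move=> E; have := ler_wpM2l eps0 E.
  have v20 : 0 <= v / 2 by lra.
  have := ler_wpM2r v20 eps_small => E1 E2.
  have : eps * (1 + v) * mu^-1 <= 4^-1 * v by lra.
  by rewrite ler_pdivrMr//; lra.
have : 2 < mu * v by move: xs; rewrite ltr_pdivrMr// mulrC.
lra.
Qed.

(** Moving by [C * eta] along the smallest coordinate [a] changes [mu * vol_of x] by at least
    [C * eta / (2 * a)], which exceeds the deviation that [near_away] leaves. *)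
Let C := 2 * (1 + 2 / mu) * (1 + 2 / mu + 2 * d%:R).

Lemma shift_gain a : 0 < a -> a <= 1 + 2 / mu ->
  eta * ((1 + 2 / mu) * (1 + 2 * d%:R / a)) <= C * eta / (2 * a).
Proof.
move=> a0 a1; have p0 : 0 < mu^-1 by rewrite invr_gt0.
have -> : C * eta / (2 * a) = eta * ((1 + 2 / mu) * ((1 + 2 / mu + 2 * d%:R) / a)).
  by rewrite /C; field; rewrite !gt_eqF.
apply: ler_wpM2l => //; apply: ler_wpM2l; first by lra.
by rewrite ler_pdivlMr// mulrDl mulfVK ?gt_eqF//; lra.
Qed.

Lemma C_ge0 : 0 <= C.
Proof.
have p0 : 0 < mu^-1 by rewrite invr_gt0.
by rewrite /C !mulr_ge0//; have : 0 <= d%:R :> R by []; lra.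
Qed.

(** Outside [H] the volume is at least half the critical one, so a move of length [C * eta] along
    the smallest coordinate enters [H]. *)
Lemma renewal_near_hyperbolic x : M x ->
  exists2 y, H y & euclidean_dist x y <= C * eta.
Proof.
move=> Mx; have p0 : 0 < mu^-1 by rewrite invr_gt0.
have s0 : 0 <= C * eta by rewrite mulr_ge0// C_ge0.
have [Hx|Hx] := pselect (H x).
  exists x => //; suff -> : euclidean_dist x x = 0 by [].
  by rewrite /euclidean_dist big1 ?sqrtr0// => i _; rewrite subrr expr0n.
have [xo xl xu] := renewal_out Mx Hx.
have [j jmin] := exists_min_coord x d0.
exists (move_along x j (C * eta)); last by rewrite dist_move_along.
split; first by move=> i; apply: le_trans (move_along_ge x j i s0); exact: ltW.
rewrite prod_move_along ?gt_eqF//.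
have xj0 := xo j.
have xj1 : x 0 j <= 1 + 2 / mu.
  by have := min_coord_le d0 (ltW xj0) jmin; lra.
have x2 : vol_of x <= 2 / mu by lra.
have := near_away xo x2 xj0 jmin; rewrite ler_norml => /andP[_ +].
have := shift_gain xj0 xj1; have [_ Gx] := Mx.
have -> : C * eta / (2 * x 0 j) = C * eta / x 0 j / 2 by rewrite invfM; lra.
set q := C * eta / x 0 j; set v := vol_of x in xl x2 *.
have q0 : 0 <= q by rewrite divr_ge0// ltW.
have : q / 2 <= q * (mu * v).
  apply: ler_wpM2l => //; rewrite -ler_pdivrMl//.
  by move: xl; rewrite invfM mulrC.
move=> *; rewrite -(ler_pM2l mu0) mulfV ?gt_eqF//; lra.
Qed.

(** Decrease one coordinate of [h] to reach a point [k] on the boundary of [H], move from [k] along its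
    smallest coordinate to a point of [M], and use monotonicity of [G] to move [h] itself by the same
    vector. The move is cut at [a], which at most doubles the volume and keeps the estimates
    of [G] in force. *)
Lemma hyperbolic_near_renewal h : H h ->
  exists2 y, M y & euclidean_dist h y <= C * eta.
Proof.
move=> [h0 hv]; have p0 : 0 < mu^-1 by rewrite invr_gt0.
have s0 : 0 <= C * eta by rewrite mulr_ge0// C_ge0.
have ho : open_orthant h.
  apply: orthant_open => // i; apply/eqP => hi.
  by move: hv; rewrite (bigD1 i)//= hi mul0r; lra.
have hv0 := vol_gt0 ho.
pose i0 := Ordinal d0.
pose c := mu^-1 / vol_of h.
have c0 : 0 < c by rewrite divr_gt0.
have c1 : c <= 1 by rewrite ler_pdivrMr// mul1r.
pose k : 'rV[R]_d := \row_i (if i == i0 then c * h 0 i else h 0 i).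
have ko : open_orthant k by move=> i; rewrite mxE; case: ifP => _; [exact: mulr_gt0 | exact: ho].
have kh i : k 0 i <= h 0 i.
  by rewrite mxE; case: ifP => // _; rewrite ger_pMl.
have kv : vol_of k = mu^-1.
  transitivity (c * vol_of h); last by rewrite /c mulfVK ?gt_eqF.
  rewrite (bigD1 i0)//= [in RHS](bigD1 i0)//= mulrA; congr (_ * _); first by rewrite mxE eqxx.
  by apply: eq_bigr => i /negbTE ii; rewrite mxE ii.
have [j jmin] := exists_min_coord k d0.
have a0 := ko j; set a := k 0 j in a0 jmin *.
pose s := Num.min (C * eta) a.
have sC : s <= C * eta by rewrite /s ge_min lexx.
have sa : s <= a by rewrite /s ge_min lexx orbT.
have ss0 : 0 <= s by rewrite /s le_min s0 ltW.
have a1 : a <= 1 + 2 / mu by have := min_coord_le d0 (ltW a0) jmin; rewrite kv; lra.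
exists (move_along h j s); last by rewrite dist_move_along.
split; first by move=> i; apply: le_trans (move_along_ge h j i ss0); exact: h0.
pose z := move_along k j s.
have zo : open_orthant z by move=> i; apply: lt_le_trans (ko i) (move_along_ge k j i ss0).
apply: (@le_trans _ _ (G z)); last first.
  by apply: leG => [i|i]; [exact: ltW | rewrite [leLHS]mxE [leRHS]mxE lerD2r].
have zv : vol_of z = (1 + s / a) * mu^-1 by rewrite prod_move_along ?gt_eqF// kv.
have sa1 : s / a <= 1 by rewrite ler_pdivrMr// mul1r.
have z2 : vol_of z <= 2 / mu by rewrite zv ler_wpM2r//; lra.
have muz : mu * vol_of z = 1 + s / a by rewrite zv mulrCA mulfV ?mulr1 ?gt_eqF.
have [sa'|sa'] := leP a (C * eta).
  have := boundG zo; rewrite muz ler_norml => /andP[+ _].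
  have -> : s = a by rewrite /s min_r.
  rewrite divff ?gt_eqF//.
  have : eps * (1 + vol_of z) <= 4^-1.
    by apply: le_trans eps_small; apply: ler_wpM2l => //; lra.
  lra.
have sE : s = C * eta by rewrite /s min_l// ltW.
have za i : a <= z 0 i by apply: le_trans (jmin i) (move_along_ge k j i ss0).
have := near_away zo z2 a0 za; rewrite muz ler_norml => /andP[+ _].
have := shift_gain a0 a1; rewrite -sE.
have -> : s / (2 * a) = s / a / 2 by rewrite invfM; lra.
have : 0 <= s / a by rewrite divr_ge0// ltW.
lra.
Qed.

Lemma hausdorff_level_sets : (hausdorff_dist M H <= (C * eta)%:E)%E.
Proof.
rewrite /hausdorff_dist ge_max; apply/andP; split; apply: ub_ereal_sup => _ [x Hx <-].
  have [y Hy xy] := renewal_near_hyperbolic Hx.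
  apply: (@le_trans _ _ (euclidean_dist x y)%:E); last by rewrite lee_fin.
  by apply: ereal_inf_lbound; exists y.
have [y Hy xy] := hyperbolic_near_renewal Hx.
apply: (@le_trans _ _ (euclidean_dist y x)%:E); last by rewrite lee_fin euclidean_distC.
by apply: ereal_inf_lbound; exists y.
Qed.

(** The bound on the coordinates from above, with a volume bounded below, keeps all the coordinates
    away from 0. *)
Lemma symdiff_level_sets (Rb : R) x : 1 <= Rb -> (forall i, x 0 i <= Rb) ->
    (M `+` H) x ->
  let rho := (2 * mu)^-1 / Rb ^+ d in
  (forall i, rho <= x 0 i) /\
  `|vol_of x - mu^-1| <= (1 + 2 / mu) * (1 + 2 * d%:R / rho) / mu * eta.
Proof.
move=> Rb1 xRb MH rho; have p0 : 0 < mu^-1 by rewrite invr_gt0.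
have p2 : (2 * mu)^-1 = mu^-1 / 2 by rewrite invfM mulrC.
have rho0 : 0 < rho by rewrite divr_gt0 ?exprn_gt0 ?invr_gt0 ?mulr_gt0//; lra.
have fin : open_orthant x -> (2 * mu)^-1 <= vol_of x <= 2 / mu ->
    (vol_of x < mu^-1 /\ 1 <= G x \/ mu^-1 <= vol_of x /\ G x < 1) ->
    (forall i, rho <= x 0 i) /\
  `|vol_of x - mu^-1| <= (1 + 2 / mu) * (1 + 2 * d%:R / rho) / mu * eta.
  move=> xo /andP[xl xu] xG.
  have xrho i : rho <= x 0 i by apply: coord_ge_prod => // k; exact: ltW.
  split => //; have := near_away xo xu rho0 xrho.
  set D := (1 + 2 / mu) * _ => near.
  have -> : vol_of x - mu^-1 = (mu * vol_of x - 1) / mu.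
    by rewrite mulrBl mul1r mulrAC mulfV ?mul1r ?gt_eqF.
  rewrite normrM (gtr0_norm p0) [leRHS]mulrAC ler_pM2r//.
  apply: (@le_trans _ _ `|G x - mu * vol_of x|); last by rewrite [leRHS]mulrC.
  case: xG => -[xv gx].
    have : mu * vol_of x < 1 by rewrite mulrC -ltr_pdivlMr// mul1r.
    by move=> ?; rewrite ltr0_norm ?ger0_norm; lra.
  have : 1 <= mu * vol_of x by rewrite mulrC -ler_pdivrMr// mul1r.
  by move=> ?; rewrite ger0_norm ?ltr0_norm; lra.
case: MH => -[A B].
  by have [xo xl xu] := renewal_out A B; apply: fin => //; [lra|left; split => //; case: A].
have [x0 _] := A.
have [xo xl xu] := renewal_in x0 A B; apply: fin => //; first by rewrite p2; lra.
by right; split => //; rewrite ltNge; apply/negP => ?; apply: B.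
Qed.

End level_sets.

(** * The volume of a hyperbolic layer *)


Section outer_measure.
Context {R : realType} {d : nat}.
Implicit Types (A B : set 'rV[R]_d).

Lemma box_volume_ge0 (a b : 'rV[R]_d) : (forall i, a 0 i <= b 0 i) -> 0 <= box_volume a b.
Proof. by move=> ab; apply: prodr_ge0 => i _; rewrite subr_ge0. Qed.

Lemma lebesgue_rV_ge0 A : (0 <= lebesgue_rV A)%E.
Proof.
apply: le_ereal_inf_tmp => _ [ab [abP _] <-].
by apply: nneseries_ge0 => k _ _; rewrite lee_fin box_volume_ge0.
Qed.

Lemma lebesgue_rV_finite_cover (F : finType) (a b : F -> 'rV[R]_d) A : (0 < d)%N ->
    (forall f i, a f 0 i <= b f 0 i) -> A `<=` \bigcup_f box (a f) (b f) ->
  (lebesgue_rV A <= (\sum_f box_volume (a f) (b f))%:E)%E.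
Proof.
move=> d0 ab Acov.
pose s := [seq (a f, b f) | f <- enum F].
pose u k := nth (0, 0) s k.
have ule k i : (u k).1 0 i <= (u k).2 0 i.
  have [ks|ks] := ltnP k (size s); last by rewrite /u nth_default.
  by rewrite /u; have /mapP[f _ ->] := mem_nth (0, 0) ks; exact: ab.
apply: (@le_trans _ _ (\sum_(k <oo) (box_volume (u k).1 (u k).2)%:E)%E).
  apply: ereal_inf_lbound; exists u => //; split => // y /Acov[f _ yf].
  have fs : (a f, b f) \in s by apply: map_f; rewrite mem_enum.
  by exists (index (a f, b f) s) => //; rewrite /u nth_index.
apply: lime_le.
  by apply: is_cvg_nneseries => k _ _; rewrite lee_fin box_volume_ge0.
near=> n.
have ns : (size s <= n)%N by near: n; exact: nbhs_infty_ge.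
have tail0 : \sum_(size s <= k < n) box_volume (u k).1 (u k).2 = 0.
  rewrite big_nat_cond big1// => k /andP[/andP[sk _] _].
  rewrite /u nth_default//= /box_volume.
  by rewrite (bigD1 (Ordinal d0))//= subrr mul0r.
rewrite sumEFin lee_fin (@big_cat_nat _ _ _ (size s))//= tail0 addr0.
have <- : \sum_(ab <- s) box_volume ab.1 ab.2 =
    \sum_(0 <= k < size s) box_volume (u k).1 (u k).2 by rewrite (big_nth (0, 0)).
by rewrite big_map big_enum.
Unshelve. all: by end_near. Qed.

End outer_measure.

Section geometric_grid.
Context {R : realType}.
Variables (r h : R).
Hypotheses (r0 : 0 < r) (h0 : 0 < h).
Local Notation g := (fun k : nat => r * (1 + h) ^+ k).

Lemma geometric_cell q y : r < y -> y <= r * (1 + q%:R * h) ->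
  exists k : 'I_q, g k < y <= g k.+1.
Proof.
move=> ry yq.
have gq : y <= g q.
  apply: le_trans yq _; rewrite ler_pM2l//.
  have h1 := h0; elim: (q) => [|m IH]; first by rewrite mul0r addr0 expr0.
  rewrite exprS -natr1; apply: le_trans (_ : (1 + h) * (1 + m%:R * h) <= _).
    have : 0 <= m%:R * h * h by rewrite !mulr_ge0// ltW.
    lra.
  by apply: ler_wpM2l => //; lra.
have h1 := h0; have ex : exists k, y <= g k.+1.
  exists q; apply: le_trans gq _; rewrite ler_pM2l// exprS ler_peMl ?exprn_ge0//; lra.
case: (ex_minnP ex) => k yk kmin.
have gk : g k < y.
  case: k kmin yk => [_ _|k kmin _]; first by rewrite expr0 mulr1.
  by rewrite ltNge; apply/negP => /kmin; rewrite ltnn.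
have kq : (k < q)%N.
  rewrite ltnNge; apply/negP => qk; have : g q <= g k.
    by rewrite ler_pM2l// ler_weXn2l//; lra.
  lra.
by exists (Ordinal kq); rewrite gk yk.
Qed.

End geometric_grid.

Section hyperbolic_layer.
Context {R : realType} {d' : nat}.
Local Notation d := d'.+1.

Lemma prod_recl (y : 'rV[R]_d) : \prod_i y 0 i = y 0 ord0 * \prod_(j < d') y 0 (lift ord0 j).
Proof. exact: big_ord_recl. Qed.

(** With cells in geometric progression for all coordinates but the first, the cell of a point
    determines the product of those coordinates up to the factor [(1 + h) ^+ d'], so the first
    coordinate lies in a short interval; all the boxes obtained have the same volume. *)
Lemma grid_cover (r h p e : R) q (A : set 'rV[R]_d) : 0 < r -> 0 < h -> 0 < p -> 0 < e ->
    (forall y, A y -> (forall i, r < y 0 i /\ y 0 i <= r * (1 + q%:R * h)) /\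
      `|\prod_i y 0 i - p| <= e) ->
  (lebesgue_rV A <= ((q%:R * h) ^+ d' * (3 * e + p * d'%:R * h))%:E)%E.
Proof.
move=> r0 h0 p0 e0 AP.
pose g k := r * (1 + h) ^+ k.
pose F := {ffun 'I_d' -> 'I_q}.
pose L (f : F) := \prod_j g (f j).
pose c := (1 + h) ^- d'.
have g0 k : 0 < g k by rewrite mulr_gt0// exprn_gt0//; lra.
have gS k : g k.+1 = g k * (1 + h) by rewrite /g exprSr mulrA.
have L0 f : 0 < L f by apply: prodr_gt0.
have U (f : F) : \prod_j g (f j).+1 = L f / c.
  rewrite /L /c invrK -[d' in (1 + h) ^+ d']card_ord -prodr_const -big_split/=.
  by apply: eq_bigr => j _; rewrite gS.
have c0 : 0 < c by rewrite invr_gt0 exprn_gt0//; lra.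
have c1 : c <= 1.
  by rewrite invf_le1 ?exprn_gt0 ?exprn_ege1//; lra.
have cl : 1 - d'%:R * h <= c.
  rewrite /c -exprVn.
  have hh : 0 <= 1 - (1 + h)^-1 <= 1.
    have i1 : (1 + h)^-1 <= 1 by rewrite invf_le1; lra.
    have i0 : 0 < (1 + h)^-1 by rewrite invr_gt0; lra.
    by apply/andP; lra.
  have := bernoulli_ineq d' hh; have -> : 1 - (1 - (1 + h)^-1) = (1 + h)^-1 by ring.
  apply: le_trans.
  have : 1 - (1 + h)^-1 <= h.
    rewrite -[X in X - _](@divff _ (1 + h)) ?gt_eqF//; last by lra.
    rewrite -[X in _ - X]mul1r -mulrBl addrC addKr ler_pdivrMr; last by lra.
    by rewrite ler_peMr; lra.
  move=> ?; have : d'%:R * (1 - (1 + h)^-1) <= d'%:R * h by apply: ler_wpM2l.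
  lra.
pose a (f : F) : 'rV[R]_d := \row_i if unlift ord0 i is Some j then g (f j)
                              else (p - 2 * e) * c / L f.
pose b (f : F) : 'rV[R]_d := \row_i if unlift ord0 i is Some j then g (f j).+1
                              else (p + e) / L f.
have pc : (p - 2 * e) * c <= p + e by nra.
have ab f i : a f 0 i <= b f 0 i.
  rewrite !mxE; case: (unlift _ _) => [j|].
    by rewrite gS ler_peMr ?ltW//; lra.
  by rewrite ler_pM2r ?invr_gt0.
apply: le_trans (lebesgue_rV_finite_cover (ltn0Sn d') ab _) _.
  move=> y /AP[yi yp].
  have cell (j : 'I_d') : {k : 'I_q | g k < y 0 (lift ord0 j) <= g k.+1}.
    by apply: cid; have [? ?] := yi (lift ord0 j); exact: geometric_cell.
  pose f : F := [ffun j => sval (cell j)].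
  have fP j : g (f j) < y 0 (lift ord0 j) <= g (f j).+1.
    by rewrite ffunE; exact: svalP (cell j).
  exists f => // i; rewrite !mxE; case: unliftP => [j ->//|->].
  have y0 : 0 < y 0 ord0 by have [? _] := yi ord0; lra.
  move: yp; rewrite prod_recl; set V := \prod_(j < d') _.
  have LV : L f <= V.
    by apply: ler_prod => j _; have /andP[/ltW -> _] := fP j; rewrite ltW.
  have VU : V <= L f / c.
    rewrite -U; apply: ler_prod => j _; have /andP[+ ->] := fP j.
    by rewrite andbT => /(lt_trans (g0 _))/ltW.
  rewrite ler_norml => /andP[lo hi]; apply/andP; split.
    rewrite ltr_pdivrMr// -ltr_pdivlMr// -mulrA.
    apply: lt_le_trans (_ : y 0 ord0 * V <= _); last by rewrite ler_pM2l.
    lra.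
  rewrite ler_pdivlMr//; apply: le_trans (_ : y 0 ord0 * V <= _); last by lra.
  by rewrite ler_pM2l.
rewrite lee_fin.
have bv f : box_volume (a f) (b f) = h ^+ d' * (p + e - (p - 2 * e) * c).
  rewrite /box_volume big_ord_recl !mxE unlift_none.
  have -> : \prod_(j < d') (b f 0 (lift ord0 j) - a f 0 (lift ord0 j)) = L f * h ^+ d'.
    rewrite -[d' in h ^+ d']card_ord -prodr_const -big_split/=.
    by apply: eq_bigr => j _; rewrite !mxE liftK gS; ring.
  by field; rewrite gt_eqF.
rewrite (eq_bigr _ (fun f _ => bv f)) sumr_const card_ffun !card_ord -[leLHS]mulr_natl natrX.
rewrite mulrA -exprMn; apply: ler_wpM2l; first by rewrite exprn_ge0// mulr_ge0// ltW.
have : 0 <= d'%:R * h by rewrite mulr_ge0// ltW.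
have : p * (1 - d'%:R * h) <= p * c by rewrite ler_pM2l.
have : e * c <= e * 1 by rewrite ler_pM2l.
lra.
Qed.

End hyperbolic_layer.

Lemma hyperbolic_layer_volume {R : realType} {d : nat} (rho Rb p : R) :
    (0 < d)%N -> 0 < rho -> 0 < p ->
  exists2 C : R, 0 <= C & forall (e : R) (A : set 'rV[R]_d), 0 < e ->
    (forall y, A y -> (forall i, rho <= y 0 i /\ y 0 i <= Rb) /\
      `|\prod_i y 0 i - p| <= e) ->
    (lebesgue_rV A <= (C * e)%:E)%E.
Proof.
case: d => [//|d' _] rho0 p0; pose r := rho / 2; have r0 : 0 < r by rewrite divr_gt0.
(* r * (1 + m) exceeds Rb, so the grid of ratio 1 + 1 / s with s * m cells covers the range. *)
pose m := (Num.truncn (Num.max 0 (Rb / r))).+1.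
exists (m%:R ^+ d' * (3 + p * d'%:R)).
  by rewrite mulr_ge0 ?exprn_ge0// addr_ge0// mulr_ge0// ltW.
move=> e A e0 AP.
pose s := (Num.truncn e^-1).+1; pose h : R := s%:R^-1.
have s0 : 0 < s%:R :> R by rewrite ltr0n.
have h0 : 0 < h by rewrite invr_gt0.
have he : h <= e.
  rewrite -[e]invrK lef_pV2 ?posrE ?invr_gt0//; apply: ltW.
  have ei : 0 <= e^-1 by rewrite invr_ge0 ltW.
  by have /andP[_] := truncn_itv ei.
have qh : (s * m)%:R * h = m%:R by rewrite natrM mulrAC mulfV ?mul1r ?gt_eqF.
have mR : Rb <= r * (1 + m%:R).
  have : Rb / r < m%:R.
    have m0 : 0 <= Num.max 0 (Rb / r) by rewrite le_max lexx.
    have /andP[_] := truncn_itv m0; apply: le_lt_trans.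
    by rewrite le_max lexx orbT.
  by rewrite ltr_pdivrMr//; lra.
apply: le_trans (grid_cover (q := s * m) r0 h0 p0 e0 _) _.
  move=> y /AP[yi ye]; split => // i; have [? ?] := yi i.
  rewrite qh; split; last by lra.
  by rewrite /r; lra.
rewrite qh lee_fin -[leRHS]mulrA; apply: ler_wpM2l; first exact: exprn_ge0.
rewrite [leRHS]mulrDl lerD2l.
by rewrite ler_wpM2l// mulr_ge0// ltW.
Qed.

(** * Rescaling and the lower limits *)


Section rescaling.
Context {R : realType} {d : nat}.
Hypothesis d2 : (2 <= d)%N.
Local Notation idx := {ffun 'I_d -> nat}.
Variables (xi : idx -> R) (mu eps : R) (J : nat).
Hypothesis xi0 : forall m, positive_index m -> 0 <= xi m.
Hypothesis eps0 : 0 < eps.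
Hypothesis dev : forall n : idx, positive_index n ->
  `|partial_sum xi n - mu * vol n| <= eps * @rt R d J * weight J n.
Local Notation N := (scale J : R).
Local Notation rtJ := (@rt R d J).

(** The function whose level set at 1 is the scaled renewal set at [t = scale J ^+ d]. *)
Definition rescaled_sum (y : 'rV[R]_d) := interpolated_sum xi (N *: y) / N ^+ d.

Lemma prodZ (y : 'rV[R]_d) : \prod_i (N *: y) 0 i = N ^+ d * \prod_i y 0 i.
Proof.
rewrite -[d in _ ^+ d]card_ord -prodr_const -big_split/=.
by apply: eq_bigr => i _; rewrite mxE.
Qed.

Lemma scale_ge1 : 1 <= N.
Proof. by rewrite exprn_ege1// ler1n. Qed.

Lemma scale_le_rt : N <= rtJ.
Proof.
have N1 := scale_ge1.
suff : Num.sqrt (N ^+ 2) <= rtJ by rewrite sqrtr_sqr ger0_norm// ltW// scale_gt0.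
rewrite ler_wsqrtr//; exact: ler_weXn2l.
Qed.

Lemma rescaled_dev (y : 'rV[R]_d) B : open_orthant y -> 0 <= B ->
    (forall n : idx, positive_index n -> (forall i, (N *: y) 0 i / 2 <= (n i)%:R) ->
       1 + \sum_i N / (n i)%:R <= B) ->
  `|rescaled_sum y - mu * \prod_i y 0 i| <= eps / rtJ * B * (1 + \prod_i y 0 i).
Proof.
move=> y0 B0 H; have N0 : 0 < N := scale_gt0 J.
have Nd0 : 0 < N ^+ d by rewrite exprn_gt0.
have r0 : 0 < rtJ := rt_gt0 J.
have Ny0 : orthant (N *: y) by move=> i; rewrite mxE mulr_ge0// ltW.
have := @interpolated_sum_dev R d xi mu (N *: y) (eps * rtJ * B) (N ^+ d) Ny0.
rewrite prodZ (_ : N ^+ d * _ / N ^+ d = \prod_i y 0 i) => [key|]; last first.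
  by rewrite mulrAC mulfV ?mul1r ?gt_eqF.
have -> : rescaled_sum y - mu * \prod_i y 0 i =
    (interpolated_sum xi (N *: y) - mu * (N ^+ d * \prod_i y 0 i)) / N ^+ d.
  by rewrite /rescaled_sum; field; rewrite gt_eqF.
rewrite normrM [`|(N ^+ d)^-1|]gtr0_norm ?invr_gt0// ler_pdivrMr//.
have -> : eps / rtJ * B * (1 + \prod_i y 0 i) * N ^+ d =
    eps * rtJ * B * (1 + \prod_i y 0 i).
  by rewrite -(@rt_sqr R d J); field; rewrite gt_eqF.
apply: key => //; first by rewrite !mulr_ge0// ltW.
move=> n n0 ny; apply: le_trans (dev n0) _.
rewrite -!mulrA ler_pM2l// ler_pM2l// [leRHS]mulrC.
apply: ler_wpM2l; last exact: H.
by rewrite addr_ge0// divr_ge0 ?vol_ge0// ltW.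
Qed.

Lemma rescaled_near (y : 'rV[R]_d) : open_orthant y ->
  `|rescaled_sum y - mu * \prod_i y 0 i| <=
    eps / rtJ * (1 + \prod_i y 0 i) * (1 + 2 * \sum_i (y 0 i)^-1).
Proof.
move=> y0; rewrite mulrAC; have N0 : 0 < N := scale_gt0 J.
apply: rescaled_dev => //.
  by rewrite addr_ge0// mulr_ge0// sumr_ge0// => i _; rewrite invr_ge0 ltW.
move=> n n0 ny; rewrite lerD2l mulr_sumr; apply: ler_sum => i _.
have ni : 0 < (n i)%:R :> R by rewrite ltr0n.
have := ny i; rewrite mxE ler_pdivrMr//.
by have := y0 i; rewrite ler_pdivrMr// mulrAC ler_pdivlMr// [2 * _]mulrC.
Qed.

(** The second estimate is coarser but uniform: as [d >= 2], a factor [scale J <= rt J] can be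
    absorbed, and vertices have coordinates at least 1. *)
Lemma rescaled_bound (y : 'rV[R]_d) : open_orthant y ->
  `|rescaled_sum y - mu * \prod_i y 0 i| <=
    eps * (1 + d%:R) * (1 + \prod_i y 0 i).
Proof.
move=> y0; have N0 : 0 < N := scale_gt0 J; have r0 : 0 < rtJ := rt_gt0 J.
have v0 : 0 < \prod_i y 0 i by apply: prodr_gt0.
apply: le_trans (rescaled_dev (B := 1 + d%:R * N) y0 _ _) _.
- by rewrite addr_ge0// mulr_ge0// ltW.
- move=> n n0 _; rewrite lerD2l.
  have -> : d%:R * N = \sum_(i < d) N by rewrite sumr_const card_ord -[RHS]mulr_natl.
  apply: ler_sum => i _; rewrite ler_pdivrMr ?ltr0n//.
  by apply: ler_peMr; [exact: ltW | rewrite ler1n; exact: n0].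
apply: ler_wpM2r; first by lra.
rewrite -mulrA; apply: ler_wpM2l; first exact: ltW.
rewrite mulrC ler_pdivrMr// mulrDl mul1r.
have := scale_ge1; have := scale_le_rt => h1 h2.
by apply: lerD; [lra | apply: ler_wpM2l].
Qed.

Lemma rescaled_mono (x y : 'rV[R]_d) : orthant x -> (forall i, x 0 i <= y 0 i) ->
  rescaled_sum x <= rescaled_sum y.
Proof.
have N0 : 0 < N := scale_gt0 J.
move=> x0 xy; rewrite ler_pM2r ?invr_gt0 ?exprn_gt0//.
apply: le_interpolated_sum => // i; rewrite !mxE; first by rewrite mulr_ge0// ltW.
by rewrite ler_pM2l.
Qed.

Lemma rescaled_axis (x : 'rV[R]_d) i : orthant x -> x 0 i = 0 -> rescaled_sum x = 0.
Proof.
have N0 : 0 < N := scale_gt0 J.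
move=> x0 xz; rewrite /rescaled_sum (@interpolated_sum_axis _ _ _ _ i) ?mul0r//.
  by move=> k; rewrite mxE mulr_ge0// ltW.
by rewrite mxE xz mulr0.
Qed.

Lemma scaled_renewal_setE :
  scaled_renewal_set xi (N ^+ d) = [set y | orthant y /\ 1 <= rescaled_sum y].
Proof.
have N0 : 0 < N := scale_gt0 J; have Nd0 : 0 < N ^+ d by rewrite exprn_gt0.
have -> : scaled_renewal_set xi (N ^+ d) = dilate N^-1 (renewal_set xi (N ^+ d)).
  congr dilate; rewrite powRN -powR_mulrn ?ltW// -powRrM mulfV ?powRr1 ?ltW//.
  by rewrite pnatr_eq0; case: (d) d2.
apply/seteqP; split => [_ [x [x0 Sx] <-]|y [y0 Sy]] /=.
  split; first by move=> i; rewrite mxE mulr_ge0// ltW// invr_gt0.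
  by rewrite /rescaled_sum scalerA mulfV ?gt_eqF// scale1r ler_pdivlMr// mul1r.
exists (N *: y); last by rewrite scalerA mulVf ?gt_eqF// scale1r.
split; first by move=> i; rewrite mxE mulr_ge0// ltW.
by move: Sy; rewrite /rescaled_sum ler_pdivlMr// mul1r.
Qed.

Hypothesis mu0 : 0 < mu.
Hypothesis eps_small : eps * (1 + d%:R) * (1 + 2 / mu) <= 4^-1.

Let d0 : (0 < d)%N. Proof. exact: leq_trans d2. Qed.
Let eta0 : 0 <= eps / rtJ. Proof. by rewrite divr_ge0// ltW// rt_gt0. Qed.
Let e0 : 0 <= eps * (1 + d%:R). Proof. by rewrite mulr_ge0 ?addr_ge0// ltW. Qed.

Lemma hausdorff_renewal :
  ((Num.sqrt (N ^+ d))%:E *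
    hausdorff_dist (scaled_renewal_set xi (N ^+ d)) (hyperbolic_set mu) <=
  (2 * (1 + 2 / mu) * (1 + 2 / mu + 2 * d%:R) * eps)%:E)%E.
Proof.
have r0 : 0 < rtJ := rt_gt0 J.
have key := hausdorff_level_sets d0 mu0 eta0 eps_small e0
  rescaled_mono rescaled_axis rescaled_near rescaled_bound.
rewrite scaled_renewal_setE; apply: le_trans (lee_wpmul2l _ key) _.
  by rewrite lee_fin ltW.
rewrite -EFinM lee_fin [_ * (eps / _)]mulrA mulrC -/rtJ divfK ?gt_eqF//.
Qed.

Lemma symdiff_renewal (K : set 'rV[R]_d) (Rb C : R) : 1 <= Rb ->
    (forall y, K y -> forall i, y 0 i <= Rb) ->
  let rho := (2 * mu)^-1 / Rb ^+ d in
    (forall (e : R) (A : set 'rV[R]_d), 0 < e ->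
      (forall y, A y -> (forall i, rho <= y 0 i /\ y 0 i <= Rb) /\
        `|\prod_i y 0 i - mu^-1| <= e) -> (lebesgue_rV A <= (C * e)%:E)%E) ->
  ((Num.sqrt (N ^+ d))%:E *
    symdiff_dist K (scaled_renewal_set xi (N ^+ d)) (hyperbolic_set mu) <=
  (C * ((1 + 2 / mu) * (1 + 2 * d%:R / rho) / mu) * eps)%:E)%E.
Proof.
move=> Rb1 KRb rho HC.
have r0 : 0 < rtJ := rt_gt0 J.
have rho0 : 0 < rho.
  by rewrite divr_gt0 ?exprn_gt0 ?invr_gt0 ?mulr_gt0//; lra.
have p0 : 0 < mu^-1 by rewrite invr_gt0.
set D := _ / mu.
have D0 : 0 < D.
  rewrite /D mulr_gt0// mulr_gt0//; first lra.
  have : 0 <= d%:R / rho by rewrite divr_ge0// ltW.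
  by rewrite -mulrA; lra.
have e0' : 0 < D * (eps / rtJ) by rewrite mulr_gt0// divr_gt0.
have key := HC _ (K `&` (scaled_renewal_set xi (N ^+ d) `+` hyperbolic_set mu)) e0' _.
apply: le_trans (lee_wpmul2l _ (key _)) _; first by rewrite lee_fin ltW.
  move=> y [Ky]; rewrite scaled_renewal_setE => MH.
  have [yrho yv] := symdiff_level_sets mu0 eta0 eps_small e0
    rescaled_axis rescaled_near rescaled_bound Rb1 (KRb _ Ky) MH.
  by split => // i; split; [exact: yrho | exact: KRb].
rewrite -EFinM lee_fin -/rtJ.
suff -> : rtJ * (C * (D * (eps / rtJ))) = C * D * eps by [].
by field; rewrite gt_eqF.
Qed.

End rescaling.

Section hyperbolic_point.
Context {R : realType} {d : nat} (d0 : (0 < d)%N) (mu : R).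

(** A witness that the hyperbolic set is nonempty, so that distances to it are nonnegative. *)
Definition hyperbolic_point : 'rV[R]_d :=
  \row_i (if i == Ordinal d0 then mu^-1 else 1).

Lemma hyperbolic_pointP : 0 < mu -> hyperbolic_set mu hyperbolic_point.
Proof.
move=> mu0; have p0 : 0 < mu^-1 by rewrite invr_gt0.
split; first by move=> i; rewrite mxE; case: ifP => _; lra.
rewrite (bigD1 (Ordinal d0))//= big1 => [|i /negbTE ij]; last by rewrite mxE ij.
by rewrite mxE eqxx mulr1.
Qed.

End hyperbolic_point.

Section lower_limit.
Context {R : realType}.

Lemma limf_einf_eq0 (f : R -> \bar R) : (forall t, 0 <= f t)%E ->
    (forall e A : R, 0 < e -> exists2 t, A <= t & (f t <= e%:E)%E) ->
  limf_einf f (pinfty_nbhs R) = 0%E.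
Proof.
move=> f0 H; rewrite limf_einfE; apply/eqP; rewrite eq_le; apply/andP; split.
  apply: ub_ereal_sup => _ [V [M [_ MV]] <-].
  apply/lee_addgt0Pr => e e0; rewrite add0e.
  have [t Mt ft] := H e (M + 1) e0; apply: le_trans ft.
  by apply: ereal_inf_lbound; exists t => //; apply: MV; lra.
apply: le_trans (ereal_sup_ubound _); last first.
  by exists setT; [exact: filterT | reflexivity].
by apply: le_ereal_inf_tmp => _ [t _ <-].
Qed.

Lemma exists_scale_ge (A : R) d : (0 < d)%N ->
  exists J1, forall J, (J1 <= J)%N -> A <= scale J ^+ d.
Proof.
move=> d0; exists (Num.truncn (Num.max 0 A)).+1 => J JA.
have m0 : 0 <= Num.max 0 A by rewrite le_max lexx.
have /andP[_ tA] := truncn_itv m0.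
have : A <= (Num.truncn (Num.max 0 A)).+1%:R.
  by apply: le_trans (ltW tA); rewrite le_max lexx orbT.
move=> AJ; apply: le_trans AJ _; apply: (@le_trans _ _ J%:R); first by rewrite ler_nat.
apply: (@le_trans _ _ (scale J)).
  by rewrite /scale -natrX ler_nat; apply: ltnW; exact: ltn_expl.
by apply: ler_eXnr => //; rewrite exprn_ege1// ler1n.
Qed.

End lower_limit.

Section conclusion.
Context {R : realType} {disp : measure_display} {T : measurableType disp}.
Variable P : probability T R.
Variables (d : nat) (d2 : (2 <= d)%N).
Variables (xi : {RV P >-> R}) (X : {ffun 'I_d -> nat} -> {RV P >-> R}) (mu : R).
Hypothesis mu0 : 0 < mu.

Lemma ae_realisation_ge0 :
  (forall m, positive_index m -> same_law (X m) xi) ->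
  {ae P, forall w, 0 <= xi w} ->
  {ae P, forall w, forall m, positive_index m -> 0 <= X m w}.
Proof.
move=> lawX xi0.
pose neg := `]-oo, 0%R[%classic : set R.
have mneg : measurable neg by exact: measurable_itv.
have mpre (Y : {RV P >-> R}) : measurable (Y @^-1` neg).
  by rewrite -[_ @^-1` _]setTI; exact: (measurable_funP Y).
have negxi : P (xi @^-1` neg) = 0%E.
  suff : P.-negligible (xi @^-1` neg) by move/negligibleP => ->.
  apply: negligibleS xi0 => w /=; rewrite /neg /= in_itv/= => xw.
  by apply/negP; rewrite -ltNge.
have H (k : nat) : {ae P, forall w, forall m, unpickle k = Some m -> positive_index m -> 0 <= X m w}.
  case km : (unpickle k) => [m|]; last by apply: aeW.
  have [pm|npm] := pselect (positive_index m); last first.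
    by apply: aeW => w _ [<-].
  have : P.-negligible (X m @^-1` neg).
    apply/negligibleP; first exact: mpre.
    by rewrite -negxi; exact: (lawX _ pm _ mneg).
  apply: negligibleS => w /= Hw; rewrite /neg /= in_itv/= ltNge; apply/negP => Xw.
  by apply: Hw => _ [<-].
apply: filterS (ae_foralln H) => w Hw m pm; exact: (Hw (pickle m) m (pickleK m)).
Qed.

Lemma centred_square_integrable :
  P.-integrable [set: T] (EFin \o xi) -> ('E_P[xi] = mu%:E)%E ->
  ('V_P[xi] < +oo)%E -> integ P (fun w => (xi w - mu) ^+ 2).
Proof.
move=> Ixi Exi; rewrite /variance unlock Exi /= unlock => V.
apply/integrableP; split.
  apply/measurable_EFinP; apply: measurable_funX; exact: measurable_funB.
apply: le_lt_trans V; apply: ge0_le_integral => //.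
- by apply: measurableT_comp => //; apply/measurable_EFinP; apply: measurable_funX; exact: measurable_funB.
- apply/measurable_EFinP; apply: measurable_funM; exact: measurable_funB.
by move=> w _ /=; rewrite lee_fin ger0_norm ?sqr_ge0// expr2.
Qed.

Lemma compact_coord_le (K : set 'rV[R]_d) : compact K ->
  exists2 Rb : R, 1 <= Rb & forall y, K y -> forall i, y 0 i <= Rb.
Proof.
move=> /compact_bounded [M [_ HM]]; exists (Num.max 1 (M + 1)); first by rewrite le_max lexx.
move=> y Ky i; apply: le_trans (ler_norm _) _; rewrite le_max; apply/orP; right.
apply: le_trans (HM (M + 1) _ y Ky); last by lra.
have := @mx_normrE R 1 d y; rewrite /Num.norm /= => ->.
exact: (le_bigmax _ (fun ij : 'I_1 * 'I_d => `|y ij.1 ij.2|) (0, i)).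
Qed.

Hypothesis lawX : forall m, positive_index m -> same_law (X m) xi.
Hypothesis indX : mutually_independent positive_index X.
Hypothesis Ixi : P.-integrable [set: T] (EFin \o xi).
Hypothesis Exi : ('E_P[xi] = mu%:E)%E.
Hypothesis xi_ge0 : {ae P, forall w, 0 <= xi w}.
Hypothesis Vxi : ('V_P[xi] < +oo)%E.
Variable K : set 'rV[R]_d.
Hypothesis cK : compact K.

Let d0 : (0 < d)%N. Proof. exact: leq_trans d2. Qed.

Lemma infinitely_often_close :
  {ae P, forall w, (forall m, positive_index m -> 0 <= X m w) /\
     forall k J0, exists2 J, (J0 <= J)%N &
       forall n : {ffun 'I_d -> nat}, positive_index n ->
         `|partial_sum (fun m => X m w) n - mu * vol n| <=
         k.+1%:R^-1 * @rt R d J * weight J n}.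
Proof.
have exi : ex P xi = mu by rewrite /ex /Rintegral -expectation_def Exi.
have Ixi2 := centred_square_integrable Ixi Exi Vxi.
have H k := good_infinitely_often d0 indX lawX Ixi exi Ixi2 (eps := k.+1%:R^-1)
  (ltac:(by rewrite invr_gt0 ltr0n)).
apply: filterS2 (ae_realisation_ge0 lawX xi_ge0) (ae_foralln H) => w X0 Hw.
split => // k J0; have [J J0J gJ] := Hw k J0; exists J => // n _.
apply: le_trans (gJ n); rewrite /field /csum shift0 -partial_sum_ibox.
by rewrite partial_sum_centered.
Qed.

Lemma small_inverse (c e : R) : 0 < e -> exists k : nat, c * k.+1%:R^-1 <= e.
Proof.
move=> e0; exists (Num.truncn (Num.max 0 (c / e))).
have m0 : 0 <= Num.max 0 (c / e) by rewrite le_max lexx.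
have /andP[_ tA] := truncn_itv m0.
rewrite ler_pdivrMr ?ltr0n// mulrC -ler_pdivrMr//; apply: le_trans (ltW tA).
by rewrite le_max lexx orbT.
Qed.

Lemma liminf_renewal :
  {ae P, forall w,
      limf_einf (fun t : R => (Num.sqrt t)%:E *
        hausdorff_dist (scaled_renewal_set (fun m => X m w) t)
                       (hyperbolic_set mu))%E (pinfty_nbhs R) = 0%E /\
      limf_einf (fun t : R => (Num.sqrt t)%:E *
        symdiff_dist K (scaled_renewal_set (fun m => X m w) t)
                       (hyperbolic_set mu))%E (pinfty_nbhs R) = 0%E}.
Proof.
have p0 : 0 < mu^-1 by rewrite invr_gt0.
apply: filterS infinitely_often_close => w [X0 Hw].
have along (e A c : R) : 0 < e -> exists eps J, [/\ 0 < eps,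
    eps * (1 + d%:R) * (1 + 2 / mu) <= 4^-1, c * eps <= e, A <= scale J ^+ d &
    forall n : {ffun 'I_d -> nat}, positive_index n ->
         `|partial_sum (fun m => X m w) n - mu * vol n| <=
         eps * @rt R d J * weight J n].
  move=> e0.
  have q0 : 0 < (4^-1 : R) by rewrite invr_gt0.
  have [k1 Hk1] := small_inverse ((1 + d%:R) * (1 + 2 / mu)) q0.
  have [k2 Hk2] := small_inverse (Num.max 0 c) e0.
  pose k := maxn k1 k2.
  have kle k' : (k' <= k)%N -> k.+1%:R^-1 <= k'.+1%:R^-1 :> R.
    by move=> kk; rewrite lef_pV2 ?posrE ?ltr0n// ler_nat ltnS.
  have [J1 HJ1] := exists_scale_ge A d0.
  have [J J1J gJ] := Hw k J1.
  have kpos : 0 < k.+1%:R^-1 :> R by rewrite invr_gt0 ltr0n.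
  exists k.+1%:R^-1, J; split => //; last exact: HJ1.
  - apply: le_trans Hk1; rewrite -mulrA mulrC; apply: ler_wpM2l.
      by rewrite mulr_ge0 ?addr_ge0//; lra.
    by apply: kle; exact: leq_maxl.
  - apply: le_trans Hk2; apply: (@le_trans _ _ (Num.max 0 c * k.+1%:R^-1)).
      by apply: ler_wpM2r; [exact: ltW | rewrite le_max lexx orbT].
    apply: ler_wpM2l; first by rewrite le_max lexx.
    by apply: kle; exact: leq_maxr.
have hd0 t : (0 <= hausdorff_dist (scaled_renewal_set (X^~ w) t) (hyperbolic_set mu))%E.
  rewrite /hausdorff_dist le_max; apply/orP; right.
  apply: le_trans (ereal_sup_ubound _); last by exists (hyperbolic_point d0 mu); [exact: hyperbolic_pointP|reflexivity].
  by apply: le_ereal_inf_tmp => _ [y _ <-]; rewrite lee_fin sqrtr_ge0.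
have s0 (t : R) : (0 <= (Num.sqrt t)%:E)%E by rewrite lee_fin sqrtr_ge0.
split; apply: limf_einf_eq0 => [t|e A e0].
- by apply: mule_ge0.
- have [eps [J [eps0 es ec eA dev]]] := along e A (2 * (1 + 2 / mu) * (1 + 2 / mu + 2 * d%:R)) e0.
  exists (scale J ^+ d) => //.
  by apply: le_trans (hausdorff_renewal d2 X0 eps0 dev mu0 es) _; rewrite lee_fin; exact: ec.
- by apply: mule_ge0 => //; exact: lebesgue_rV_ge0.
have [Rb Rb1 KRb] := compact_coord_le cK.
have rho0 : 0 < (2 * mu)^-1 / Rb ^+ d.
  by rewrite divr_gt0 ?exprn_gt0 ?invr_gt0 ?mulr_gt0//; lra.
have [C C0 HC] := @hyperbolic_layer_volume R d ((2 * mu)^-1 / Rb ^+ d) Rb mu^-1 d0 rho0 p0.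
have [eps [J [eps0 es ec eA dev]]] := along e A (C * ((1 + 2 / mu) * (1 + 2 * d%:R / ((2 * mu)^-1 / Rb ^+ d)) / mu)) e0.
exists (scale J ^+ d) => //.
have := symdiff_renewal d2 eps0 dev mu0 es Rb1 KRb HC.
by move/le_trans; apply; rewrite lee_fin; exact: ec.
Qed.

End conclusion.

Theorem theorem3p4
  (R : realType) (disp : measure_display) (T : measurableType disp)
  (P : probability T R)
  (d : nat) (hd : (2 <= d)%N)
  (xi : {RV P >-> R}) (X : {ffun 'I_d -> nat} -> {RV P >-> R})
  (hX : independent_copies positive_index X xi)
  (hint : P.-integrable [set: T] (EFin \o xi))
  (mu : R) (hmu : ('E_P[xi] = mu%:E)%E) (hmu0 : 0 < mu)
  (hxi0 : {ae P, forall w, 0 <= xi w})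
  (hvar : ('V_P[xi] < +oo)%E)
  (K : set 'rV[R]_d) (hK : compact K) :
  let hausdorff_claim :=
    {ae P, forall w,
      limf_einf (fun t : R => (Num.sqrt t)%:E *
        hausdorff_dist (scaled_renewal_set (fun m => X m w) t)
                       (hyperbolic_set mu))%E (pinfty_nbhs R) = 0%E} in
  let symdiff_claim :=
    {ae P, forall w,
      limf_einf (fun t : R => (Num.sqrt t)%:E *
        symdiff_dist K (scaled_renewal_set (fun m => X m w) t)
                       (hyperbolic_set mu))%E (pinfty_nbhs R) = 0%E} in
  (('E_P[(fun w => xi w ^+ 2 * (log1 `|xi w| ^+ d.-1 / loglog1 `|xi w|))%R]
      < +oo)%E ->
    hausdorff_claim /\ symdiff_claim) /\
  (K `<=` open_orthant -> ('E_P[(fun w => xi w ^+ 2)%R] < +oo)%E ->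
    symdiff_claim).
Proof.
move=> hausdorff_claim symdiff_claim.
have [indX lawX] := hX.
have close := liminf_renewal hd hmu0 lawX indX hint hmu hxi0 hvar hK.
have sc : symdiff_claim by apply: filterS close => w [].
by split=> // _; split => //; apply: filterS close => w [].
Qed.
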